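(* Suppose $Y, Z \subseteq \mathbb{R}$ are non-empty compact sets such that $Y$ contains a non-zero point and $\dim_F(Y)+\dim_H(Z) > 0$. Let $\alpha\in[0,1]$ be such that $\dim_F(Y)+\dim_H(Z) > 1-\alpha$. Then there exists a compact set $R\subseteq(0,\infty)$ such that $\dim_H(R) = \dim_F(R) = \alpha$ and $RY+Z$ has positive Lebesgue measure.
   Context: Here $RY+Z = \{ry+z : r \in R,\ y\in Y,\ z \in Z\}$. For $A \subseteq \mathbb{R}$, $\mathcal{M}(A)$ is the set of non-zero finite Borel measures on $\mathbb{R}$ with compact support contained in $A$. The Fourier transform is $\widehat{\mu}(\xi) = \int e^{-2\pi i x\xi}\,d\mu(x)$. $\dim_H(A)$ is Hausdorff dimension; for Borel $A$ it equals $\sup\{0<s<1 : \iint |x-y|^{-s}d\mu(x)d\mu(y)<\infty \text{ for some } \mu \in \mathcal{M}(A)\}$. The Fourier dimension of a Borel set $A \subseteq \mathbb{R}$ is $\dim_F(A) = \sup\{0<s<1 : \sup_{\xi\in\mathbb{R}} |\widehat{\mu}(\xi)|^2|\xi|^s < \infty \text{ for some } \mu\in\mathcal{M}(A)\}$. The supremum of the empty set is taken to be $0$. *)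

(* Defs.v *)
From HB Require Import structures.
From mathcomp Require Import all_boot all_order all_algebra.
From mathcomp Require Import complex.
From mathcomp Require Import all_classical all_reals all_analysis.
Import Order.TTheory GRing.Theory Num.Theory.
Import numFieldNormedType.Exports.

Set Implicit Arguments.
Unset Strict Implicit.
Unset Printing Implicit Defensive.

Local Open Scope classical_set_scope.
Local Open Scope ring_scope.

(** Hausdorff measure and Hausdorff dimension on the line. *)

(* The supremum is only meaningful for nonempty U (it is -oo for set0). *)
Definition diameter (R : realType) (U : set R) : \bar R :=
  ereal_sup [set d | exists x y, [/\ U x, U y & d = `|x - y|%:E]].

(* |U|^s with the convention |set0|^0 = 0 and |U|^0 = 1 for nonempty U, so that
   the 0-dimensional Hausdorff measure is the counting measure. *)
Definition diam_pow (R : realType) (s : R) (U : set R) : \bar R :=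
  if U == set0 then 0%E else poweR (diameter U) s.

(* The covering sets U n are arbitrary and may be empty, so finite covers are
   included. *)
Definition hausdorff_premeasure (R : realType) (s delta : R) (A : set R)
    : \bar R :=
  ereal_inf [set t | exists U : (set R)^nat,
    [/\ A `<=` \bigcup_n U n,
        forall n, (diameter (U n) <= delta%:E)%E
      & t = (\sum_(0 <= n <oo) diam_pow s (U n))%E]].

Definition hausdorff_measure (R : realType) (s : R) (A : set R) : \bar R :=
  ereal_sup [set hausdorff_premeasure s delta A | delta in [set d | 0 < d]].

(* The real-valued infimum is a true one: the index set is bounded below by 0
   and contains every s > 1. *)
Definition dim_H (R : realType) (A : set R) : R :=
  inf [set s | 0 <= s /\ hausdorff_measure s A = 0%E].

(** Fourier dimension. *)

Definition supp (R : realType) (mu : set (measurableTypeR R) -> \bar R)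
    : set R :=
  [set x | forall U : set R, open U -> U x -> (0 < mu U)%E].

(* M(A) *)
Definition compactly_supported_in (R : realType) (A : set R)
    : set {finite_measure set (measurableTypeR R) -> \bar R} :=
  [set mu | [/\ mu setT != 0%E, compact (supp mu) & supp mu `<=` A]].

(* e^{it} *)
Definition expi (R : realType) (t : R) : R[i] := (cos t +i* sin t)%C.

Definition cintegral (R : realType)
    (mu : {finite_measure set (measurableTypeR R) -> \bar R})
    (f : R -> R[i]) : R[i] :=
  ((\int[mu]_x complex.Re (f x)) +i* (\int[mu]_x complex.Im (f x)))%C.

Definition fourier (R : realType)
    (mu : {finite_measure set (measurableTypeR R) -> \bar R}) (xi : R) : R[i] :=
  cintegral mu (fun x => expi (- (2 * pi * x * xi))).

(* sup of the empty set is 0 here, and the index set is bounded by 1. *)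
Definition dim_F (R : realType) (A : set R) : R :=
  sup [set s | [/\ 0 < s, s < 1 &
    exists2 mu, compactly_supported_in A mu &
      (ereal_sup (range (fun xi : R =>
         (Normc.normc (fourier mu xi) ^+ 2 * `|xi| `^ s)%:E)) < +oo)%E]].

(* Main.v *)
(** The set S is a Cantor set in [1, 2] which at level k consists of about
    2^(alpha k) dyadic intervals: from one level to the next one keeps either
    both halves of every interval or one half of each, the halves being chosen
    by signs. A derandomized Chernoff bound gives signs for which the averages
    over level k and level k + 1 of each of finitely many oscillating functions
    differ by O(k 2^(-alpha k / 2)) times their decay. For phi = cos and sin,
    this gives dim_F S >= alpha, and the spacing of the intervals gives the
    remaining bounds on the dimensions of S.

    Let mu on Y have Fourier decay |x|^(-s/2) (a Dirac mass if dim_F Y = 0),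
    reweighted by sin(c y)^2 so that phi(x) = mu^(x) has an antiderivative with
    the same decay. Choosing S adapted to phi as well, the average over r in S
    of mu^(r x) is O(|x|^(-(s + kappa) / 2)) for every kappa < alpha. With a
    t-Frostman measure on Z, the law of r y + z has a square summable Fourier
    series as soon as s + kappa + t > 1. The law is only used through finite
    families of r and z, for which the sums of the power spectrum are uniformly
    bounded: then SY + Z meets at least a fixed proportion of the cells of any
    fine grid, which is impossible for a compact set of measure zero. *)

From HB Require Import structures.
Require Import Defs.
From mathcomp Require Import all_boot all_order all_algebra.
From mathcomp Require Import ring lra zify.
From mathcomp Require Import complex.
From mathcomp Require Import all_classical all_reals all_analysis measurable_realfun.
Import Order.TTheory GRing.Theory Num.Theory.
Import numFieldNormedType.Exports.
Set Implicit Arguments.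
Unset Strict Implicit.
Unset Printing Implicit Defensive.
Local Open Scope classical_set_scope.
Local Open Scope ring_scope.

(** * Averages over dyadic cells *)

(** The obstacle: the Fourier decay of mu and that of a measure on S, each used alone, give one of
    the two rates for the average of mu^(r x), not their sum. Hence S is built after mu, with mu^
    among the functions to which its signs are fitted. The gain comes from oscillation. Over a cell
    of length 2^-k, the average of phi(r xi) is a difference quotient of the primitive of phi, so
    for xi > 2^k it gains a factor 2^k / xi. The error made at level k is then, up to the factor k
    of the union bound, at most about 2^(-alpha k / 2) xi^-sigma min(1, (2^k / xi)^(1/2)). It is
    largest near 2^k = xi, and the sum over k is xi^(-sigma - alpha / 2) up to powers of log xi;
    these logarithms are the reason for taking kappa < alpha. The primitive in x of the transform of
    mu carries a factor 1 / y, which would be singular near y = 0: this is what the weight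
    repairs. *)

Section calculus.
Context {R : realType}.
Implicit Types (F f : R -> R) (x h L K : R).

(* A quantitative form of F' = f with f Lipschitz. *)
Definition quad_deriv L F f :=
  forall x h, `|F (x + h) - F x - h * f x| <= L * h ^+ 2.

Lemma quad_deriv_is_derive L F f x : quad_deriv L F f -> is_derive x 1 F (f x).
Proof.
move=> FL.
have FE : (fun h => h^-1 *: ((F \o shift x) (h *: 1) - F x)) @ 0^' --> f x.
  apply/cvgrPdist_le => e e0.
  have L0 : 0 <= L by move: (FL 0 1); rewrite expr1n mulr1; exact: le_trans.
  near=> h.
  have h0 : h != 0 by near: h; exact: nbhs_dnbhs_neq.
  have hle : `|h| <= e / (L + 1).
    near: h; apply: dnbhs0_le; rewrite divr_gt0//; lra.
  rewrite /= distrC.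
  have -> : h^-1 *: (F (h *: 1 + x) - F x) - f x = h^-1 * (F (x + h) - F x - h * f x).
    rewrite !/(_ *: _) /= mulr1 (addrC h); field; exact: h0.
  rewrite normrM normfV ler_pdivrMl ?normr_gt0//.
  apply: (le_trans (FL _ _)); rewrite -real_normK ?num_real// expr2 mulrCA.
  rewrite ler_wpM2l//.
  move: hle; rewrite ler_pdivlMr; last lra.
  move=> hle; have : 0 <= `|h| by []. nra.
by split; [exact: cvgP FE|exact: cvg_lim FE].
Unshelve. all: by end_near. Qed.

Lemma quad_deriv_mvi L F f K a b : quad_deriv L F f -> a <= b ->
  (forall x, a <= x <= b -> `|f x| <= K) -> `|F b - F a| <= K * (b - a).
Proof.
move=> FL ab fK.
have dF x : is_derive x 1 F (f x) by exact: quad_deriv_is_derive.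
have [|c cab ->] := @MVT_segment _ F f a b ab.
- apply: derivable_within_continuous => x _; exact: (@ex_derive _ _ _ _ _ _ _ (dF x)).
- by rewrite normrM [X in _ * X]ger0_norm ?subr_ge0// ler_wpM2r ?subr_ge0// fK.
Qed.

Lemma quad_derivZ L F f c : 0 <= c ->
  quad_deriv L F f -> quad_deriv (c * L) (fun x => c * F x) (fun x => c * f x).
Proof.
move=> c0 FL x h.
rewrite (_ : _ - _ = c * (F (x + h) - F x - h * f x)); last ring.
by rewrite normrM ger0_norm// -mulrA ler_wpM2l.
Qed.

Lemma quad_derivB L L' F f G g : quad_deriv L F f -> quad_deriv L' G g ->
  quad_deriv (L + L') (fun x => F x - G x) (fun x => f x - g x).
Proof.
move=> FL GL x h.
rewrite (_ : _ - _ = (F (x + h) - F x - h * f x) - (G (x + h) - G x - h * g x)).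
  by rewrite mulrDl; apply: (le_trans (ler_normB _ _)); exact: lerD.
ring.
Qed.

Lemma quad_deriv_scale L F f c :
  quad_deriv L F f -> quad_deriv (c ^+ 2 * L) (fun x => F (x * c)) (fun x => c * f (x * c)).
Proof.
move=> FL x h; have := FL (x * c) (h * c).
by rewrite -mulrDl -(mulrA h) exprMn (_ : L * _ = c ^+ 2 * L * h ^+ 2) //; ring.
Qed.

(** Adding the estimates for the step from x to y and for the step back cancels [F] and leaves
    [(f x - f y) * (x - y)]. *)
Lemma quad_deriv_lip L F f x y : quad_deriv L F f -> `|f x - f y| <= 2 * L * `|x - y|.
Proof.
move=> FL; have [->|xy] := eqVneq x y; first by rewrite !subrr normr0 mulr0.
have d0 : 0 < `|x - y| by rewrite normr_gt0 subr_eq0.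
rewrite -(ler_pM2r d0) -normrM.
have A := FL x (y - x); have B := FL y (x - y).
rewrite (_ : (f x - f y) * (x - y) =
  (F (x + (y - x)) - F x - (y - x) * f x) + (F (y + (x - y)) - F y - (x - y) * f y)); last first.
  rewrite (_ : x + (y - x) = y); last ring.
  rewrite (_ : y + (x - y) = x); last ring.
  ring.
apply: (le_trans (ler_normD _ _)).
have -> : 2 * L * `|x - y| * `|x - y| = L * (y - x) ^+ 2 + L * (x - y) ^+ 2.
  rewrite -[(x - y) ^+ 2]real_normK ?num_real// -[(y - x) ^+ 2]real_normK ?num_real//.
  by rewrite (distrC y x); ring.
exact: lerD.
Qed.

Lemma cos_lip x y : `|cos x - cos y| <= `|x - y|.
Proof.
wlog xy : x y / x <= y.
  move=> H; have [xy|/ltW yx] := leP x y; first exact: H.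
  by rewrite distrC (distrC x); exact: H.
have [|c _ E] := @MVT_segment R cos (fun x => - sin x) x y xy.
- apply: derivable_within_continuous => z _; exact: ex_derive.
- rewrite distrC E normrM normrN distrC ler_piMl//.
  rewrite ler_norml sin_geN1 sin_le1//.
Qed.

Lemma sin_lip x y : `|sin x - sin y| <= `|x - y|.
Proof.
have := cos_lip (x - pi / 2) (y - pi / 2).
by rewrite !cosBpihalf (_ : x - pi / 2 - (y - pi / 2) = x - y); last ring.
Qed.

Lemma sin_quad : quad_deriv (1 : R) sin cos.
Proof.
move=> x h; rewrite mul1r.
wlog h0 : x h / 0 <= h => [H|].
  have [h0|/ltW h0] := leP 0 h; first exact: H.
  have := H (- x) (- h); rewrite oppr_ge0 -opprD !sinN cosN sqrrN.
  rewrite (_ : _ - _ - _ = - (sin (x + h) - sin x - h * cos x)); last ring.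
  by rewrite normrN; exact.
have [||c cx E] := @MVT_segment R sin cos x (x + h).
- by rewrite lerDl.
- apply: derivable_within_continuous => z _; exact: ex_derive.
- rewrite E (_ : _ - _ = h * (cos c - cos x)); last ring.
  rewrite normrM (ger0_norm h0) expr2 ler_wpM2l//.
  apply: (le_trans (cos_lip _ _)).
  by move: cx; rewrite in_itv/= => /andP[c1 c2]; rewrite ger0_norm; lra.
Qed.

Lemma cos_quad : quad_deriv (1 : R) (fun x => - cos x) sin.
Proof.
move=> x h; have := sin_quad (x - pi / 2) h.
by rewrite (_ : x - pi / 2 + h = x + h - pi / 2) ?sinBpihalf ?cosBpihalf //; ring.
Qed.

End calculus.

(** * Derandomized choice of signs *)

Section signs.
Context {R : realType}.

(** The subgaussian bound for cosh with a cruder constant, from exp x >= 1 + x alone: for |b| <= 1/2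
    it gives exp b <= 1 / (1 - b) and exp (-b) <= 1 / (1 + b), and for larger b already |b| <= 2
    b^2. *)
Lemma expR_avg_le (b : R) : expR b + expR (- b) <= 2 * expR (2 * b ^+ 2).
Proof.
have [b2|b2] := leP `|b| (1/2).
  have [/= bl bu] : - (1/2) <= b /\ b <= 1/2 by apply/andP; rewrite -ler_norml.
  have p1 : expR b <= (1 - b)^-1.
    rewrite -[X in expR X]opprK expRN lef_pV2 ?posrE ?expR_gt0//; last lra.
    exact: expR_ge1Dx.
  have q1 : expR (- b) <= (1 + b)^-1.
    rewrite expRN lef_pV2 ?posrE ?expR_gt0//; last lra.
    exact: expR_ge1Dx.
  have e1 := expR_ge1Dx (2 * b ^+ 2).
  have : (1 - b)^-1 + (1 + b)^-1 <= 2 * (1 + 2 * b ^+ 2).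
    have -> : (1 - b)^-1 + (1 + b)^-1 = 2 / (1 - b ^+ 2).
      by field; apply/and3P; split; apply/eqP; nra.
    rewrite ler_pdivrMr; last nra.
    have : b ^+ 2 <= 1/4 by nra.
    have : 0 <= b ^+ 2 by exact: sqr_ge0.
    move: (b ^+ 2) => t; nra.
  lra.
have b3 : `|b| <= 2 * b ^+ 2.
  rewrite -real_normK ?num_real//; nra.
have : expR b <= expR (2 * b ^+ 2) by rewrite ler_expR (le_trans (ler_norm _)).
have : expR (- b) <= expR (2 * b ^+ 2).
  by rewrite ler_expR (le_trans (ler_norm _))// normrN.
lra.
Qed.

(* Conditional expectations: some sign does not exceed the average of the
   potential over both signs, and the average is controlled by expR_avg_le. *)
Lemma exists_signs (T : Type) (s : seq T) (x : T -> nat -> R) (lam : R) (M : nat) :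
  (forall g i, `|x g i| <= 1) ->
  exists e : nat -> bool,
    \sum_(g <- s) expR (lam * `|\sum_(i < M) (-1) ^+ e i * x g i|)
      <= 2 * (size s)%:R * expR (2 * lam ^+ 2 * M%:R).
Proof.
move=> x1.
(* The potential [ch] dominates exp |z| and, unlike it, factors exactly when averaged over a sign.
   Its value 2 at z = 0 is the 2 in the bound. *)
pose ch (z : R) := expR z + expR (- z).
suff [e He] : exists e : nat -> bool,
    \sum_(g <- s) ch (lam * \sum_(i < M) (-1) ^+ e i * x g i)
      <= 2 * (size s)%:R * expR (2 * lam ^+ 2 * M%:R).
  exists e; apply: le_trans He; apply: ler_sum => g _.
  rewrite /ch; set z := \sum_(i < M) _.
  have [z0|z0] := leP 0 z.
    by rewrite ger0_norm// lerDl expR_ge0.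
  by rewrite ltr0_norm// mulrN lerDr expR_ge0.
elim: M => [|M [e He]].
  exists (fun=> false); rewrite mulr0 expR0 mulr1.
  rewrite (eq_bigr (fun=> 2)) => [|g _]; last by rewrite big_ord0 mulr0 /ch oppr0 expR0.
  by rewrite big_const_seq count_predT iter_addr_0 mulr_natr.
pose A g := lam * \sum_(i < M) (-1) ^+ e i * x g i.
pose B g := lam * x g M.
pose ext b i := if (i < M)%N then e i else b.
have extE b g : lam * \sum_(i < M.+1) (-1) ^+ ext b i * x g i = A g + (-1) ^+ b * B g.
  rewrite big_ord_recr/= mulrDr /ext ltnn; congr (_ + _); last by rewrite /B mulrCA.
  by congr (_ * _); apply: eq_bigr => i _; rewrite ltn_ord.
have key : \sum_(g <- s) ch (A g + B g) + \sum_(g <- s) ch (A g - B g) <=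
    2 * (2 * (size s)%:R * expR (2 * lam ^+ 2 * M.+1%:R)).
  rewrite -big_split/=.
  have -> : expR (2 * lam ^+ 2 * M.+1%:R) =
            expR (2 * lam ^+ 2 * M%:R) * expR (2 * lam ^+ 2).
    by rewrite -expRD; congr expR; rewrite -[M.+1]addn1 natrD mulrDr mulr1.
  apply: (@le_trans _ _ ((\sum_(g <- s) ch (A g)) * (2 * expR (2 * lam ^+ 2)))); last first.
    rewrite [leRHS](_ : _ = 2 * (size s)%:R * expR (2 * lam ^+ 2 * M%:R) * (2 * expR (2 * lam ^+ 2))); last ring.
    by rewrite ler_wpM2r ?mulr_ge0 ?expR_ge0.
  rewrite mulr_suml; apply: ler_sum => g _.
  have -> : ch (A g + B g) + ch (A g - B g) = ch (A g) * (expR (B g) + expR (- B g)).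
    rewrite /ch !opprD opprK !expRD; ring.
  rewrite ler_wpM2l ?addr_ge0 ?expR_ge0//.
  apply: (le_trans (expR_avg_le _)); rewrite ler_wpM2l// ler_expR ler_wpM2l//.
  rewrite /B exprMn ler_piMr ?sqr_ge0// -real_normK ?num_real//.
  by rewrite expr_le1.
have [H|H] := leP (\sum_(g <- s) ch (A g + B g)) (2 * (size s)%:R * expR (2 * lam ^+ 2 * M.+1%:R)).
  exists (ext false); apply: le_trans H.
  by under eq_bigr do rewrite extE expr0 mul1r.
exists (ext true); under eq_bigr do rewrite extE expr1 mulN1r.
lra.
Qed.

End signs.

Section profile.
Context {R : realType}.
Implicit Types (phi Psi : R -> R) (B L sigma xi : R) (k p : nat).

(** [phi] oscillates in the sense that its primitive [Psi] is as small as [phi] itself; averages of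
    [phi (r * xi)] over an interval of length h in r then gain a factor 1 / (h xi). *)
Definition profile B L sigma phi Psi :=
  [/\ quad_deriv L Psi phi,
      forall x, 1 <= x -> `|phi x| <= B * x `^ (- sigma)
    & forall x, 1 <= x -> `|Psi x| <= B * x `^ (- sigma)].

Definition node k p : R := 1 + p%:R / 2 ^+ k.

(* When Psi' = phi, the average of phi (r * xi) over r in the p-th
   dyadic cell of order k in [1, 2]. *)
Definition cell_avg Psi k p xi : R :=
  (Psi (node k p.+1 * xi) - Psi (node k p * xi)) * 2 ^+ k / xi.

Definition half_diff Psi k p xi : R :=
  (cell_avg Psi k.+1 p.*2 xi - cell_avg Psi k.+1 p.*2.+1 xi) / 2.

Lemma exp2_gt0 k : 0 < 2 ^+ k :> R. Proof. exact: exprn_gt0. Qed.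

Lemma exp2_neq0 k : 2 ^+ k != 0 :> R. Proof. by rewrite gt_eqF// exp2_gt0. Qed.

Hint Resolve exp2_gt0 exp2_neq0 : core.

Lemma exp2_ge1 k : 1 <= 2 ^+ k :> R. Proof. by apply: exprn_ege1; rewrite ler1n. Qed.

Lemma nodeS k p : node k p.+1 = node k p + (2 ^+ k)^-1.
Proof. by rewrite /node -[p.+1]addn1 natrD mulrDl mul1r addrA. Qed.

Lemma node_double k p : node k.+1 p.*2 = node k p.
Proof.
rewrite /node -mul2n natrM exprS; congr (_ + _); field.
by rewrite exp2_neq0.
Qed.

Lemma node_ge1 k p : 1 <= node k p.
Proof. by rewrite lerDl divr_ge0// ltW. Qed.

Lemma node_le2 k p : (p <= 2 ^ k)%N -> node k p <= 2.
Proof.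
move=> pk; rewrite /node [leRHS](_ : 2 = 1 + 1 :> R)//.
by rewrite lerD2l ler_pdivrMr// mul1r -natrX ler_nat.
Qed.

Lemma cell_avg_half Psi k p xi :
  cell_avg Psi k p xi =
  (cell_avg Psi k.+1 p.*2 xi + cell_avg Psi k.+1 p.*2.+1 xi) / 2.
Proof. by rewrite /cell_avg -doubleS !node_double exprS; lra. Qed.

Lemma cell_avg_child Psi k p xi (b : bool) :
  cell_avg Psi k.+1 (p.*2 + b) xi =
  cell_avg Psi k p xi + (-1) ^+ b * half_diff Psi k p xi.
Proof.
rewrite (cell_avg_half _ k) /half_diff.
by case: b; rewrite ?addn1 ?addn0 ?expr1 ?expr0; lra.
Qed.

Section bounds.
Variables (B L sigma : R) (phi Psi : R -> R).
Hypothesis prof : profile B L sigma phi Psi.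
Hypothesis sigma_ge0 : 0 <= sigma.
Variable xi : R.
Hypothesis xi_ge1 : 1 <= xi.

Let xi0 : 0 < xi. Proof. exact: lt_le_trans xi_ge1. Qed.

Let B0 : 0 <= B.
Proof.
have [_ /(_ 1 (lexx _))] := prof.
by rewrite powR1 mulr1 => + _; exact: le_trans.
Qed.

Lemma powRN_le r : 1 <= r -> (r * xi) `^ (- sigma) <= xi `^ (- sigma).
Proof.
move=> r1; rewrite !powRN lef_pV2 ?posrE ?powR_gt0 ?mulr_gt0//; last lra.
rewrite ge0_ler_powR ?nnegrE ?mulr_ge0 ?(ltW xi0)//; first lra.
by rewrite ler_pMl.
Qed.

Lemma cell_avg_le k p : `|cell_avg Psi k p xi| <= B * xi `^ (- sigma).
Proof.
have [Pq phiB _] := prof.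
have step : node k p <= node k p.+1 by rewrite nodeS lerDl invr_ge0 ltW.
have := quad_deriv_mvi (quad_deriv_scale xi Pq) step.
move=> /(_ (xi * (B * xi `^ (- sigma)))) H.
have {}H : `|Psi (node k p.+1 * xi) - Psi (node k p * xi)| <=
    xi * (B * xi `^ (- sigma)) * (node k p.+1 - node k p).
  apply: H => r /andP[r1 _]; rewrite normrM gtr0_norm// ler_pM2l//.
  have r1' : 1 <= r by apply: le_trans r1; exact: node_ge1.
  apply: le_trans (phiB _ _) _; first exact: mulr_ege1.
  by rewrite ler_wpM2l// powRN_le.
rewrite /cell_avg 2!normrM (gtr0_norm (exp2_gt0 _)) normfV (gtr0_norm xi0).
rewrite ler_pdivrMr// -ler_pdivlMr//.
apply: (le_trans H); rewrite nodeS (_ : node k p + _ - _ = (2 ^+ k)^-1); last ring.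
by rewrite [xi * _]mulrC.
Qed.

(** Only the values of [Psi] at the two ends enter, without cancellation between them. This beats
    [cell_avg_le] once xi exceeds 2^(k+1). *)
Lemma cell_avg_le_far k p :
  `|cell_avg Psi k p xi| <= 2 * B * xi `^ (- sigma) * (2 ^+ k / xi).
Proof.
have [_ _ PsiB] := prof.
rewrite /cell_avg -mulrA normrM [X in _ * X]gtr0_norm ?divr_gt0//.
rewrite ler_wpM2r ?divr_ge0 ?(ltW xi0)// ?(ltW (exp2_gt0 _))//.
apply: (le_trans (ler_normB _ _)).
have bd q : `|Psi (node k q * xi)| <= B * xi `^ (- sigma).
  have q1 := node_ge1 k q.
  apply: le_trans (PsiB _ _) _; first exact: mulr_ege1.
  by rewrite ler_wpM2l// powRN_le.
by have := bd p; have := bd p.+1; lra.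
Qed.

Lemma cell_avg_close k p r : node k p <= r <= node k p.+1 ->
  `|cell_avg Psi k p xi - phi (r * xi)| <= 3 * L * (xi / 2 ^+ k).
Proof.
move=> /andP[r1 r2]; have [Pq _ _] := prof.
have L0 : 0 <= L by move: (Pq 0 1); rewrite expr1n mulr1; exact: le_trans.
have d0 : 0 < xi / 2 ^+ k by rewrite divr_gt0.
have H1 : `|cell_avg Psi k p xi - phi (node k p * xi)| <= L * (xi / 2 ^+ k).
  have := Pq (node k p * xi) (xi / 2 ^+ k).
  rewrite (_ : node k p * xi + _ = node k p.+1 * xi); last first.
    by rewrite nodeS [RHS]mulrDl [in RHS](mulrC _^-1).
  rewrite (_ : _ - _ - _ =
      (cell_avg Psi k p xi - phi (node k p * xi)) * (xi / 2 ^+ k)); last first.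
    by rewrite /cell_avg; field; rewrite exp2_neq0 gt_eqF.
  by rewrite normrM (gtr0_norm d0) expr2 mulrA ler_pM2r.
have H2 : `|phi (node k p * xi) - phi (r * xi)| <= 2 * L * (xi / 2 ^+ k).
  apply: le_trans (quad_deriv_lip _ _ Pq) _.
  rewrite ler_wpM2l ?mulr_ge0// -mulrBl normrM (gtr0_norm xi0) mulrC.
  rewrite ler_wpM2l ?(ltW xi0)//.
  by move: r2; rewrite nodeS distrC ger0_norm; lra.
have := ler_distD (phi (node k p * xi)) (cell_avg Psi k p xi) (phi (r * xi)).
lra.
Qed.

End bounds.

(** The division by xi does no harm because [Psi (r * xi) / xi] has r-derivative [phi (r * xi)]: the
    mean value inequality only sees a difference of values of [phi], at points r xi and r xi' with r
    <= 2. *)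
Lemma cell_avg_lip B L sigma phi Psi k p xi xi' :
  profile B L sigma phi Psi -> (p < 2 ^ k)%N -> 1 <= xi -> 1 <= xi' ->
  `|cell_avg Psi k p xi - cell_avg Psi k p xi'| <= 4 * L * `|xi - xi'|.
Proof.
move=> [Pq _ _] pk x1 x1'.
have L0 : 0 <= L by move: (Pq 0 1); rewrite expr1n mulr1; exact: le_trans.
have x0 : 0 < xi by lra.
have x0' : 0 < xi' by lra.
pose H r := Psi (r * xi) / xi - Psi (r * xi') / xi'.
pose h r := phi (r * xi) - phi (r * xi').
have Hh : quad_deriv (xi^-1 * (xi ^+ 2 * L) + xi'^-1 * (xi' ^+ 2 * L)) H h.
  have := quad_derivB (quad_derivZ _ (quad_deriv_scale xi Pq)) (quad_derivZ _ (quad_deriv_scale xi' Pq)).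
  move=> /(_ xi^-1 xi'^-1); rewrite !invr_ge0 => /(_ (ltW x0) (ltW x0')).
  move=> + x t => /(_ x t); rewrite /H /h.
  rewrite !mulKf ?gt_eqF//.
  by rewrite ![_^-1 * Psi _]mulrC.
have step : node k p <= node k p.+1 by rewrite nodeS lerDl invr_ge0 ltW.
have := quad_deriv_mvi Hh step => /(_ (4 * L * `|xi - xi'|)) K.
have {}K : `|H (node k p.+1) - H (node k p)| <= 4 * L * `|xi - xi'| * (node k p.+1 - node k p).
  apply: K => r /andP[r1 r2].
  have r3 : 1 <= r by apply: le_trans r1; exact: node_ge1.
  have r4 : r <= 2 by apply: (le_trans r2); exact: node_le2.
  apply: (le_trans (quad_deriv_lip _ _ Pq)).
  rewrite -mulrBr normrM ger0_norm; last lra.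
  have := normr_ge0 (xi - xi'); move: `|_| => t t0.
  have : r * (L * t) <= 2 * (L * t) by rewrite ler_wpM2r// mulr_ge0.
  lra.
have -> : cell_avg Psi k p xi - cell_avg Psi k p xi' =
    (H (node k p.+1) - H (node k p)) * 2 ^+ k.
  by rewrite /cell_avg /H; ring.
rewrite normrM (gtr0_norm (exp2_gt0 _)) -ler_pdivlMr//.
by apply: (le_trans K); rewrite nodeS (_ : node k p + _ - _ = (2 ^+ k)^-1)//; ring.
Qed.

End profile.
#[global] Hint Resolve exp2_gt0 exp2_neq0 : core.

(** * One step of the construction: signs that are good at all frequencies *)

Section random_step.
Context {R : realType}.

(** [half_diff] even decays like 2^k / xi. The square root is enough for the exponents kappa / 2 <=
    1 / 2, and it leaves a spare factor (2^k / xi)^(1/2) that pays for the trivial bound beyond the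
    frequency grid. *)
Definition envelope (sigma : R) k (xi : R) : R :=
  xi `^ (- sigma) * Num.min 1 (Num.sqrt (2 ^+ k / xi)).

Lemma envelope_gt0 sigma k xi : 0 < xi -> 0 < envelope sigma k xi.
Proof.
by move=> xi0; rewrite mulr_gt0 ?powR_gt0// lt_min ltr01 sqrtr_gt0 divr_gt0.
Qed.

Lemma envelope_le sigma k xi xi' : 0 <= sigma -> 0 < xi -> xi <= xi' ->
  envelope sigma k xi' <= envelope sigma k xi.
Proof.
move=> s0 xi0 le; have xi'0 : 0 < xi' by exact: lt_le_trans le.
apply: ler_pM.
- exact: powR_ge0.
- by rewrite le_min ler01 sqrtr_ge0.
- rewrite !powRN lef_pV2 ?posrE ?powR_gt0// ge0_ler_powR// nnegrE ltW//.
- rewrite le_min; apply/andP; split; first by rewrite ge_min lexx.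
  rewrite ge_min; apply/orP; right.
  by rewrite ler_sqrt ?divr_ge0 ?(ltW xi0) ?(ltW (exp2_gt0 _))// ler_pM2l// lef_pV2.
Qed.

Lemma half_diff_le B L sigma phi Psi k p (xi : R) :
  profile B L sigma phi Psi -> 0 <= sigma -> 1 <= xi ->
  `|half_diff Psi k p xi| <= 4 * B * (xi `^ (- sigma) * Num.min 1 (2 ^+ k / xi)).
Proof.
move=> pr s0 x1; set t := xi `^ (- sigma).
have t0 : 0 <= t by exact: powR_ge0.
have A q : `|cell_avg Psi k.+1 q xi| <= B * t by exact: (cell_avg_le pr).
have F q : `|cell_avg Psi k.+1 q xi| <= 4 * (B * t) * (2 ^+ k / xi).
  by apply: (le_trans (cell_avg_le_far pr s0 x1 _ _)); rewrite exprS -/t; lra.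
have Bt0 : 0 <= B * t by exact: le_trans (A 0).
have H c : (forall q, `|cell_avg Psi k.+1 q xi| <= c) -> `|half_diff Psi k p xi| <= c.
  move=> Hc; rewrite /half_diff normrM (ger0_norm (_ : 0 <= 2^-1)) ?invr_ge0//.
  have := ler_normB (cell_avg Psi k.+1 p.*2 xi) (cell_avg Psi k.+1 p.*2.+1 xi).
  have := Hc p.*2; have := Hc p.*2.+1; lra.
rewrite /Num.min; case: ifP => _; rewrite ?mulr1 -/t.
  by apply: (le_trans (H _ A)); lra.
by apply: (le_trans (H _ F)); rewrite le_eqVlt; apply/orP; left; apply/eqP; ring.
Qed.

Lemma half_diff_envelope B L sigma phi Psi k p (xi : R) :
  profile B L sigma phi Psi -> 0 <= sigma -> 1 <= xi ->
  `|half_diff Psi k p xi| <= 4 * B * envelope sigma k xi.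
Proof.
move=> pr s0 x1; apply: (le_trans (half_diff_le k p pr s0 x1)).
have B0 : 0 <= B.
  by have [_ /(_ 1 (lexx _))] := pr; rewrite powR1 mulr1 => + _; exact: le_trans.
rewrite ler_wpM2l ?mulr_ge0// ler_wpM2l ?powR_ge0//.
have y0 : 0 <= 2 ^+ k / xi by rewrite divr_ge0// ltW//; lra.
move: (2 ^+ k / xi) y0 => y y0.
rewrite le_min ge_min lexx/= ge_min.
have [y1|y1] := leP y 1.
  apply/orP; right; rewrite -ler_sqr ?nnegrE ?sqrtr_ge0// sqr_sqrtr//; nra.
by apply/orP; left; rewrite -[leLHS]sqrtr1 ler_sqrt ?(ltW y1)//; lra.
Qed.

Lemma half_diff_lip B L sigma phi Psi k p (xi xi' : R) :
  profile B L sigma phi Psi -> (p < 2 ^ k)%N -> 1 <= xi -> 1 <= xi' ->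
  `|half_diff Psi k p xi - half_diff Psi k p xi'| <= 4 * L * `|xi - xi'|.
Proof.
move=> pr pk x1 x1'.
have p1 : (p.*2 < 2 ^ k.+1)%N by rewrite expnS mul2n ltn_double.
have p2 : (p.*2.+1 < 2 ^ k.+1)%N by rewrite expnS mul2n ltn_Sdouble.
have := cell_avg_lip pr p1 x1 x1'; have := cell_avg_lip pr p2 x1 x1'.
rewrite /half_diff; set a := cell_avg _ _ _ _; set b := cell_avg _ _ _ _.
set c := cell_avg _ _ _ _; set d := cell_avg _ _ _ _ => H1 H2.
have -> : (c - a) / 2 - (d - b) / 2 = ((c - d) - (a - b)) / 2 by lra.
rewrite normrM (ger0_norm (_ : 0 <= 2^-1)) ?invr_ge0//.
have := ler_normB (c - d) (a - b); lra.
Qed.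

Lemma exp2_le_expR n : (2 ^ n)%:R <= expR n%:R :> R.
Proof.
rewrite natrX -[n%:R]mulr1 -(mulrC 1) expRM_natr.
rewrite lerXn2r ?nnegrE ?expR_ge0//.
by apply: le_trans (expR_ge1Dx _); rewrite (_ : 1 + 1 = 2).
Qed.

(* Union bound over the grid 1 + g / 2^6k, g <= 2^9k, which is fine enough for
   the frequencies up to 2^3k; beyond them the trivial bound is good enough. *)
Lemma exists_halves (B L : R) (J : nat) (sigma : 'I_J -> R)
    (phi Psi : 'I_J -> R -> R) (k N : nat) (p : nat -> nat) :
  (forall j, profile B L (sigma j) (phi j) (Psi j)) ->
  (forall j, 0 <= sigma j <= 1) -> 0 < B ->
  (0 < N <= 2 ^ k)%N -> (forall i, (i < N)%N -> (p i < 2 ^ k)%N) ->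
  exists e : nat -> bool, forall j xi, 1 <= xi ->
    `|\sum_(i < N) (-1) ^+ e i * half_diff (Psi j) k (p i) xi| <=
    (12 * (J%:R + 9) * B + 4 * L) * k.+1%:R * Num.sqrt N%:R * envelope (sigma j) k xi.
Proof.
move=> prof s01 B0 /andP[N0 Nk] pN.
have s0 j : 0 <= sigma j by case/andP: (s01 j).
pose grid g : R := 1 + g%:R / 2 ^+ (6 * k).
have grid1 g : 1 <= grid g by rewrite lerDl divr_ge0// ltW.
pose G := [seq (j, g) | j <- enum 'I_J, g <- iota 0 (2 ^ (9 * k)).+1].
pose x (jg : 'I_J * nat) i : R := if (i < N)%N then
  half_diff (Psi jg.1) k (p i) (grid jg.2) / (4 * B * envelope (sigma jg.1) k (grid jg.2)) else 0.
have x1 jg i : `|x jg i| <= 1.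
  rewrite /x; case: ifP => _; last by rewrite normr0.
  have e0 : 0 < 4 * B * envelope (sigma jg.1) k (grid jg.2).
    by rewrite mulr_gt0 ?envelope_gt0 ?mulr_gt0// (lt_le_trans _ (grid1 _)).
  rewrite normrM normfV (gtr0_norm e0) ler_pdivrMr// mul1r.
  exact: (half_diff_envelope _ _ (prof jg.1)).
(* [Lam] bounds the logarithm of the number of tests, which is below 2^(J + 9k + 2). With [lam] =
   [Lam] / sqrt N the variance term is 2 Lam^2, so every normalized sum is at most 3 Lam sqrt N; the
   normalization 4 B turns this into the constant 12 (J + 9) B. *)
pose Lam : R := (J%:R + 9) * k.+1%:R.
have Lam9 : 9 <= Lam.
  rewrite /Lam; have : 1 <= k.+1%:R :> R by rewrite ler1n.
  have : 0 <= J%:R :> R by []. nra.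
have NR : 0 < N%:R :> R by rewrite ltr0n.
have sN0 : 0 < Num.sqrt N%:R :> R by rewrite sqrtr_gt0.
pose lam := Lam / Num.sqrt N%:R.
have [e He] := exists_signs G lam N x1.
have sizeG : 2 * (size G)%:R <= expR (Lam ^+ 2).
  rewrite size_allpairs size_iota size_enum_ord.
  apply: (@le_trans _ _ (2 ^ (J + 9 * k + 2))%:R).
    rewrite -natrM ler_nat; move: (9 * k)%N => K; rewrite !expnD.
    have : (J <= 2 ^ J)%N by apply: ltnW; apply: ltn_expl.
    have : (0 < 2 ^ K)%N by rewrite expn_gt0.
    move: (2 ^ J)%N (2 ^ K)%N => a b b0 Ja.
    have h1 := leq_mul Ja (leqnn b); have h2 := leq_mul Ja b0.
    rewrite mulnS (_ : 2 ^ 2 = 4)%N//; move: h1 h2; rewrite muln1; lia.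
  apply: le_trans (exp2_le_expR _) _; rewrite ler_expR.
  apply: (@le_trans _ _ Lam); last nra.
  rewrite /Lam -natrD -natrM ler_nat; nia.
have gridb j g : (g <= 2 ^ (9 * k))%N ->
    `|\sum_(i < N) (-1) ^+ e i * half_diff (Psi j) k (p i) (grid g)| <=
    3 * Lam * Num.sqrt N%:R * (4 * B * envelope (sigma j) k (grid g)).
  move=> gk; set c := 4 * B * _.
  have c0 : 0 < c.
    by rewrite mulr_gt0 ?envelope_gt0 ?mulr_gt0// (lt_le_trans _ (grid1 _)).
  have jgG : (j, g) \in G.
    by apply: allpairs_f; rewrite ?mem_enum// mem_iota add0n ltnS.
  set S := \sum_(i < N) _.
  have SE : \sum_(i < N) (-1) ^+ e i * x (j, g) i = S / c.
    rewrite /S mulr_suml; apply: eq_bigr => i _.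
    by rewrite /x ltn_ord /= mulrA.
  have : expR (lam * `|S / c|) <= expR (3 * Lam ^+ 2).
    rewrite -SE; apply: (@le_trans _ _ (\sum_(g <- G) expR (lam * `|\sum_(i < N) (-1) ^+ e i * x g i|))).
      by rewrite (big_rem _ jgG)/= lerDl sumr_ge0// => ? _; exact: expR_ge0.
    apply: (le_trans He).
    have -> : 2 * lam ^+ 2 * N%:R = 2 * Lam ^+ 2.
      by rewrite /lam expr_div_n sqr_sqrtr ?ltW// -mulrA divfK ?gt_eqF.
    rewrite (_ : 3 * Lam ^+ 2 = Lam ^+ 2 + 2 * Lam ^+ 2); last ring.
    by rewrite expRD ler_wpM2r ?expR_ge0.
  rewrite ler_expR /lam normrM normfV (gtr0_norm c0).
  move=> H; have {}H : Lam * (`|S| / (Num.sqrt N%:R * c)) <= Lam * (3 * Lam).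
    rewrite invfM (_ : Lam * (3 * Lam) = 3 * Lam ^+ 2); last ring.
    by apply: le_trans H; rewrite le_eqVlt; apply/orP; left; apply/eqP; ring.
  move: H; rewrite ler_pM2l; last lra.
  rewrite ler_pdivrMr; last by rewrite mulr_gt0.
  by rewrite mulrA.
exists e => j xi xi1; set S := \sum_(i < N) _; set E := envelope _ _ _.
have xi0 : 0 < xi by lra.
have L0 : 0 <= L.
  by have [/(_ 0 1) + _ _] := prof j; rewrite expr1n mulr1; exact: le_trans.
have E0 : 0 < E by exact: envelope_gt0.
have sN1 : 1 <= Num.sqrt N%:R :> R by rewrite -[leLHS]sqrtr1 ler_sqrt// ler1n.
have NS : N%:R = Num.sqrt N%:R * Num.sqrt N%:R :> R by rewrite -expr2 sqr_sqrtr.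
have Nk2 : N%:R <= 2 ^+ k :> R by rewrite -natrX ler_nat.
have pref0 : 0 <= k.+1%:R * Num.sqrt N%:R * E :> R by rewrite mulr_ge0 ?(ltW E0)// mulr_ge0 ?sqrtr_ge0.
have pref1 : Num.sqrt N%:R * E <= k.+1%:R * Num.sqrt N%:R * E.
  by rewrite -mulrA ler_peMl ?ler1n// mulr_ge0 ?sqrtr_ge0 ?(ltW E0).
have [xik|xik] := leP xi (2 ^+ (3 * k)).
  (* Rounding upwards: the envelope decreases in xi, so its value at the grid point is at most
     [E]. *)
  pose g := (Num.truncn ((xi - 1) * 2 ^+ (6 * k))).+1.
  have y0 : 0 <= (xi - 1) * 2 ^+ (6 * k) by rewrite mulr_ge0 ?subr_ge0// ltW.
  have /andP[g1 g2] := truncn_itv y0.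
  have gk : (g <= 2 ^ (9 * k))%N.
    rewrite /g -(ltr_nat R) (le_lt_trans g1)// natrX.
    have -> : (9 * k = 3 * k + 6 * k)%N by rewrite -mulnDl.
    by rewrite (exprD _ (3 * k)) ltr_pM2r//; lra.
  have xig : xi <= grid g.
    by rewrite /grid -lerBlDl ler_pdivlMr// ltW.
  have gxi : grid g - xi <= (2 ^+ (6 * k))^-1.
    rewrite /grid /g -[_.+1]addn1 natrD mulrDl mul1r.
    by move: g1; rewrite -ler_pdivrMr//; lra.
  have Hg := gridb j g gk.
  have D : `|S - \sum_(i < N) (-1) ^+ e i * half_diff (Psi j) k (p i) (grid g)| <=
      N%:R * (4 * L * (2 ^+ (6 * k))^-1).
    rewrite /S -sumrB; apply: (le_trans (ler_norm_sum _ _ _)).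
    apply: (@le_trans _ _ (\sum_(i < N) (4 * L * (2 ^+ (6 * k))^-1))); last first.
      by rewrite sumr_const card_ord (mulr_natl _ N).
    apply: ler_sum => i _; rewrite -mulrBr normrM normrX normrN1 expr1n mul1r.
    apply: le_trans (half_diff_lip (prof j) (pN _ (ltn_ord i)) xi1 (grid1 _)) _.
    by rewrite ler_wpM2l ?mulr_ge0// distrC ger0_norm// subr_ge0.
  (* For xi <= 2^3k and sigma <= 1 the two factors of [E] are at least 2^-3k and 2^-k. The rounding
     error N 2^-6k, with N <= 2^k, is therefore below sqrt N times [E]. *)
  have Elow : (2 ^+ (4 * k))^-1 <= E.
    rewrite /E /envelope (_ : 4 * k = 3 * k + k)%N; last by rewrite mulSnr.
    rewrite (exprD _ (3 * k)) invfM; apply: ler_pM; rewrite ?invr_ge0 ?(ltW (exp2_gt0 _))//.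
      rewrite powRN lef_pV2 ?posrE ?powR_gt0//.
      apply: le_trans xik; rewrite -[leRHS]powRr1 ?(ltW xi0)//.
      by rewrite ler_powR//; case/andP: (s01 j).
    rewrite le_min; apply/andP; split; first by rewrite invf_le1// exp2_ge1.
    rewrite -ler_sqr ?nnegrE ?sqrtr_ge0 ?invr_ge0 ?(ltW (exp2_gt0 _))//.
    rewrite sqr_sqrtr ?divr_ge0 ?(ltW xi0) ?(ltW (exp2_gt0 _))//.
    rewrite ler_pdivlMr//; apply: (@le_trans _ _ ((2 ^+ k)^-1 ^+ 2 * 2 ^+ (3 * k))).
      by rewrite ler_pM2l// exprn_gt0// invr_gt0.
    rewrite (_ : 3 * k = k + k + k)%N; last by rewrite !mulSn mul0n addn0 addnA.
    by rewrite (exprD _ (k + k)) (exprD _ k) le_eqVlt; apply/orP; left; apply/eqP; field.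
  have D2 : N%:R * (4 * L * (2 ^+ (6 * k))^-1) <= 4 * L * (Num.sqrt N%:R * E).
    rewrite mulrCA ler_wpM2l ?mulr_ge0//.
    rewrite {1}NS -mulrA ler_wpM2l ?(ltW sN0)//.
    apply: le_trans Elow.
    have -> : (2 ^+ (6 * k))^-1 = (2 ^+ k)^-1 * ((2 ^+ k)^-1 * (2 ^+ (4 * k))^-1) :> R.
      by rewrite (_ : 6 * k = k + (k + 4 * k))%N; [rewrite (exprD _ k) (exprD _ k) !invfM|rewrite !mulSn].
    apply: (@le_trans _ _ ((2 ^+ k)^-1 * (2 ^+ (4 * k))^-1)).
      rewrite (mulrA (Num.sqrt _)) ler_piMl ?mulr_ge0 ?invr_ge0 ?(ltW (exp2_gt0 _))//.
      rewrite ler_pdivrMr// mul1r; apply: le_trans Nk2; rewrite [leRHS]NS.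
      by rewrite ler_peMr// ltW.
    rewrite ler_piMl ?invr_ge0 ?(ltW (exp2_gt0 _))//.
    by rewrite invf_le1// exp2_ge1.
  have envg : envelope (sigma j) k (grid g) <= E by exact: envelope_le.
  have Hg2 : 3 * Lam * Num.sqrt N%:R * (4 * B * envelope (sigma j) k (grid g)) <=
      12 * (J%:R + 9) * B * (k.+1%:R * Num.sqrt N%:R * E).
    have -> : 3 * Lam * Num.sqrt N%:R * (4 * B * envelope (sigma j) k (grid g)) =
      12 * (J%:R + 9) * B * (k.+1%:R * Num.sqrt N%:R * envelope (sigma j) k (grid g)).
      by rewrite /Lam; ring.
    rewrite ler_wpM2l ?mulr_ge0 ?addr_ge0// ?(ltW B0)//.
    by rewrite ler_wpM2l// mulr_ge0 ?sqrtr_ge0.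
  have D3 : 4 * L * (Num.sqrt N%:R * E) <= 4 * L * (k.+1%:R * Num.sqrt N%:R * E).
    by rewrite ler_wpM2l// mulr_ge0 ?sqrtr_ge0.
  set Q := k.+1%:R * Num.sqrt N%:R * E in Hg2 D3.
  have -> : (12 * (J%:R + 9) * B + 4 * L) * k.+1%:R * Num.sqrt N%:R * E =
     12 * (J%:R + 9) * B * Q + 4 * L * Q by rewrite /Q; ring.
  have := ler_normD (S - \sum_(i < N) (-1) ^+ e i * half_diff (Psi j) k (p i) (grid g))
    (\sum_(i < N) (-1) ^+ e i * half_diff (Psi j) k (p i) (grid g)).
  by rewrite subrK; lra.
(* Beyond the grid 2^k / xi is at most 2^-2k, hence at most 2^-k times its own square root. Since N
   <= 2^k, the termwise bound then suffices whatever the signs are. *)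
have k2xi : 2 ^+ k / xi <= (2 ^+ k)^-1 ^+ 2.
  rewrite ler_pdivrMr//; apply: (@le_trans _ _ ((2 ^+ k)^-1 ^+ 2 * 2 ^+ (3 * k))).
    rewrite (_ : 3 * k = k + k + k)%N; last by rewrite !mulSn mul0n addn0 addnA.
    by rewrite (exprD _ (k + k)) (exprD _ k) le_eqVlt; apply/orP; left; apply/eqP; field.
  by rewrite ler_pM2l ?(ltW xik)// exprn_gt0// invr_gt0.
have y0 : 0 <= 2 ^+ k / xi by rewrite divr_ge0 ?(ltW xi0)// ltW.
have ys : 2 ^+ k / xi <= (2 ^+ k)^-1 * Num.sqrt (2 ^+ k / xi).
  have sq : 2 ^+ k / xi = Num.sqrt (2 ^+ k / xi) * Num.sqrt (2 ^+ k / xi).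
    by rewrite -expr2 sqr_sqrtr.
  rewrite [leLHS]sq ler_wpM2r ?sqrtr_ge0//.
  by rewrite -ler_sqr ?nnegrE ?sqrtr_ge0 ?invr_ge0 ?(ltW (exp2_gt0 _))// sqr_sqrtr.
have sE : xi `^ (- sigma j) * Num.sqrt (2 ^+ k / xi) = E.
  rewrite /E /envelope; congr (_ * _); rewrite min_r//.
  rewrite -[leRHS]sqrtr1 ler_sqrt//; apply: (le_trans k2xi).
  by rewrite expr_le1 ?invr_ge0 ?(ltW (exp2_gt0 _))// invf_le1// exp2_ge1.
have S1 : `|S| <= N%:R * (4 * B * ((2 ^+ k)^-1 * E)).
  apply: (le_trans (ler_norm_sum _ _ _)).
  apply: (@le_trans _ _ (\sum_(i < N) (4 * B * ((2 ^+ k)^-1 * E)))); last first.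
    by rewrite sumr_const card_ord (mulr_natl _ N).
  apply: ler_sum => i _; rewrite normrM normrX normrN1 expr1n mul1r.
  apply: (le_trans (half_diff_le k (p i) (prof j) (s0 j) xi1)).
  rewrite ler_wpM2l ?mulr_ge0 ?(ltW B0)// -sE mulrCA ler_wpM2l ?powR_ge0//.
  by rewrite ge_min; apply/orP; right.
apply: (le_trans S1).
have -> : N%:R * (4 * B * ((2 ^+ k)^-1 * E)) = 4 * B * E * (N%:R / 2 ^+ k) by ring.
have NK1 : N%:R / 2 ^+ k <= 1 :> R by rewrite ler_pdivrMr// mul1r.
apply: (@le_trans _ _ (4 * B * (k.+1%:R * Num.sqrt N%:R * E))).
  rewrite -(mulrA (4 * B)) ler_wpM2l ?mulr_ge0 ?(ltW B0)//.
  apply: le_trans pref1; rewrite mulrC ler_wpM2r ?(ltW E0)//; exact: le_trans sN1.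
have -> : (12 * (J%:R + 9) * B + 4 * L) * k.+1%:R * Num.sqrt N%:R * E =
  (12 * (J%:R + 9) * B + 4 * L) * (k.+1%:R * Num.sqrt N%:R * E) by ring.
rewrite ler_wpM2r//.
have : 0 <= J%:R * B by rewrite mulr_ge0// ltW.
lra.
Qed.

End random_step.

(** * Cantor sets built by choosing halves *)

Lemma powR2_gt1 {R : realType} (c : R) : 0 < c -> 1 < 2 `^ c.
Proof.
move=> c0; have := gt0_ltr_powR c0 (x := 1) (y := 2).
by rewrite powR1 !nnegrE; apply => //; lra.
Qed.

Section cantor_scheme.
Context {R : realType}.
Variable alpha : R.
Hypothesis alpha01 : 0 <= alpha <= 1.

(* At level k the Cantor scheme keeps 2 ^ level k of the 2 ^ k dyadic cells. *)
Definition level k : nat := Num.truncn (alpha * k%:R).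

Definition cells k : nat := (2 ^ level k)%N.

(** [pos k i] is constrained for every i and not only below [cells k], so that monotonicity in i
    holds with no side condition. *)
Definition cantor_scheme (pos : nat -> nat -> nat) :=
  [/\ forall i, pos 0%N i = i,
      forall k i, level k.+1 = level k -> exists b : bool, pos k.+1 i = ((pos k i).*2 + b)%N
    & forall k i, level k.+1 = (level k).+1 -> pos k.+1 i = ((pos k i./2).*2 + odd i)%N].

Lemma level0 : level 0 = 0%N. Proof. by rewrite /level mulr0 truncn0. Qed.

Lemma level_le k : (level k)%:R <= alpha * k%:R.
Proof.
have /andP[a0 _] := alpha01.
by rewrite truncn_le// mulr_ge0.
Qed.

Lemma level_gt k : alpha * k%:R < (level k)%:R + 1.
Proof.
have /andP[a0 _] := alpha01.
by rewrite natr1 truncnS_gt.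
Qed.

Lemma levelS k : level k.+1 = level k \/ level k.+1 = (level k).+1.
Proof.
have /andP[a0 a1] := alpha01.
have le : (level k <= level k.+1)%N.
  by apply: le_truncn; rewrite ler_wpM2l// ler_nat.
have : (level k.+1 < (level k).+2)%N.
  rewrite -(ltr_nat R); apply: (le_lt_trans (level_le _)).
  have := level_gt k; rewrite -[k.+1]addn1 -[(level k).+2]addn2 !natrD; lra.
by move: le; lia.
Qed.

Lemma level_leq k : (level k <= k)%N.
Proof.
by elim: k => [|k IH]; [rewrite level0|case: (levelS k) => ->]; lia.
Qed.

Lemma cells_gt0 k : (0 < cells k)%N. Proof. by rewrite expn_gt0. Qed.

Lemma cells_le k : (cells k <= 2 ^ k)%N.
Proof. by rewrite leq_exp2l// level_leq. Qed.

Lemma cells_powR k : 2 `^ (alpha * k%:R) <= 2 * (cells k)%:R.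
Proof.
rewrite /cells natrX -exprS -powR_mulrn// ler_powR ?ler1n//.
by have := level_gt k; rewrite -[(level k).+1]addn1 natrD; lra.
Qed.

Lemma cells_le_powR k : (cells k)%:R <= 2 `^ (alpha * k%:R).
Proof. by rewrite /cells natrX -powR_mulrn// ler_powR ?ler1n ?level_le. Qed.

Section positions.
Variable pos : nat -> nat -> nat.
Hypothesis posP : cantor_scheme pos.

Lemma pos_lt k i : (i < cells k)%N -> (pos k i < 2 ^ k)%N.
Proof.
have [p0 p1 p2] := posP.
elim: k i => [|k IH] i; first by rewrite /cells level0 p0.
rewrite /cells expnS; case: (levelS k) => E; rewrite E => iN.
  have [b ->] := p1 k i E; have := IH _ iN; case: b; lia.
rewrite p2//; have : (i./2 < cells k)%N by rewrite /cells; move: iN; rewrite expnS; lia.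
move=> /IH; case: (odd i); lia.
Qed.

Lemma pos_mono k i i' : (i < i')%N -> (pos k i < pos k i')%N.
Proof.
have [p0 p1 p2] := posP.
elim: k i i' => [|k IH] i i' ii'; first by rewrite !p0.
case: (levelS k) => E.
  have [b ->] := p1 k i E; have [b' ->] := p1 k i' E; have := IH _ _ ii'; case: b; case: b'; lia.
rewrite !p2//; have [/IH|] := ltnP i./2 i'./2; first by case: (odd i); case: (odd i'); lia.
move=> H; have e : i./2 = i'./2 by lia.
by rewrite e; case oi : (odd i); case oi' : (odd i'); lia.
Qed.

Lemma pos_gap k i i' m : (i + m <= i')%N -> (pos k i + m <= pos k i')%N.
Proof.
elim: m i' => [|m IH] i'; rewrite ?addn0; last first.
  case: i' => [|i']; first lia.
  rewrite addnS ltnS => /IH; have := pos_mono k (ltnSn i'); lia.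
rewrite leq_eqVlt => /predU1P[->//|/(pos_mono k)/ltnW//].
Qed.

Definition cantor_avg (Psi : R -> R) k xi : R :=
  (cells k)%:R^-1 * \sum_(i < cells k) cell_avg Psi k (pos k i) xi.

End positions.

Lemma sum_double (f : nat -> R) n :
  \sum_(i < 2 * n) f i = \sum_(i < n) (f i.*2 + f i.*2.+1).
Proof.
elim: n => [|n IH]; first by rewrite muln0 !big_ord0.
rewrite (_ : 2 * n.+1 = (2 * n).+2)%N; last lia.
by rewrite !big_ord_recr/= IH -addrA mul2n.
Qed.

Lemma cantor_avg_double pos Psi k xi : cantor_scheme pos ->
  level k.+1 = (level k).+1 -> cantor_avg pos Psi k.+1 xi = cantor_avg pos Psi k xi.
Proof.
move=> [p0 p1 p2] E; rewrite /cantor_avg /cells E expnS.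
rewrite (sum_double (fun i => cell_avg Psi k.+1 (pos k.+1 i) xi)).
transitivity ((2 * 2 ^ level k)%:R^-1 *
    \sum_(i < 2 ^ level k) 2 * cell_avg Psi k (pos k i) xi : R).
  congr (_ * _); apply: eq_bigr => i _.
  rewrite !p2// (_ : i.*2./2 = i) ?doubleK// (_ : i.*2.+1./2 = i); last by rewrite /= uphalf_double.
  rewrite /= odd_double addn0 addn1 (cell_avg_half _ k); lra.
rewrite -mulr_sumr natrM invfM mulrACA mulVf ?mul1r//.
Qed.

Lemma cantor_avg_single pos Psi k xi (e : nat -> bool) :
  level k.+1 = level k -> (forall i, pos k.+1 i = ((pos k i).*2 + e i)%N) ->
  cantor_avg pos Psi k.+1 xi = cantor_avg pos Psi k xi +
    (cells k)%:R^-1 * \sum_(i < cells k) (-1) ^+ e i * half_diff Psi k (pos k i) xi.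
Proof.
move=> E pE; have cE : cells k.+1 = cells k by rewrite /cells E.
rewrite /cantor_avg cE -mulrDr -big_split/=.
by congr (_ * _); apply: eq_bigr => i _; rewrite pE cell_avg_child.
Qed.

Lemma geometric_weighted_sum_le (r : R) n : 0 <= r < 1 ->
  \sum_(k < n) k.+1%:R * r ^+ k <= (1 - r)^-1 ^+ 2.
Proof.
move=> /andP[r0 r1].
have E : (1 - r) ^+ 2 * \sum_(k < n) k.+1%:R * r ^+ k =
    1 - n.+1%:R * r ^+ n + n%:R * r ^+ n.+1.
  elim: n => [|n IH]; first by rewrite big_ord0; ring.
  by rewrite big_ord_recr/= mulrDr IH -[n.+2]addn2 -[n.+1]addn1 !natrD !exprD expr1; ring.
have d0 : 0 < (1 - r) ^+ 2 by rewrite exprn_gt0// subr_gt0.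
rewrite exprVn -(ler_pM2l d0) E mulfV ?gt_eqF//.
have h1 : 0 <= r ^+ n by exact: exprn_ge0.
have h2 : n%:R * r ^+ n.+1 <= n.+1%:R * r ^+ n.
  by rewrite ler_pM ?ler_nat ?exprn_ge0// exprS ler_piMl// ltW.
lra.
Qed.

(* The random error at level k is comparable with (cells k) ^ (-1/2) times the
   envelope; since cells k >= 2 ^ (alpha k) / 2 these errors sum geometrically
   as soon as kappa < alpha. *)
Lemma envelope_powR_le (sigma kappa : R) k xi : 0 <= kappa <= 1 -> 1 <= xi ->
  envelope sigma k xi <= xi `^ (- (sigma + kappa / 2)) * (2 `^ (kappa / 2)) ^+ k.
Proof.
move=> /andP[k0 k1] x1; have x0 : 0 < xi by lra.
rewrite /envelope opprD powRD; last by rewrite (gt_eqF x0) implybT.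
rewrite -mulrA ler_wpM2l ?powR_ge0//.
have -> : xi `^ (- (kappa / 2)) * (2 `^ (kappa / 2)) ^+ k = (2 ^+ k / xi) `^ (kappa / 2).
  have xV0 : 0 <= xi^-1 by rewrite invr_ge0 ltW.
  rewrite (powRM _ (ltW (exp2_gt0 k)) xV0) mulrC; congr (_ * _).
    rewrite -(powR_mulrn k (powR_ge0 _ _)) -(powR_mulrn k (ler0n R 2)).
    exact: powRAC.
  by rewrite -(powR_inv1 (ltW x0)) -powRrM mulN1r.
have y0 : 0 < 2 ^+ k / xi by rewrite divr_gt0.
move: (2 ^+ k / xi) y0 => y y0.
have [y1|y1] := leP 1 y.
  by rewrite ge_min; apply/orP; left; rewrite -[leLHS](powRr0 y) ler_powR// divr_ge0.
rewrite ge_min; apply/orP; right; rewrite -powR12_sqrt ?(ltW y0)//.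
by rewrite ger_powR ?y0 ?(ltW y1)//; lra.
Qed.

Section choice.
Variables (B L : R) (J : nat) (sigma : 'I_J -> R) (phi Psi : 'I_J -> R -> R).
Hypothesis prof : forall j, profile B L (sigma j) (phi j) (Psi j).
Hypothesis sigma01 : forall j, 0 <= sigma j <= 1.
Hypothesis B_gt0 : 0 < B.

Let K := 12 * (J%:R + 9) * B + 4 * L.

Lemma exists_cantor_scheme : exists2 pos, cantor_scheme pos &
  forall k j xi, 1 <= xi ->
    `|cantor_avg pos (Psi j) k.+1 xi - cantor_avg pos (Psi j) k xi| <=
    K * k.+1%:R / Num.sqrt (cells k)%:R * envelope (sigma j) k xi.
Proof.
(* The choice of signs is made total in the positions [p], so that it can drive a plain recursion on
   k; the range condition on the positions is discharged afterwards, by [pos_lt]. *)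
have ch k (p : nat -> nat) : {e : nat -> bool |
    (forall i, (i < cells k)%N -> (p i < 2 ^ k)%N) -> forall j xi, 1 <= xi ->
    `|\sum_(i < cells k) (-1) ^+ e i * half_diff (Psi j) k (p i) xi| <=
    K * k.+1%:R * Num.sqrt (cells k)%:R * envelope (sigma j) k xi}.
  apply: cid.
  have [pk|npk] := pselect (forall i, (i < cells k)%N -> (p i < 2 ^ k)%N); last first.
    by exists (fun=> false).
  have [|e He] := exists_halves prof sigma01 B_gt0 _ pk.
    by rewrite cells_gt0 cells_le.
  by exists e.
pose fix pos k : nat -> nat := if k is k'.+1 then
  if level k == level k' then fun i => ((pos k' i).*2 + sval (ch k' (pos k')) i)%N
  else fun i => ((pos k' i./2).*2 + odd i)%N
  else id.
have posS k i : pos k.+1 i = if level k.+1 == level k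
    then ((pos k i).*2 + sval (ch k (pos k)) i)%N else ((pos k i./2).*2 + odd i)%N.
  by rewrite /=; case: ifP.
have posP : cantor_scheme pos.
  split=> [//|k i E|k i E]; rewrite posS E.
    by rewrite eqxx; exists (sval (ch k (pos k)) i).
  by rewrite gtn_eqF.
exists pos => // k j xi x1.
have K0 : 0 <= K.
  have [/(_ 0 1) + _ _] := prof j; rewrite expr1n mulr1 => /(le_trans (normr_ge0 _)) L0.
  by rewrite /K addr_ge0 ?mulr_ge0 ?addr_ge0// ltW.
have x0 : 0 < xi by lra.
have [E|E] := levelS k; last first.
  rewrite (cantor_avg_double _ _ posP E) subrr normr0.
  apply: mulr_ge0; last exact: ltW (envelope_gt0 _ _ x0).
  by rewrite divr_ge0 ?sqrtr_ge0 ?(mulr_ge0 K0).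
rewrite (cantor_avg_single (e := sval (ch k (pos k))) _ _ E); last first.
  by move=> i; rewrite posS E eqxx.
rewrite addrC addKr normrM normfV normr_nat.
have N0 : 0 < (cells k)%:R :> R by rewrite ltr0n cells_gt0.
rewrite ler_pdivrMl//.
have := svalP (ch k (pos k)) (fun i => @pos_lt pos posP k i) j xi x1.
move=> /le_trans; apply; rewrite le_eqVlt; apply/orP; left; apply/eqP.
have s0 : Num.sqrt (cells k)%:R != 0 :> R by rewrite gt_eqF// sqrtr_gt0.
rewrite -[X in X * (_ * _ / _ * _)](sqr_sqrtr (ltW N0)); field; exact: s0.
Qed.

End choice.

Section decay.
Variables (B L sigma kappa : R) (phi Psi : R -> R) (pos : nat -> nat -> nat) (K : R).
Hypothesis prof : profile B L sigma phi Psi.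
Hypothesis sigma01 : 0 <= sigma <= 1.
Hypothesis posK : forall k xi, 1 <= xi ->
    `|cantor_avg pos Psi k.+1 xi - cantor_avg pos Psi k xi| <=
    K * k.+1%:R / Num.sqrt (cells k)%:R * envelope sigma k xi.

(** For kappa = 0, the only possibility when alpha = 0, the average inherits the decay of the single
    cell averages. Otherwise one telescopes over the levels: level 0 is the one cell [1, 2], with
    decay xi^(-sigma - 1), and the increments are bounded by the series of (k + 1) r^k with r =
    2^(-(alpha - kappa) / 2). *)
Lemma cantor_avg_decay : kappa = 0 \/ 0 <= kappa < alpha ->
  exists C, forall k xi, 1 <= xi ->
    `|cantor_avg pos Psi k xi| <= C * xi `^ (- (sigma + kappa / 2)).
Proof.
have /andP[s0 s1] := sigma01; have /andP[a0 a1] := alpha01.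
have B0 : 0 <= B.
  by have [_ /(_ 1 (lexx _))] := prof; rewrite powR1 mulr1 => + _; exact: le_trans.
case=> [->|/andP[k0 ka]].
  exists B => k xi x1; rewrite mul0r addr0 /cantor_avg normrM normfV normr_nat.
  rewrite ler_pdivrMl ?ltr0n ?cells_gt0//.
  apply: (le_trans (ler_norm_sum _ _ _)).
  apply: (@le_trans _ _ (\sum_(i < cells k) B * xi `^ (- sigma))).
    by apply: ler_sum => i _; exact: (cell_avg_le prof).
  by rewrite sumr_const card_ord (mulr_natl _ (cells k)).
have K0 : 0 <= K.
  have := posK 0 (lexx 1); rewrite /cells level0 expn0 sqrtr1 mulr1 divr1.
  move=> /(le_trans (normr_ge0 _)); rewrite pmulr_lge0// envelope_gt0//.
pose r : R := 2 `^ (- ((alpha - kappa) / 2)).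
have r0 : 0 <= r by exact: powR_ge0.
have r1 : r < 1.
  rewrite /r powRN invf_lt1 ?powR_gt0//.
  by apply: powR2_gt1; lra.
pose D := 2 * B + K * 2 * (1 - r)^-1 ^+ 2.
exists D => k xi x1; set t := xi `^ _.
have t0 : 0 <= t by exact: powR_ge0.
have x0 : 0 < xi by lra.
have inc i : `|cantor_avg pos Psi i.+1 xi - cantor_avg pos Psi i xi| <=
    K * 2 * t * (i.+1%:R * r ^+ i).
  apply: (le_trans (posK i x1)).
  have Henv : envelope sigma i xi <= t * (2 `^ (kappa / 2)) ^+ i.
    by apply: envelope_powR_le => //; lra.
  have N0 : 0 < (cells i)%:R :> R by rewrite ltr0n cells_gt0.
  have s0' : 0 < Num.sqrt (cells i)%:R :> R by rewrite sqrtr_gt0.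
  have half : (2 `^ (kappa / 2)) ^+ i <= 2 * r ^+ i * Num.sqrt (cells i)%:R.
    have -> : 2 `^ (kappa / 2) = r * 2 `^ (alpha / 2).
      by rewrite /r -powRD; [congr powR; lra|apply/implyP => _].
    rewrite exprMn -mulrA mulrCA ler_wpM2l ?exprn_ge0// -ler_sqr ?nnegrE ?mulr_ge0 ?exprn_ge0 ?powR_ge0//.
    rewrite exprMn sqr_sqrtr ?(ltW N0)// -exprM -powR_mulrn ?powR_ge0// -powRrM.
    have := cells_powR i; rewrite natrM (_ : alpha / 2 * (i%:R * 2) = alpha * i%:R); last lra.
    lra.
  apply: (@le_trans _ _ (K * i.+1%:R / Num.sqrt (cells i)%:R * (t * (2 `^ (kappa / 2)) ^+ i))).
    by rewrite ler_wpM2l// divr_ge0 ?sqrtr_ge0 ?(mulr_ge0 K0).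
  apply: (@le_trans _ _ (K * i.+1%:R / Num.sqrt (cells i)%:R *
      (t * (2 * r ^+ i * Num.sqrt (cells i)%:R)))).
    apply: ler_wpM2l; first by rewrite divr_ge0 ?sqrtr_ge0 ?(mulr_ge0 K0).
    by rewrite ler_wpM2l.
  by rewrite le_eqVlt; apply/orP; left; apply/eqP; field; rewrite gt_eqF.
have T0 : `|cantor_avg pos Psi 0 xi| <= 2 * B * t.
  rewrite /cantor_avg /cells level0 expn0 big_ord1 invr1 mul1r.
  apply: (le_trans (cell_avg_le_far prof s0 x1 _ _)).
  rewrite -mulrA ler_wpM2l ?mulr_ge0// expr0 mul1r -(powR_inv1 (ltW x0)).
  rewrite -powRD; last by rewrite (gt_eqF x0) implybT.
  by rewrite ler_powR//; lra.
have sum_inc : `|cantor_avg pos Psi k xi| <=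
    2 * B * t + K * 2 * t * \sum_(i < k) i.+1%:R * r ^+ i.
  elim: k => [|k IH]; first by rewrite big_ord0 mulr0 addr0.
  rewrite big_ord_recr/= mulrDr addrA.
  have := ler_normD (cantor_avg pos Psi k.+1 xi - cantor_avg pos Psi k xi) (cantor_avg pos Psi k xi).
  rewrite subrK => /le_trans; apply; rewrite addrC; apply: lerD => //.
apply: (le_trans sum_inc); rewrite /D [leRHS]mulrDl lerD2l.
rewrite mulrAC ler_wpM2r// ler_wpM2l ?mulr_ge0//.
by apply: geometric_weighted_sum_le; rewrite r0.
Qed.

End decay.

End cantor_scheme.

Section powers_of_two.
Context {R : realType}.

Lemma powR2_unbounded (a M : R) : 0 < a -> exists k : nat, M < 2 `^ (a * k%:R).
Proof.
move=> a0; pose m := (Num.truncn `|M|).+1.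
exists (Num.truncn (m%:R / a)).+1.
have Mm : M < m%:R by apply: le_lt_trans (ler_norm M) _; rewrite truncnS_gt.
apply: (lt_le_trans Mm); apply: (@le_trans _ _ (2 `^ m%:R)).
  by rewrite powR_mulrn// -natrX ler_nat ltnW// ltn_expl.
rewrite ler_powR ?ler1n// mulrC -ler_pdivrMr// ltW// truncnS_gt//.
Qed.

Lemma dyadic_scale (d : R) : 0 < d -> d < 1 ->
  exists k, (2 ^+ k.+1)^-1 <= d < (2 ^+ k)^-1.
Proof.
move=> d0 d1.
have ex : exists k, (2 ^+ k)^-1 <= d.
  have [k Hk] := powR2_unbounded d^-1 ltr01.
  exists k; rewrite invf_ple ?posrE// -powR_mulrn//.
  by rewrite mul1r in Hk; exact: ltW.
case: (ex_minnP ex) => -[|k] kd kmin.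
  by move: kd; rewrite expr0 invr1 leNgt d1.
exists k; rewrite kd/= ltNge; apply/negP => /kmin; lia.
Qed.

End powers_of_two.

Section cantor_set.
Context {R : realType}.
Variable alpha : R.
Hypothesis alpha01 : 0 <= alpha <= 1.
Variable pos : nat -> nat -> nat.
Hypothesis posP : cantor_scheme alpha pos.

Let N := cells alpha.

Definition cantor_set : set R := [set x | forall k, exists i,
  (i < cells alpha k)%N /\ node k (pos k i) <= x <= node k (pos k i).+1].

Definition cell_index k (u : R) : nat := Num.truncn ((cells alpha k)%:R * u).

(* The measure on the Cantor set is the law of cantor_map u for u uniform in
   [0, 1[. *)
Definition cantor_map (u : R) : R :=
  sup (range (fun k => node k (pos k (cell_index k u)))).

Lemma truncn_double (x : R) : (Num.truncn (2 * x))./2 = Num.truncn x.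
Proof.
have [x0|x0] := leP 0 x; last first.
  have /truncn0Pn -> : ~~ (1 <= 2 * x) by rewrite -ltNge; lra.
  by have /truncn0Pn -> : ~~ (1 <= x) by rewrite -ltNge; lra.
have /andP[h1 h2] := truncn_itv x0.
have x20 : 0 <= 2 * x by lra.
have : (Num.truncn (2 * x) < 2 * (Num.truncn x).+1)%N.
  by rewrite truncn_lt_nat// natrM ltr_pM2l.
have : (2 * Num.truncn x <= Num.truncn (2 * x))%N.
  by rewrite truncn_ge_nat// natrM ler_pM2l.
by lia.
Qed.

Let approx k u := node k (pos k (cell_index k u)) : R.

Lemma approxS k u : approx k u <= approx k.+1 u <= approx k u + (2 ^+ k.+1)^-1.
Proof.
have [p0 p1 p2] := posP; rewrite /approx.
suff [b ->] : exists b : bool, pos k.+1 (cell_index k.+1 u) = ((pos k (cell_index k u)).*2 + b)%N.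
  by case: b; rewrite ?addn1 ?addn0 ?nodeS node_double; rewrite lexx ?lerDl ?lerDr ?andbT ?invr_ge0// ltW.
have [E|E] := levelS alpha01 k.
  have [b ->] := p1 k (cell_index k.+1 u) E; exists b.
  by rewrite {1}/cell_index /cells E.
rewrite p2//; exists (odd (cell_index k.+1 u)).
rewrite (_ : (cell_index k.+1 u)./2 = cell_index k u)//.
by rewrite /cell_index /cells E expnS natrM -mulrA truncn_double.
Qed.

(** The subtracted term says that the whole cell of order k + m, not only its left end, lies in the
    cell of order k; this makes the induction close. *)
Lemma approx_le k m u : approx k u <= approx (k + m) u <= approx k u + (2 ^+ k)^-1 - (2 ^+ (k + m))^-1.
Proof.
elim: m => [|m /andP[IH1 IH2]]; first by rewrite addn0 lexx addrK lexx.
have /andP[h1 h2] := approxS (k + m) u; rewrite addnS (le_trans IH1 h1)/=.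
apply: (le_trans h2); rewrite exprS invfM; lra.
Qed.

Lemma approx_ub m k u : approx m u <= approx k u + (2 ^+ k)^-1.
Proof.
have [km|mk] := leqP k m.
  have /andP[_] := approx_le k (m - k) u; rewrite subnKC//.
  have : 0 <= (2 ^+ m)^-1 :> R by rewrite invr_ge0 ltW.
  lra.
have /andP[+ _] := approx_le m (k - m) u; rewrite subnKC ?(ltnW mk)//.
have : 0 <= (2 ^+ k)^-1 :> R by rewrite invr_ge0 ltW.
lra.
Qed.

Lemma cantor_map_bounds k u :
  node k (pos k (cell_index k u)) <= cantor_map u <= node k (pos k (cell_index k u)).+1.
Proof.
apply/andP; split.
  apply: ub_le_sup; last by exists k.
  by exists (approx 0 u + (2 ^+ 0)^-1) => _ [m _ <-]; exact: approx_ub.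
apply: ge_sup; first by exists (approx 0 u); exists 0%N.
by move=> _ [m _ <-]; rewrite nodeS; exact: approx_ub.
Qed.

Lemma cell_index_lt k u : 0 <= u < 1 -> (cell_index k u < cells alpha k)%N.
Proof.
move=> /andP[u0 u1]; rewrite truncn_lt_nat ?mulr_ge0// gtr_pMr// ltr0n.
exact: cells_gt0.
Qed.

Lemma cantor_map_in u : 0 <= u < 1 -> cantor_set (cantor_map u).
Proof.
move=> u01 k; exists (cell_index k u); split; first exact: cell_index_lt.
exact: cantor_map_bounds.
Qed.

Lemma cantor_map_nondecreasing : {homo cantor_map : u v / u <= v}.
Proof.
move=> u v uv; apply: ge_sup; first by exists (approx 0 u); exists 0%N.
move=> _ [k _ <-].
have /andP[+ _] := cantor_map_bounds k v; apply: le_trans.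
rewrite /node lerD2l ler_wpM2r ?invr_ge0 ?(ltW (exp2_gt0 _))// ler_nat.
have : (cell_index k u <= cell_index k v)%N by rewrite le_truncn// ler_wpM2l.
by rewrite leq_eqVlt => /predU1P[->//|/(pos_mono alpha01 posP k)/ltnW].
Qed.

Lemma cantor_set_bounds : cantor_set `<=` `[1, 2]%classic.
Proof.
move=> x /(_ 0%N) [i [iN /andP[x1 x2]]]; rewrite /= in_itv/=; apply/andP; split.
  by apply: le_trans x1; exact: node_ge1.
apply: (le_trans x2); apply: node_le2.
exact: (pos_lt alpha01 posP).
Qed.

Lemma cantor_set_compact : compact cantor_set.
Proof.
apply: (subclosed_compact _ (@segment_compact R 1 2)); last exact: cantor_set_bounds.
rewrite (_ : cantor_set = \bigcap_k \bigcup_(i in `I_(cells alpha k))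
    `[node k (pos k i), node k (pos k i).+1]%classic).
  apply: closed_bigI => k _; apply: closed_bigcup; first exact: finite_II.
  by move=> i _; exact: itv_closed.
apply/seteqP; split => x.
  by move=> H k _; have [i [iN xi]] := H k; exists i => //=; rewrite in_itv.
by move=> H k; have [i iN /=] := H k Logic.I; rewrite in_itv/= => xi; exists i.
Qed.

(** Indices that differ by 2 or more are separated by a full cell of width 2^-k. So the indices of u
    and v differ by at most 1, and |u - v| is at most 2 / [cells k]. *)
Lemma cantor_map_close k u v : 0 <= u -> 0 <= v ->
  `|cantor_map u - cantor_map v| < (2 ^+ k)^-1 ->
  `|u - v| <= 4 * 2 `^ (- (alpha * k%:R)).
Proof.
wlog uv : u v / u <= v.
  move=> H u0 v0; have [uv|/ltW vu] := leP u v; first exact: H.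
  by rewrite distrC (distrC u); exact: H.
move=> u0 v0 d.
have N0 : 0 < (cells alpha k)%:R :> R by rewrite ltr0n cells_gt0.
have iv : (cell_index k v <= (cell_index k u).+1)%N.
  rewrite leqNgt; apply/negP => h.
  have /(pos_gap alpha01 posP k) : (cell_index k u + 2 <= cell_index k v)%N by rewrite addn2.
  rewrite -(ler_nat R) natrD => g.
  have /andP[_ b1] := cantor_map_bounds k u; have /andP[b2 _] := cantor_map_bounds k v.
  have : node k (pos k (cell_index k u)) + 2 * (2 ^+ k)^-1 <= node k (pos k (cell_index k v)) :> R.
    rewrite -subr_ge0 (_ : _ - _ = ((pos k (cell_index k v))%:R -
        ((pos k (cell_index k u))%:R + 2)) / 2 ^+ k); last by rewrite /node; ring.
    by rewrite divr_ge0 ?subr_ge0// ltW.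
  move: b1 d; rewrite nodeS distrC => b1 /(le_lt_trans (ler_norm _)); lra.
rewrite distrC ger0_norm ?subr_ge0//.
have : (cells alpha k)%:R * (v - u) <= 2.
  have := truncnS_gt ((cells alpha k)%:R * v); rewrite -/(cell_index k v).
  have /andP[+ _] := truncn_itv (mulr_ge0 (ltW N0) u0); rewrite -/(cell_index k u).
  move: iv; rewrite -(ler_nat R) -[(cell_index k v).+1]addn1 -[(cell_index k u).+1]addn1 !natrD; lra.
rewrite -ler_pdivlMl// => /le_trans; apply.
rewrite powRN ler_pdivrMl// mulrA ler_pdivlMr ?powR_gt0//.
have := cells_powR alpha01 k; lra.
Qed.

(** This inverse Hölder bound says that the law of [cantor_map] is an alpha-Frostman measure. The
    constant 8 is the 4 of [cantor_map_close] times a loss of 2^alpha <= 2 for rounding the distance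
    to a dyadic scale. *)
Lemma cantor_map_holder u v : 0 <= u < 1 -> 0 <= v < 1 ->
  `|u - v| <= 8 * `|cantor_map u - cantor_map v| `^ alpha.
Proof.
move=> /andP[u0 u1] /andP[v0 v1]; have /andP[a0 a1] := alpha01.
have uv1 : `|u - v| <= 1 by rewrite ler_norml; lra.
set d := `|cantor_map u - cantor_map v|.
have [d1|d1] := leP 1 d.
  have : 1 `^ alpha <= d `^ alpha by rewrite ge0_ler_powR ?nnegrE//; lra.
  rewrite powR1; lra.
have : 0 <= d by exact: normr_ge0.
rewrite le_eqVlt => /predU1P[d0|d0].
  (* Here the distance is 0. For alpha = 0 the convention that 0 to the power 0 is 1 gives the
     bound; for alpha > 0 closeness at every scale forces u = v. *)
  move: a0; rewrite le_eqVlt => /predU1P[a0|a0]; first by rewrite -a0 powRr0; lra.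
  have [->|uv] := eqVneq u v; first by rewrite subrr normr0 mulr_ge0 ?powR_ge0.
  have uv0 : 0 < `|u - v| by rewrite normr_gt0 subr_eq0.
  have [k] := powR2_unbounded (4 / `|u - v|) a0.
  have := @cantor_map_close k u v u0 v0; rewrite -/d -d0 invr_gt0 => /(_ (exp2_gt0 _)).
  rewrite powRN ler_pdivlMr ?powR_gt0// ltr_pdivrMr// [in X in _ -> X]mulrC; lra.
have [k /andP[k1 k2]] := dyadic_scale d0 d1.
apply: (le_trans (cantor_map_close u0 v0 k2)).
rewrite (_ : 8 = 4 * 2); last lra.
rewrite -mulrA ler_wpM2l//.
have : (2 ^+ k.+1)^-1 `^ alpha <= d `^ alpha.
  by rewrite ge0_ler_powR ?nnegrE ?invr_ge0 ?(ltW d0) ?(ltW (exp2_gt0 _)).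
have -> : (2 ^+ k.+1)^-1 `^ alpha = 2 `^ (- alpha) * 2 `^ (- (alpha * k%:R)) :> R.
  rewrite -powR_invn// -powRrM -powRD; last by rewrite (_ : 2 == 0 = false) ?implybT ?pnatr_eq0.
  by congr powR; rewrite -[k.+1]addn1 natrD; ring.
have h2 : 2^-1 <= 2 `^ (- alpha) :> R.
  by rewrite -powR_inv1// ler_powR ?ler1n//; lra.
have p0 : 0 <= 2 `^ (- (alpha * k%:R)) :> R by exact: powR_ge0.
nra.
Qed.

End cantor_set.

(** * Hausdorff dimension *)

Section hausdorff.
Context {R : realType}.
Implicit Types (A U : set R) (s delta : R).

Lemma diam_pow_ge0 s U : (0 <= diam_pow s U)%E.
Proof. by rewrite /diam_pow; case: ifP => // _; exact: poweR_ge0. Qed.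

Lemma diameter_ge0 U : U !=set0 -> (0 <= diameter U)%E.
Proof.
move=> [x Ux]; apply: ereal_sup_ubound => /=.
by exists x, x; split=> //; rewrite subrr normr0.
Qed.

Lemma diameter_dist U x y : U x -> U y -> (`|x - y|%:E <= diameter U)%E.
Proof. by move=> Ux Uy; apply: ereal_sup_ubound => /=; exists x, y. Qed.

Lemma diameter_le U e : (forall x y, U x -> U y -> `|x - y| <= e) ->
  (diameter U <= e%:E)%E.
Proof.
by move=> H; apply: ge_ereal_sup => _ [x [y [Ux Uy ->]]]; rewrite lee_fin H.
Qed.

Lemma diameter_fin U e : U !=set0 -> (diameter U <= e%:E)%E ->
  exists2 d, diameter U = d%:E & 0 <= d <= e.
Proof.
move=> U0 Ue; have := diameter_ge0 U0.
by move: Ue; case: (diameter U) => [d| |]// h1 h2; exists d; rewrite // -!lee_fin h2.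
Qed.

Lemma diam_pow_le s U e : 0 <= s -> 0 <= e -> (forall x y, U x -> U y -> `|x - y| <= e) ->
  (diam_pow s U <= (e `^ s)%:E)%E.
Proof.
move=> s0 e0 H; rewrite /diam_pow; case: ifPn => [_|/set0P U0].
  by rewrite lee_fin powR_ge0.
have [d -> /andP[d0 de]] := diameter_fin U0 (diameter_le H).
by rewrite poweR_EFin lee_fin ge0_ler_powR.
Qed.

Lemma itvcc_dist a e x y : a <= x <= a + e -> a <= y <= a + e -> `|x - y| <= e :> R.
Proof. by move=> ? ?; rewrite ler_norml; lra. Qed.

Lemma hausdorff_premeasure_ge0 s delta A : (0 <= hausdorff_premeasure s delta A)%E.
Proof.
apply: le_ereal_inf_tmp => _ [U [_ _ ->]].
by apply: nneseries_ge0 => n _ _; exact: diam_pow_ge0.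
Qed.

Lemma hausdorff_premeasure_le s delta A (U : (set R)^nat) :
  A `<=` \bigcup_n U n -> (forall n, (diameter (U n) <= delta%:E)%E) ->
  (hausdorff_premeasure s delta A <= \sum_(0 <= n <oo) diam_pow s (U n))%E.
Proof. by move=> AU Ud; apply: ereal_inf_lbound; exists U. Qed.

Lemma hausdorff_premeasure_finite_cover s delta A M e (a : nat -> R) :
  0 <= s -> 0 <= e <= delta ->
  (forall x, A x -> exists2 i, (i < M)%N & a i <= x <= a i + e) ->
  (hausdorff_premeasure s delta A <= (M%:R * e `^ s)%:E)%E.
Proof.
move=> s0 /andP[e0 ed] cov.
pose U n : set R := if (n < M)%N then [set x | a n <= x <= a n + e] else set0.
have Ud n x y : U n x -> U n y -> `|x - y| <= e.
  by rewrite /U; case: ifP => // _; exact: itvcc_dist.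
apply: le_trans (@hausdorff_premeasure_le s delta A U _ _) _.
- by move=> x /cov [i iM xi]; exists i => //; rewrite /U iM.
- by move=> n; apply: diameter_le => x y /Ud /[apply] /le_trans; exact.
apply: lime_le; first by apply: is_cvg_nneseries => n _ _; exact: diam_pow_ge0.
apply: nearW => n.
apply: (@le_trans _ _ (\sum_(0 <= k < n) (if (k < M)%N then e `^ s else 0)%:E)%E).
  apply: lee_sum => k _; rewrite /U; case: ifP => kM.
    by apply: diam_pow_le => // x y; exact: itvcc_dist.
  by rewrite /diam_pow eqxx.
rewrite sumEFin lee_fin.
suff -> : \sum_(0 <= k < n) (if (k < M)%N then e `^ s else 0) = (minn n M)%:R * e `^ s.
  by rewrite ler_wpM2r ?powR_ge0// ler_nat geq_minr.
elim: n => [|n IH]; first by rewrite big_geq// min0n mul0r.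
rewrite big_nat_recr//= IH; case: ifPn => nM.
  by rewrite !(minn_idPl _) ?(ltnW nM)// -natr1 mulrDl mul1r.
by rewrite addr0 !(minn_idPr _)//; lia.
Qed.

Lemma hausdorff_measure_eq0 s A : 0 <= s ->
  (forall e : R, 0 < e -> exists M r (a : nat -> R),
    [/\ 0 <= r <= e, forall x, A x -> exists2 i, (i < M)%N & a i <= x <= a i + r
      & M%:R * r `^ s <= e]) ->
  hausdorff_measure s A = 0%E.
Proof.
move=> s0 H; apply/eqP; rewrite eq_le; apply/andP; split; last first.
  apply: le_trans (hausdorff_premeasure_ge0 s 1 A) _.
  by apply: ereal_sup_ubound; exists 1 => //=.
apply: ge_ereal_sup => _ [delta /= delta0 <-].
apply/lee_addgt0Pr => e e0; rewrite add0e.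
have [|M [r [a [/andP[r0 re] cov Me]]]] := H (Num.min e delta); first by rewrite lt_min e0.
apply: (le_trans (@hausdorff_premeasure_finite_cover s delta A M r a s0 _ cov)).
  by rewrite r0 (le_trans re)// ge_min lexx orbT.
by rewrite lee_fin (le_trans Me)// ge_min lexx.
Qed.

Lemma hausdorff_measure_eq0_premeasure s delta A : 0 < delta ->
  hausdorff_measure s A = 0%E -> hausdorff_premeasure s delta A = 0%E.
Proof.
move=> d0 H; apply/eqP; rewrite eq_le hausdorff_premeasure_ge0 andbT -H.
by apply: ereal_sup_ubound; exists delta.
Qed.

(* Mass distribution principle for the law of g under the uniform measure. *)
Lemma hausdorff_measure_neq0 s C A (g : R -> R) : 0 <= s -> 0 < C ->
  (forall u, 0 <= u < 1 -> A (g u)) ->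
  (forall u v, 0 <= u < 1 -> 0 <= v < 1 -> `|u - v| <= C * `|g u - g v| `^ s) ->
  hausdorff_measure s A != 0%E.
Proof.
move=> s0 C0 Ag gC; apply/eqP => /(hausdorff_measure_eq0_premeasure ltr01) H.
(* A covering set of diameter d has its preimage in an interval of length 2 C d^s, so a cover of
   cost below 1 / (4 C) would confine the unit interval to length 1/2. *)
have c0 : (0 < ((4 * C)^-1)%:E :> \bar R)%E by rewrite lte_fin invr_gt0 mulr_gt0.
have /ereal_inf_lt[_ [U [AU Ud ->]] Ulow] : (hausdorff_premeasure s 1 A < ((4 * C)^-1)%:E)%E.
  by rewrite H.
pose I : set R := `[0, 1[%classic.
have Ip u : I u -> 0 <= u < 1 by rewrite /I/= in_itv.
(* The sets [U n] and the map [g] are arbitrary: replacing the preimage of [U n] by an enclosing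
   interval keeps everything measurable. *)
have J n : exists a b, [/\ a <= b, (forall u, I u -> U n (g u) -> a <= u <= b)
    & ((b - a)%:E <= (2 * C)%:E * diam_pow s (U n))%E].
  have [[u0 [Iu0 Uu0]]|none] := pselect (exists u, I u /\ U n (g u)); last first.
    exists 0, 0; split => //; first by move=> u Iu Uu; exfalso; apply: none; exists u.
    by rewrite subrr mule_ge0 ?diam_pow_ge0// lee_fin mulr_ge0// ltW.
  have U0 : U n !=set0 by exists (g u0).
  have [d dE /andP[d0 d1]] := diameter_fin U0 (Ud n).
  exists (u0 - C * d `^ s), (u0 + C * d `^ s); split.
  - have h : 0 <= C * d `^ s by rewrite mulr_ge0 ?powR_ge0// ltW.
    by lra.
  - move=> u Iu Uu.
    have : `|u - u0| <= C * d `^ s.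
      apply: (le_trans (gC _ _ (Ip _ Iu) (Ip _ Iu0))).
      rewrite ler_wpM2l ?(ltW C0)// ge0_ler_powR ?nnegrE//.
      by rewrite -lee_fin -dE; exact: diameter_dist.
    by rewrite ler_norml; lra.
  - rewrite /diam_pow; case: ifPn => [/eqP U00|_].
      by move: Uu0; rewrite U00.
    by rewrite dE poweR_EFin -EFinM lee_fin; lra.
pose a n := sval (cid (J n)); pose b n := sval (cid (svalP (cid (J n)))).
have ab n : [/\ a n <= b n, (forall u, I u -> U n (g u) -> a n <= u <= b n)
    & ((b n - a n)%:E <= (2 * C)%:E * diam_pow s (U n))%E].
  exact: (svalP (cid (svalP (cid (J n))))).
have leb x y : x <= y -> lebesgue_measure (`[x, y]%classic : set R) = (y - x)%:E.
  move=> xy; rewrite lebesgue_measure_itv/= lte_fin.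
  by case: ltP => // yx; rewrite (_ : y - x = 0)//; lra.
have I1 : lebesgue_measure I = 1%:E.
  by rewrite lebesgue_measure_itv/= lte_fin ltr01 oppr0 adde0.
have : (lebesgue_measure I <= \sum_(0 <= n <oo) lebesgue_measure (`[a n, b n]%classic : set R))%E.
  apply: measure_sigma_subadditive => //.
  - exact: measurable_itv.
  - move=> u Iu; have [n _ Un] := AU _ (Ag _ (Ip _ Iu)).
    by exists n => //=; rewrite in_itv/=; have [_ /(_ u Iu Un)] := ab n.
apply/negP; rewrite -ltNge I1.
apply: (@le_lt_trans _ _ ((2 * C)%:E * \sum_(0 <= n <oo) diam_pow s (U n))%E).
  rewrite -nneseriesZl; last by move=> n _; exact: diam_pow_ge0.
  apply: lee_nneseries; first by move=> n _ _; exact: measure_ge0.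
  by move=> n _; have [h1 _ h3] := ab n; rewrite leb.
apply: (@le_lt_trans _ _ ((2 * C)%:E * ((4 * C)^-1)%:E)%E).
  by rewrite lee_pmul2l ?lte_fin ?mulr_gt0// ltW.
by rewrite -EFinM lte_fin invfM mulrACA mulfV ?gt_eqF// mulr1; lra.
Qed.

End hausdorff.

(** * A Frostman lemma on the line, by distribution functions *)

Section frostman.
Context {R : realType}.
Implicit Types (A B U Z : set R) (s t delta : R).

Lemma hausdorff_premeasure_subset t delta A B : A `<=` B ->
  (hausdorff_premeasure t delta A <= hausdorff_premeasure t delta B)%E.
Proof.
move=> AB; apply: le_ereal_inf_tmp => _ [U [BU Ud ->]].
by apply: hausdorff_premeasure_le => //; exact: subset_trans BU.
Qed.

Lemma hausdorff_premeasureU t delta A B e : 0 <= t -> 0 <= e <= delta ->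
  (forall x y, B x -> B y -> `|x - y| <= e) ->
  (hausdorff_premeasure t delta (A `|` B) <=
   hausdorff_premeasure t delta A + (e `^ t)%:E)%E.
Proof.
move=> t0 /andP[e0 ed] Be; rewrite -leeBlDr//.
apply: le_ereal_inf_tmp => _ [U [AU Ud ->]]; rewrite leeBlDr//.
pose V n := if n is n'.+1 then U n' else B.
apply: le_trans (@hausdorff_premeasure_le R t delta (A `|` B) V _ _) _.
- move=> x [/AU[n _ Ux]|Bx]; [by exists n.+1|by exists 0%N].
- case=> [|n]; last exact: Ud.
  by apply: (le_trans (diameter_le Be)); rewrite lee_fin.
rewrite nneseries_recl//; last by move=> n _; exact: diam_pow_ge0.
rewrite addeC leeD//; last exact: diam_pow_le.
rewrite (_ : \sum_(1 <= k <oo) diam_pow t (V k) = \sum_(0 <= k <oo) diam_pow t (U k))%E//.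
rewrite -nneseries_addn; last by move=> n; exact: diam_pow_ge0.
by congr (limn _); apply/funext => n; apply: eq_bigr => i _; rewrite addn1.
Qed.

Lemma powR_small (t e delta : R) : 0 < t -> 0 < e -> 0 < delta ->
  exists2 eta, 0 < eta <= delta & eta `^ t < e.
Proof.
move=> t0 e0 d0; have e20 : 0 < (e / 2) `^ t^-1 by apply: powR_gt0; rewrite divr_gt0.
exists (Num.min delta ((e / 2) `^ t^-1)).
  by rewrite lt_min d0 e20 ge_min lexx.
apply: (@le_lt_trans _ _ (((e / 2) `^ t^-1) `^ t)); last first.
  by rewrite -powRrM mulVf ?gt_eqF// powRr1; lra.
by rewrite ge0_ler_powR ?nnegrE ?(ltW t0) ?powR_ge0 ?le_min ?(ltW d0) ?(ltW e20)// ge_min lexx orbT.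
Qed.

Section one_dimensional.
Variables (Z : set R) (t delta a b : R).
Hypothesis Zab : forall z, Z z -> a <= z <= b.
Hypothesis Zclosed : closed Z.
Hypothesis t0 : 0 < t.
Hypothesis delta0 : 0 < delta.

Let trunc_set x := Z `&` [set z | z <= x].
(** The Hausdorff measure may be infinite, but the premeasure at one fixed scale is finite on a
    bounded set. On the line its growth along half-lines can serve as the distribution function of a
    measure, although the premeasure is only subadditive. *)
Let F x := hausdorff_premeasure t delta (trunc_set x).
Let f x := fine (F x).

Let F_fin x : F x \is a fin_num.
Proof.
pose M := (Num.truncn ((x - a) / delta)).+1.
rewrite ge0_fin_numE ?hausdorff_premeasure_ge0//.
apply: le_lt_trans (@hausdorff_premeasure_finite_cover R t delta _ M delta
    (fun i => a + i%:R * delta) (ltW t0) _ _) (ltry _).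
  by rewrite lexx ltW.
move=> z [/Zab /andP[az _] /= zx].
have za0 : 0 <= (z - a) / delta by rewrite divr_ge0 ?subr_ge0// ltW.
have /andP[h1 h2] := truncn_itv za0.
exists (Num.truncn ((z - a) / delta)).
  by rewrite ltnS le_truncn// ler_pM2r ?invr_gt0// lerB.
by move: h1 h2; rewrite ler_pdivlMr// ltr_pdivrMr// -natr1; lra.
Qed.

Let FE x : F x = (f x)%:E. Proof. by rewrite fineK. Qed.

Let f_mono x y : x <= y -> f x <= f y.
Proof.
move=> xy; rewrite -lee_fin -!FE; apply: hausdorff_premeasure_subset.
by move=> z [Zz /= zx]; split=> //=; exact: le_trans xy.
Qed.

Let f_holder x y : x <= y -> y - x <= delta -> f y <= f x + (y - x) `^ t.
Proof.
move=> xy yx; rewrite -lee_fin EFinD -!FE.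
apply: (@le_trans _ _ (hausdorff_premeasure t delta (trunc_set x `|` [set z | x <= z <= y]))).
  apply: hausdorff_premeasure_subset => z [Zz /= zy].
  by have [zx|/ltW xz] := leP z x; [left|right; apply/andP].
apply: hausdorff_premeasureU; first exact: ltW.
  by rewrite subr_ge0 xy.
by move=> u v /= /andP[? ?] /andP[? ?]; rewrite ler_norml; lra.
Qed.

Let f_gap x y : x <= y -> (forall z, Z z -> x < z -> y < z) -> f y = f x.
Proof.
move=> xy H; rewrite /f /F; congr (fine (hausdorff_premeasure _ _ _)).
apply/seteqP; split => z [Zz /= zx]; split=> //=; last exact: le_trans xy.
by rewrite leNgt; apply/negP => /(H _ Zz); rewrite ltNge zx.
Qed.

Let fa x : x < a -> f x = 0.
Proof.
move=> xa; apply/eqP; rewrite -eqe -FE eq_le hausdorff_premeasure_ge0 andbT.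
have := @hausdorff_premeasure_finite_cover R t delta (trunc_set x) 0 0 (fun=> 0) (ltW t0).
rewrite mul0r; apply; first by rewrite lexx ltW.
by move=> z [/Zab /andP[az _] /= zx]; exfalso; move: (le_lt_trans zx xa); rewrite ltNge az.
Qed.

Let m := f b.

(* The increment of f over [x, y] is at most (y - x)^t and f is constant off Z,
   so its generalized inverse takes values in Z and pushes the uniform measure
   to a t-Frostman measure. *)
Let quant v := inf [set x | v <= f x].

Let quant_lb v : 0 < v -> lbound [set x | v <= f x] a.
Proof.
by move=> v0 x /= vx; rewrite leNgt; apply/negP => /fa f0; move: vx; rewrite f0 leNgt v0.
Qed.

Let quant_lt v x : 0 < v -> x < quant v -> f x < v.
Proof.
move=> v0 xq; rewrite ltNge; apply/negP => vx; move: xq; rewrite ltNge => /negP; apply.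
by apply: ge_inf => //; exists a; exact: quant_lb.
Qed.

Let quant_gt v x : 0 < v <= m -> quant v < x -> v <= f x.
Proof.
move=> /andP[v0 vm] qx.
have hi : has_inf [set x | v <= f x].
  by split; [exists b|exists a; exact: quant_lb].
have e0 : 0 < x - quant v by rewrite subr_gt0.
have [y /= vy yx] := inf_adherent e0 hi.
by move: yx; rewrite -/(quant v) subrKC => /ltW/f_mono; exact: le_trans.
Qed.

(** If [quant v] had a neighbourhood free of [Z], then [f] would be constant on it, whereas [f] is
    below v to the left of [quant v] and at least v to the right. *)
Let quant_in v : 0 < v <= m -> Z (quant v).
Proof.
move=> vm; have /andP[v0 _] := vm.
apply: contrapT => nZ.
have oZ : open (~` Z) by rewrite openC.
have : nbhs (quant v) (~` Z) by exact: open_nbhs_nbhs.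
case/nbhs_ballP => e /= e0 eZ.
have E : f (quant v + e / 2) = f (quant v - e / 2).
  apply: f_gap; first lra.
  move=> z Zz z1; rewrite ltNge; apply/negP => z2; apply: (eZ z) => //.
  rewrite /ball/= distrC ltr_norml; lra.
have h1 : v <= f (quant v + e / 2) by apply: quant_gt => //; lra.
have h2 : f (quant v - e / 2) < v by apply: quant_lt => //; lra.
by move: h1; rewrite E leNgt h2.
Qed.

Let quant_holder v w : 0 < v <= m -> v <= w <= m ->
  w - v <= (m * (2 / delta) `^ t + 2 * 2 `^ t) * `|quant w - quant v| `^ t.
Proof.
move=> /andP[v0 vm] /andP[vw wm].
have w0 : 0 < w by exact: lt_le_trans vw.
have m0 : 0 < m by exact: lt_le_trans wm.
have qq : quant v <= quant w.
  rewrite leNgt; apply/negP => qwv; pose y := (quant w + quant v) / 2.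
  have h1 : f y < v by apply: quant_lt => //; rewrite /y; lra.
  have h2 : w <= f y by apply: quant_gt; [rewrite w0|rewrite /y; lra].
  by lra.
rewrite ger0_norm ?subr_ge0//; set D := quant w - quant v.
have A eta : 0 < eta -> w - v <= f (quant w + eta) - f (quant v - eta).
  move=> e0; have h1 : w <= f (quant w + eta) by apply: quant_gt; [rewrite w0|lra].
  have h2 : f (quant v - eta) < v by apply: quant_lt => //; lra.
  lra.
have D0 : 0 <= D by rewrite subr_ge0.
have c1 : 0 <= m * (2 / delta) `^ t * D `^ t.
  by rewrite !mulr_ge0 ?powR_ge0// ltW.
have c2 : 0 <= 2 * 2 `^ t * D `^ t by rewrite !mulr_ge0 ?powR_ge0.
rewrite mulrDl.
have [Dd|Dd] := ltP delta (2 * D).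
  suff : m <= m * (2 / delta) `^ t * D `^ t by lra.
  rewrite -mulrA -powRM ?divr_ge0 ?(ltW delta0)// ler_peMr ?(ltW m0)//.
  have : 1 `^ t <= (2 / delta * D) `^ t.
    have q1 : 1 <= 2 / delta * D by rewrite mulrAC ler_pdivlMr// mul1r ltW.
    by apply: ge0_ler_powR; rewrite ?nnegrE ?(ltW t0)//; lra.
  by rewrite powR1.
have B eta : 0 < eta -> D + 2 * eta <= delta -> w - v <= (D + 2 * eta) `^ t.
  move=> e0 le; apply: (le_trans (A _ e0)); rewrite lerBlDl.
  have := @f_holder (quant v - eta) (quant w + eta).
  rewrite (_ : quant w + eta - (quant v - eta) = D + 2 * eta); last by rewrite /D; lra.
  by apply => //; lra.
move: D0; rewrite le_eqVlt => /predU1P[D0|D0].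
  suff : w - v <= 0 by lra.
  rewrite leNgt; apply/negP => wv0.
  have [eta /andP[e0 ed] ev] := powR_small t0 wv0 delta0.
  have := B (eta / 2); rewrite -D0 add0r (_ : 2 * (eta / 2) = eta); last lra.
  move=> /(_ _ ed) H; have : w - v <= eta `^ t by apply: H; lra.
  lra.
have := B (D / 2); rewrite (_ : 2 * (D / 2) = D); last lra.
move=> H.
have : w - v <= (2 * D) `^ t.
  by rewrite (_ : 2 * D = D + D); [apply: H; lra|lra].
rewrite powRM//; last exact: ltW.
have : 0 <= 2 `^ t * D `^ t by rewrite mulr_ge0 ?powR_ge0.
lra.
Qed.

Lemma frostman_map : hausdorff_premeasure t delta Z != 0%E ->
  exists G C, [/\ 0 < C, forall u, 0 <= u < 1 -> Z (G u)
    & forall u v, 0 <= u < 1 -> 0 <= v < 1 -> `|u - v| <= C * `|G u - G v| `^ t].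
Proof.
move=> pm0.
have m0 : 0 < m.
  rewrite lt0r fine_ge0 ?hausdorff_premeasure_ge0// andbT.
  apply: contra pm0 => /eqP mE; rewrite -[X in hausdorff_premeasure _ _ X](_ : trunc_set b = _).
    by rewrite -/(F b) FE -/m mE.
  by apply/seteqP; split => z; [case|move=> Zz; split=> //=; case/andP: (Zab Zz)].
pose c := m * (2 / delta) `^ t + 2 * 2 `^ t.
have c0 : 0 < c.
  by rewrite /c addr_gt0 ?mulr_gt0 ?powR_gt0 ?divr_gt0.
(* Only the upper half of the values of [f] is used: the parameter stays positive at u = 0, as
   [quant] requires, at the price of the factor 2 / m. *)
pose V u := (1 + u) / 2 * m.
have V0 u : 0 <= u < 1 -> 0 < V u <= m.
  move=> /andP[u0 u1]; rewrite /V mulr_gt0//=; last lra.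
  by rewrite ger_pMl//; lra.
exists (fun u => quant (V u)), (2 / m * c); split.
- by rewrite mulr_gt0// divr_gt0.
- by move=> u /V0; exact: quant_in.
move=> u v; wlog uv : u v / u <= v.
  move=> H u01 v01; have [uv|/ltW vu] := leP u v; first exact: H.
  by rewrite distrC (distrC (quant _)); exact: H.
move=> u01 v01.
have Vuv : V u <= V v by rewrite /V ler_pM2r//; lra.
have VVm : V u <= V v <= m by rewrite Vuv; case/andP: (V0 _ v01).
have := quant_holder (V0 _ u01) VVm.
rewrite -/c -(ger0_norm (_ : 0 <= V v - V u)) ?subr_ge0// => H.
have E : `|V v - V u| = `|u - v| * (m / 2).
  rewrite distrC (_ : V u - V v = (u - v) * (m / 2)); last by rewrite /V; lra.
  by rewrite normrM [X in _ * X]gtr0_norm// divr_gt0.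
move: H; rewrite E -ler_pdivlMr ?divr_gt0// => /le_trans; apply.
by rewrite invf_div distrC le_eqVlt; apply/orP; left; apply/eqP; ring.
Qed.

End one_dimensional.

End frostman.

Section dimension.
Context {R : realType}.
Implicit Types (A Z : set R) (s t alpha : R).

Lemma compact_norm_le A : compact A -> exists2 L : R, 1 <= L & forall x, A x -> `|x| <= L.
Proof.
move=> /compact_bounded [M [_ HM]]; exists (`|M| + 1); first by rewrite lerDr.
by apply: HM; rewrite (le_lt_trans (ler_norm M))// ltrDl.
Qed.

Lemma hausdorff_measure_neq0_lt_dim_H t A : 0 <= t -> t < dim_H A ->
  hausdorff_measure t A != 0%E.
Proof.
move=> t0; rewrite ltNge; apply: contra => /eqP H.
by apply: ge_inf => //; exists 0 => s [].
Qed.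

Lemma dim_H_le A a : 0 <= a -> (forall s, a < s -> hausdorff_measure s A = 0%E) -> dim_H A <= a.
Proof.
move=> a0 H; apply/ler_addgt0Pr => e e0.
apply: ge_inf; first by exists 0 => s [].
by split; [lra|apply: H; lra].
Qed.

Lemma dim_H_le1 A : compact A -> dim_H A <= 1.
Proof.
move=> /compact_norm_le [L0 L01 AL0].
have [L AL] : exists L : nat, forall x, A x -> `|x| <= L%:R.
  exists (Num.truncn L0).+1 => x /AL0 /le_trans; apply.
  by rewrite ltW// truncnS_gt.
apply: dim_H_le => // s s1; apply: hausdorff_measure_eq0; first lra.
move=> e e0.
(* One k has to make both the mesh 2^-k and the cost, about 2^(-(s - 1) k) times 2 L + 1, at most e;
   the minimum treats both at once. *)
have s10 : 0 < Num.min 1 (s - 1) by rewrite lt_min ltr01 subr_gt0.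
have [k Hk] := powR2_unbounded ((2 * L%:R + 1) / e) s10.
have Hc c : 0 < c -> Num.min 1 (s - 1) <= c -> 2 `^ (- (c * k%:R)) * (2 * L%:R + 1) <= e.
  move=> c0 hc; rewrite powRN ler_pdivrMl ?powR_gt0// -ler_pdivrMr//.
  apply: (le_trans (ltW Hk)); rewrite ler_powR ?ler1n//.
  by rewrite ler_wpM2r.
have LL : 0 <= L%:R :> R by [].
exists (2 * L * 2 ^ k).+1, (2 `^ (- k%:R)), (fun i => - L%:R + i%:R * 2 `^ (- k%:R)).
have pk : 0 < 2 `^ (- k%:R) :> R by exact: powR_gt0.
split.
- rewrite (ltW pk)/=; have := Hc 1 ltr01; rewrite mul1r ge_min lexx => /(_ isT).
  by apply: le_trans; rewrite ler_peMr ?(ltW pk)//; lra.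
- move=> x /AL; rewrite ler_norml => /andP[x1 x2].
  have y0 : 0 <= (x + L%:R) * 2 ^+ k by rewrite mulr_ge0 ?(ltW (exp2_gt0 _))//; lra.
  have /andP[h1 h2] := truncn_itv y0.
  exists (Num.truncn ((x + L%:R) * 2 ^+ k)).
    rewrite -(ltr_nat R) (le_lt_trans h1)// -[(2 * L * 2 ^ k).+1%:R]natr1 !natrM natrX ltr_pwDr//.
    by rewrite ler_pM2r//; lra.
  move: (Num.truncn _) h1 h2 => n; rewrite powR_invn// -ler_pdivrMr// -ltr_pdivlMr//.
  rewrite -[n.+1]addn1 natrD (mulrDl n%:R) mul1r; lra.
- have : 2 `^ (- ((s - 1) * k%:R)) * (2 * L%:R + 1) <= e.
    by apply: Hc; [lra|rewrite ge_min lexx orbT].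
  apply: le_trans.
  have -> : 2 `^ (- ((s - 1) * k%:R)) = 2 `^ k%:R * (2 `^ (- k%:R)) `^ s :> R.
    rewrite -powRrM -powRD; last by rewrite pnatr_eq0 implybT.
    by congr powR; ring.
  rewrite powR_mulrn// mulrAC ler_wpM2r ?powR_ge0//.
  rewrite -[(2 * L * 2 ^ k).+1%:R]natr1 !natrM natrX.
  have := @exp2_ge1 R k; lra.
Qed.

Lemma dim_H_cantor_set alpha pos : 0 <= alpha <= 1 -> cantor_scheme alpha pos ->
  dim_H (cantor_set alpha pos : set R) = alpha.
Proof.
move=> alpha01 posP; have /andP[a0 a1] := alpha01.
have H s : alpha < s -> hausdorff_measure s (cantor_set alpha pos : set R) = 0%E.
  move=> sa; apply: hausdorff_measure_eq0; first lra.
  move=> e e0.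
  have s10 : 0 < Num.min 1 (s - alpha) by rewrite lt_min ltr01 subr_gt0.
  have [k Hk] := powR2_unbounded e^-1 s10.
  have Hc c : 0 < c -> Num.min 1 (s - alpha) <= c -> 2 `^ (- (c * k%:R)) <= e.
    move=> c0 hc; rewrite powRN invf_ple ?posrE ?powR_gt0//.
    apply: (le_trans (ltW Hk)); rewrite ler_powR ?ler1n//.
    by rewrite ler_wpM2r.
  exists (cells alpha k), (2 `^ (- k%:R)), (fun i => node k (pos k i)).
  split.
  - rewrite powR_ge0/=; have := Hc 1 ltr01; rewrite mul1r ge_min lexx; exact.
  - by move=> x /(_ k) [i [iN xi]]; exists i => //; rewrite powR_invn// -nodeS.
  - apply: (@le_trans _ _ (2 `^ (- ((s - alpha) * k%:R)))); last first.
      by apply: Hc; [lra|rewrite ge_min lexx orbT].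
    have -> : 2 `^ (- ((s - alpha) * k%:R)) = 2 `^ (alpha * k%:R) * (2 `^ (- k%:R)) `^ s :> R.
      rewrite -powRrM -powRD; last by rewrite pnatr_eq0 implybT.
      by congr powR; ring.
    by rewrite ler_wpM2r ?powR_ge0// cells_le_powR.
apply/eqP; rewrite eq_le dim_H_le//=.
apply: lb_le_inf; first by exists (alpha + 1); split; [lra|apply: H; lra].
move=> s [s0 Hs]; rewrite leNgt; apply/negP => sa.
move/eqP: Hs; apply/negP.
apply: (@hausdorff_measure_neq0 R s 8 _ (cantor_map alpha pos)) => //.
  exact: cantor_map_in.
move=> u v u01 v01; apply: (le_trans (cantor_map_holder alpha01 posP u01 v01)).
rewrite ler_wpM2l//.
(* Both points lie in [1, 2], so their distance is at most 1 and the exponent alpha may be lowered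
   to s. *)
have /cantor_set_bounds : cantor_set alpha pos (cantor_map alpha pos u) by exact: cantor_map_in.
have /cantor_set_bounds : cantor_set alpha pos (cantor_map alpha pos v) by exact: cantor_map_in.
move=> /(_ alpha01 posP); rewrite /= in_itv/= => /andP[v1 v2].
move=> /(_ alpha01 posP); rewrite /= in_itv/= => /andP[u1 u2].
have [->|d0] := eqVneq (cantor_map alpha pos u) (cantor_map alpha pos v).
  by rewrite subrr normr0 powR0 ?powR_ge0//; lra.
rewrite ger_powR ?normr_gt0 ?subr_eq0 ?d0 ?(ltW sa)//= ler_norml; lra.
Qed.

Lemma frostman_dim_H Z t : Z !=set0 -> compact Z -> 0 <= t -> (0 < t -> t < dim_H Z) ->
  exists G C, [/\ 0 < C, forall u, 0 <= u < 1 -> Z (G u)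
    & forall u v, 0 <= u < 1 -> 0 <= v < 1 -> `|u - v| <= C * `|G u - G v| `^ t].
Proof.
move=> [z Zz] cZ; rewrite le_eqVlt => /predU1P[<- _|t0 /(_ t0) td].
  exists (fun=> z), 1; split => // u v /andP[? ?] /andP[? ?].
  by rewrite powRr0 mulr1 ler_norml; lra.
have := hausdorff_measure_neq0_lt_dim_H (ltW t0) td.
have [L _ ZL] := compact_norm_le cZ.
have [[delta [delta0 pm]] _|none] :=
    pselect (exists delta : R, 0 < delta /\ hausdorff_premeasure t delta Z != 0%E).
  apply: (@frostman_map R Z t delta (- L) L _ _ t0 delta0 pm).
    by move=> x /ZL; rewrite ler_norml.
  exact: compact_closed.
move=> /eqP []; apply/eqP; rewrite eq_le; apply/andP; split.
  apply: ge_ereal_sup => _ [delta /= delta0 <-].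
  by rewrite leNgt; apply/negP => H; apply: none; exists delta; rewrite gt_eqF.
apply: le_trans (hausdorff_premeasure_ge0 t 1 Z) _.
by apply: ereal_sup_ubound; exists 1 => //=.
Qed.

End dimension.

(** * Positive functionals and their power spectrum *)

Section positive_functional.
Context {R : realType}.
Implicit Types (f g : R -> R) (S : set R).

Definition bounded_measurable f :=
  measurable_fun [set: R] f /\ exists K, forall x, `|f x| <= K.

Lemma bounded_measurable_cst c : bounded_measurable (fun=> c).
Proof. by split; [exact: measurable_cst|exists `|c|]. Qed.

Lemma bounded_measurableD f g : bounded_measurable f -> bounded_measurable g ->
  bounded_measurable (fun x => f x + g x).
Proof.
move=> [mf [K fK]] [mg [L gL]]; split; first exact: measurable_funD.
by exists (K + L) => x; apply: (le_trans (ler_normD _ _)); exact: lerD.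
Qed.

Lemma bounded_measurableM f g : bounded_measurable f -> bounded_measurable g ->
  bounded_measurable (fun x => f x * g x).
Proof.
move=> [mf [K fK]] [mg [L gL]]; split; first exact: measurable_funM.
by exists (K * L) => x; rewrite normrM; exact: ler_pM.
Qed.

Lemma bounded_measurableZ c f : bounded_measurable f -> bounded_measurable (fun x => c * f x).
Proof. exact/bounded_measurableM/bounded_measurable_cst. Qed.

Lemma bounded_measurableB f g : bounded_measurable f -> bounded_measurable g ->
  bounded_measurable (fun x => f x - g x).
Proof.
move=> bf /(bounded_measurableZ (-1)) bg; have := bounded_measurableD bf bg.
by congr bounded_measurable; apply/funext => x; rewrite mulN1r.
Qed.

Lemma bounded_measurable_sum (I : Type) (r : seq I) (F : I -> R -> R) :
  (forall i, bounded_measurable (F i)) ->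
  bounded_measurable (fun x => \sum_(i <- r) F i x).
Proof.
move=> mF; elim: r => [|i r IH].
  by under eq_fun do rewrite big_nil; exact: bounded_measurable_cst.
by under eq_fun do rewrite big_cons; exact: bounded_measurableD.
Qed.

Lemma bounded_measurable_comp f g : bounded_measurable f -> measurable_fun [set: R] g ->
  bounded_measurable (fun x => f (g x)).
Proof.
move=> [mf [K fK]] mg; split; last by exists K.
exact: measurableT_comp.
Qed.

Lemma bounded_measurable_cos c : bounded_measurable (fun x => cos (c * x)).
Proof.
split; last by exists 1 => x; rewrite ler_norml cos_geN1 cos_le1.
apply: (measurableT_comp (f := cos)); last exact: measurable_funM.
by apply: continuous_measurable_fun; exact: continuous_cos.
Qed.

Lemma bounded_measurable_sin c : bounded_measurable (fun x => sin (c * x)).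
Proof.
split; last by exists 1 => x; rewrite ler_norml sin_geN1 sin_le1.
apply: (measurableT_comp (f := sin)); last exact: measurable_funM.
by apply: continuous_measurable_fun; exact: continuous_sin.
Qed.

Lemma bounded_measurable_indic (A : set R) : measurable A -> bounded_measurable (\1_A).
Proof.
move=> mA; split; first exact: measurable_indic.
by exists 1 => x; rewrite indicE; case: (_ \in _); rewrite ?normr1 ?normr0.
Qed.

(* Integration against a finite measure carried by S. *)
Definition pos_functional S (E : (R -> R) -> R) :=
  [/\ forall f g, bounded_measurable f -> bounded_measurable g ->
        E (fun x => f x + g x) = E f + E g,
      forall c f, bounded_measurable f -> E (fun x => c * f x) = c * E f
    & forall f g, bounded_measurable f -> bounded_measurable g ->
        (forall x, S x -> f x <= g x) -> E f <= E g].

(** The squared modulus of the Fourier transform, at frequency c / (2 pi). *)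
Definition power_at (E : (R -> R) -> R) (c : R) :=
  E (fun x => cos (c * x)) ^+ 2 + E (fun x => sin (c * x)) ^+ 2.

Lemma power_at_ge0 E c : 0 <= power_at E c.
Proof. by rewrite addr_ge0 ?sqr_ge0. Qed.

Lemma sqr_sum_le (I : Type) (r : seq I) (q : I -> R) :
  (\sum_(i <- r) q i) ^+ 2 <= (size r)%:R * \sum_(i <- r) q i ^+ 2.
Proof.
elim: r => [|i r IH]; first by rewrite !big_nil expr0n mulr0.
rewrite !big_cons [size _]/= -[(size r).+1]addn1 natrD mulrDl mul1r.
have T0 : 0 <= \sum_(j <- r) q j ^+ 2 by apply: sumr_ge0 => j _; exact: sqr_ge0.
move: (\sum_(j <- r) q j) (\sum_(j <- r) q j ^+ 2) T0 IH => S T T0 IH.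
have [r0|r0] := posnP (size r).
  rewrite r0 mul0r add0r; move: IH; rewrite r0 mul0r => S2.
  have -> : S = 0 by apply/eqP; rewrite -sqrf_eq0 eq_le S2 sqr_ge0.
  by rewrite addr0; lra.
have n0 : 0 < (size r)%:R :> R by rewrite ltr0n.
move: (size r)%:R n0 IH => n n0 IH.
rewrite -subr_ge0 -(pmulr_rge0 _ n0).
have -> : n * (n * (q i ^+ 2 + T) + (q i ^+ 2 + T) - (q i + S) ^+ 2) =
  (n * q i - S) ^+ 2 + (n * (n * T - S ^+ 2) + (n * T - S ^+ 2)) by ring.
by rewrite addr_ge0 ?sqr_ge0// addr_ge0 ?mulr_ge0 ?(ltW n0)// subr_ge0.
Qed.

(** The two truncated differences add up to |n - m|, and a given distance occurs for at most two
    values of m, one on each side of n. *)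
Lemma sum_dist_row_le (P : nat -> R) N n : (forall l, 0 <= P l) -> (n < N)%N ->
  \sum_(m < N) P (n - m + (m - n))%N <= 2 * \sum_(l < N) P l.
Proof.
move=> P0 nN; rewrite [2]mulr2n [leRHS]mulrDl mul1r.
rewrite -(big_mkord xpredT (fun m => P (n - m + (m - n))%N)) -(big_mkord xpredT P).
rewrite (big_cat_nat (n := n.+1))//=; apply: lerD.
  rewrite big_nat_rev/= add0n.
  apply: (@le_trans _ _ (\sum_(0 <= i < n.+1) P i)).
    rewrite big_nat [leRHS]big_nat; apply: ler_sum => i /andP[_ ni].
    by rewrite (_ : _ + _ = i)%N//; lia.
  rewrite [leRHS](big_cat_nat (n := n.+1))//= lerDl.
  by rewrite big_nat sumr_ge0.
case: N nN => // N; rewrite ltnS => nN.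
rewrite [leRHS]big_nat_recl//= big_add1/=.
apply: (@le_trans _ _ (\sum_(n <= i < N) P (i - n).+1)).
  rewrite big_nat [leRHS]big_nat; apply: ler_sum => i /andP[ni _].
  by rewrite (_ : _ + _ = (i - n).+1)%N//; lia.
rewrite -{1}[n]add0n big_addn; under eq_bigr do rewrite addnK.
apply: (@le_trans _ _ (\sum_(0 <= i < N) P i.+1)); last by rewrite lerDr.
rewrite [leRHS](big_cat_nat (n := N - n)) ?leq_subr//= lerDl.
by rewrite sumr_ge0.
Qed.

Lemma sum_dist_le (P : nat -> R) N : (forall l, 0 <= P l) ->
  \sum_(n < N) \sum_(m < N) P (n - m + (m - n))%N <= 2 * N%:R * \sum_(l < N) P l.
Proof.
move=> P0; apply: (@le_trans _ _ (\sum_(n < N) (2 * \sum_(l < N) P l))).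
  by apply: ler_sum => n _; exact: sum_dist_row_le.
by rewrite sumr_const card_ord -[leLHS](mulr_natl _ N) mulrCA mulrA.
Qed.

End positive_functional.

Section covering_bound.
Context {R : realType}.
Variables (S : set R) (E : (R -> R) -> R).
Hypothesis posE : pos_functional S E.
Implicit Types (f g : R -> R).

Lemma pos_functional_cst c : E (fun=> c) = c * E (fun=> 1).
Proof.
have [_ EZ _] := posE; rewrite -EZ; last exact: bounded_measurable_cst.
by congr E; apply/funext => x; rewrite mulr1.
Qed.

Lemma pos_functional_sum (I : Type) (r : seq I) (F : I -> R -> R) :
  (forall i, bounded_measurable (F i)) ->
  E (fun x => \sum_(i <- r) F i x) = \sum_(i <- r) E (F i).
Proof.
move=> mF; have [ED _ _] := posE; elim: r => [|i r IH].
  under eq_fun do rewrite big_nil.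
  by rewrite pos_functional_cst mul0r big_nil.
under eq_fun do rewrite big_cons.
by rewrite ED ?IH ?big_cons//; exact: bounded_measurable_sum.
Qed.

Lemma pos_functional_norm_le f K : bounded_measurable f ->
  (forall x, S x -> `|f x| <= K) -> `|E f| <= K * E (fun=> 1).
Proof.
move=> bf fK; have [_ _ Emono] := posE.
have h1 : E f <= E (fun=> K).
  apply: Emono => //; first exact: bounded_measurable_cst.
  by move=> x /fK; exact: le_trans (ler_norm _).
have h2 : E (fun=> - K) <= E f.
  apply: Emono => //; first exact: bounded_measurable_cst.
  by move=> x /fK; rewrite ler_norml => /andP[].
by move: h1 h2; rewrite (pos_functional_cst K) (pos_functional_cst (- K)) ler_norml; lra.
Qed.

Lemma power_atN c : power_at E (- c) = power_at E c.
Proof.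
have [_ EZ _] := posE; rewrite /power_at; congr (_ + _).
  by congr (E _ ^+ 2); apply/funext => x; rewrite mulNr cosN.
rewrite (_ : (fun x => sin (- c * x)) = (fun x => -1 * sin (c * x))).
  by rewrite EZ ?mulN1r ?sqrrN//; exact: bounded_measurable_sin.
by apply/funext => x; rewrite mulN1r -sinN mulNr.
Qed.

Lemma power_at0 : power_at E 0 = E (fun=> 1) ^+ 2.
Proof.
rewrite /power_at (_ : (fun x => cos (0 * x)) = fun=> 1); last first.
  by apply/funext => x; rewrite mul0r cos0.
rewrite (_ : (fun x => sin (0 * x)) = fun=> 0); last first.
  by apply/funext => x; rewrite mul0r sin0.
by rewrite (pos_functional_cst 0) mul0r expr0n addr0.
Qed.

Let kernel a N (u : R) : R :=
  (\sum_(n < N) cos (n%:R * a * u)) ^+ 2 + (\sum_(n < N) sin (n%:R * a * u)) ^+ 2.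

Let kernelE a N x y : kernel a N (x - y) =
  \sum_(n < N) \sum_(m < N)
    (cos ((n%:R - m%:R) * a * x) * cos ((n%:R - m%:R) * a * y) +
     sin ((n%:R - m%:R) * a * x) * sin ((n%:R - m%:R) * a * y)).
Proof.
rewrite /kernel !expr2 !mulr_suml -big_split/=; apply: eq_bigr => n _.
rewrite !mulr_sumr -big_split/=; apply: eq_bigr => m _.
by rewrite -!cosB; congr cos; ring.
Qed.

(** All the phases n a u are at most 1/2 in absolute value, where cosine is at least 1/2, so the
    cosine sum has no cancellation. *)
Let kernel_ge a N u eps : 0 < a -> N%:R * a * eps <= 1 / 2 -> `|u| <= eps ->
  (N%:R / 2) ^+ 2 <= kernel a N u.
Proof.
move=> a0 Nae ue; rewrite /kernel -[leLHS]addr0 lerD ?sqr_ge0//.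
suff : N%:R / 2 <= \sum_(n < N) cos (n%:R * a * u).
  by move=> h; rewrite lerXn2r ?nnegrE ?divr_ge0// (le_trans _ h)// divr_ge0.
apply: (@le_trans _ _ (\sum_(n < N) 2^-1)).
  by rewrite sumr_const card_ord -[leRHS](mulr_natl _ N).
apply: ler_sum => n _.
have h : `|n%:R * a * u| <= 1 / 2.
  rewrite normrM ger0_norm ?mulr_ge0 ?(ltW a0)//; apply: le_trans Nae.
  apply: ler_pM; rewrite ?mulr_ge0 ?(ltW a0)// ler_wpM2r ?(ltW a0)// ler_nat.
  exact: ltnW.
have := cos_quad (0 : R) (n%:R * a * u).
rewrite add0r cos0 sin0 mulr0 subr0 mul1r -[_ ^+ 2]real_normK ?num_real//.
rewrite ler_norml => /andP[_].
have : 0 <= `|n%:R * a * u| by [].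
move: h; move: `|_| => t; nra.
Qed.

Let cell b eps (c : nat) : set R := `[b + c%:R * eps, b + c.+1%:R * eps[%classic.

Let cell_unique b eps c d x : 0 < eps -> cell b eps c x -> cell b eps d x -> c = d.
Proof.
move=> e0; rewrite /cell/= !in_itv/= => /andP[c1 c2] /andP[d1 d2].
have : (c < d.+1)%N.
  by rewrite -(ltr_nat R) -(ltr_pM2r e0); lra.
have : (d < c.+1)%N.
  by rewrite -(ltr_nat R) -(ltr_pM2r e0); lra.
by lia.
Qed.

Let cell_dist b eps c x y : cell b eps c x -> cell b eps c y -> `|x - y| <= eps.
Proof.
rewrite /cell/= !in_itv/= -[c.+1]addn1 natrD mulrDl mul1r ler_norml; lra.
Qed.

(* The sum over the cells of E(cell)^2 is the correlation of E with itself
   along pairs in a common cell, hence at most 4 / N^2 times the correlation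
   against the positive definite kernel |sum_(n < N) e^(i n a (x - y))|^2. *)
Lemma pos_functional_cover_le b eps a N (H : seq nat) :
  0 < eps -> 0 < a -> (0 < N)%N -> N%:R * a * eps <= 1 / 2 -> uniq H ->
  (forall x, S x -> exists2 c, c \in H & cell b eps c x) ->
  E (fun=> 1) ^+ 2 <= 8 * (size H)%:R / N%:R * \sum_(l < N) power_at E (l%:R * a).
Proof.
move=> e0 a0 N0 Nae uH cov; have [ED EZ Emono] := posE.
have mcell c : bounded_measurable (\1_(cell b eps c) : R -> R).
  by apply: bounded_measurable_indic; exact: measurable_itv.
pose q c := E (\1_(cell b eps c)).
have NR : 0 < N%:R :> R by rewrite ltr0n.
have step1 : E (fun=> 1) <= \sum_(c <- H) q c.
  rewrite -pos_functional_sum//; apply: Emono.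
  - exact: bounded_measurable_cst.
  - exact: bounded_measurable_sum.
  move=> x /cov[c cH xc]; rewrite (big_rem c)//= indicE mem_set//= lerDl.
  by apply: sumr_ge0 => i _; rewrite indicE.
have E1 : 0 <= E (fun=> 1).
  rewrite -[X in X <= _](_ : E (fun=> 0) = 0); last by rewrite pos_functional_cst mul0r.
  by apply: Emono => //; exact: bounded_measurable_cst.
pose th (n m : nat) : R := (n%:R - m%:R) * a.
pose C t := E (fun x => cos (t * x)); pose D t := E (fun x => sin (t * x)).
have mc t := @bounded_measurable_cos R t; have ms t := @bounded_measurable_sin R t.
have mterm (x t : R) : bounded_measurable (fun y => cos (t * x) * cos (t * y) + sin (t * x) * sin (t * y)).
  by apply: bounded_measurableD; [exact: bounded_measurableZ _ (mc t)|exact: bounded_measurableZ _ (ms t)].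
have mterm2 t : bounded_measurable (fun x => C t * cos (t * x) + D t * sin (t * x)).
  by apply: bounded_measurableD; [exact: bounded_measurableZ _ (mc t)|exact: bounded_measurableZ _ (ms t)].
(* Applying [E] in y and then in x stands for integration against the product measure. The kernel is
   a trigonometric polynomial in x - y, so both applications reduce to finite sums. *)
have EK x : E (fun y => kernel a N (x - y)) =
    \sum_(n < N) \sum_(m < N) (C (th n m) * cos (th n m * x) + D (th n m) * sin (th n m * x)).
  under eq_fun do rewrite kernelE.
  rewrite pos_functional_sum; last by move=> n; exact: bounded_measurable_sum.
  apply: eq_bigr => n _; rewrite pos_functional_sum//; apply: eq_bigr => m _.
  rewrite ED; [|exact: bounded_measurableZ _ (mc _)|exact: bounded_measurableZ _ (ms _)].
  by rewrite !EZ// mulrC [X in _ + X]mulrC.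
have EEK : E (fun x => E (fun y => kernel a N (x - y))) =
    \sum_(n < N) \sum_(m < N) power_at E (th n m).
  under eq_fun do rewrite EK.
  rewrite pos_functional_sum; last by move=> n; exact: bounded_measurable_sum.
  apply: eq_bigr => n _; rewrite pos_functional_sum//; apply: eq_bigr => m _.
  rewrite ED; [|exact: bounded_measurableZ _ (mc _)|exact: bounded_measurableZ _ (ms _)].
  by rewrite !EZ// -!expr2.
have mEK : bounded_measurable (fun x => E (fun y => kernel a N (x - y))).
  under eq_fun do rewrite EK.
  by apply: bounded_measurable_sum => n; exact: bounded_measurable_sum.
have mK x : bounded_measurable (fun y => kernel a N (x - y)).
  under eq_fun do rewrite kernelE.
  by apply: bounded_measurable_sum => n; exact: bounded_measurable_sum.
have kernel0 u : 0 <= kernel a N u by rewrite addr_ge0 ?sqr_ge0.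
have pointwise x y : \sum_(c <- H) \1_(cell b eps c) x * \1_(cell b eps c) y <=
    4 / N%:R ^+ 2 * kernel a N (x - y) :> R.
  have k0 : 0 <= 4 / N%:R ^+ 2 * kernel a N (x - y) by rewrite mulr_ge0 ?divr_ge0 ?sqr_ge0.
  have [[c [cH xc yc]]|none] := pselect (exists c, [/\ c \in H, cell b eps c x & cell b eps c y]).
    rewrite (big_rem c)//= !indicE !mem_set// mulr1 big_seq big1 ?addr0.
      have := kernel_ge a0 Nae (cell_dist xc yc).
      move=> K1; apply: (@le_trans _ _ (4 / N%:R ^+ 2 * (N%:R / 2) ^+ 2)).
        have -> : 4 / N%:R ^+ 2 * (N%:R / 2) ^+ 2 = 1 :> R by field; rewrite gt_eqF.
        by [].
      by rewrite ler_wpM2l// divr_ge0// sqr_ge0.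
    move=> d; rewrite mem_rem_uniq// => /andP[/= dc _].
    rewrite !indicE; case: (boolP (x \in _)) => [/set_mem xd|_]; last by rewrite mul0r.
    by move: dc; rewrite (cell_unique e0 xd xc) eqxx.
  rewrite big_seq big1// => c cH; rewrite !indicE.
  case: (boolP (x \in _)) => [/set_mem xc|_]; last by rewrite mul0r.
  case: (boolP (y \in _)) => [/set_mem yc|_]; last by rewrite mulr0.
  by exfalso; apply: none; exists c.
have step2 x : \sum_(c <- H) \1_(cell b eps c) x * q c <=
    4 / N%:R ^+ 2 * E (fun y => kernel a N (x - y)).
  rewrite -EZ//; under eq_bigr do rewrite -EZ//.
  rewrite -pos_functional_sum; last by move=> c; exact: bounded_measurableZ.
  apply: Emono => //.
  - by apply: bounded_measurable_sum => c; exact: bounded_measurableZ.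
  - exact: bounded_measurableZ.
have step3 : \sum_(c <- H) q c ^+ 2 <= 4 / N%:R ^+ 2 * \sum_(n < N) \sum_(m < N) power_at E (th n m).
  rewrite -EEK -EZ//.
  have -> : \sum_(c <- H) q c ^+ 2 = E (fun x => \sum_(c <- H) q c * \1_(cell b eps c) x).
    rewrite pos_functional_sum; last by move=> c; exact: bounded_measurableZ.
    by apply: eq_bigr => c _; rewrite EZ// expr2.
  apply: Emono.
  - by apply: bounded_measurable_sum => c; exact: bounded_measurableZ.
  - exact: bounded_measurableZ.
  by move=> x _; apply: le_trans (step2 x); under eq_bigr do rewrite mulrC.
have thE n m : power_at E (th n m) = power_at E ((n - m + (m - n))%N%:R * a).
  rewrite /th; have [mn|nm] := leqP m n.
    by rewrite (eqP mn) addn0 natrB.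
  rewrite (_ : n - m = 0)%N ?add0n ?natrB; [|exact: ltnW|lia].
  by rewrite -power_atN -mulNr opprB.
have step4 : \sum_(n < N) \sum_(m < N) power_at E (th n m) <=
    2 * N%:R * \sum_(l < N) power_at E (l%:R * a).
  under eq_bigr do under eq_bigr do rewrite thE.
  by apply: (@sum_dist_le _ (fun l => power_at E (l%:R * a))) => l; exact: power_at_ge0.
apply: (@le_trans _ _ ((\sum_(c <- H) q c) ^+ 2)).
  by rewrite lerXn2r ?nnegrE// (le_trans E1).
(* Cauchy-Schwarz over the cells of [H]. The factor 8 / N collects 4 / N^2 from the kernel and 2 N
   from counting the pairs (n, m) by their distance. *)
apply: (le_trans (sqr_sum_le _ _)).
apply: (@le_trans _ _ ((size H)%:R * (4 / N%:R ^+ 2 * (2 * N%:R * \sum_(l < N) power_at E (l%:R * a))))).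
  rewrite ler_wpM2l//; apply: (le_trans step3).
  by rewrite ler_wpM2l// divr_ge0// sqr_ge0.
by rewrite le_eqVlt; apply/orP; left; apply/eqP; field; rewrite gt_eqF.
Qed.

End covering_bound.

(** * Dyadic sums, Dirichlet kernels and discrete energy *)

Section energy.
Context {R : realType}.

Lemma dyadic_sum (f : nat -> R) J :
  \sum_(l < 2 ^ J) f l = f 0%N + \sum_(i < J) \sum_(2 ^ i <= l < 2 ^ i.+1) f l.
Proof.
elim: J => [|J IH]; first by rewrite expn0 big_ord1 big_ord0 addr0.
rewrite -(big_mkord xpredT f) (big_cat_nat (n := 2 ^ J))//=; last by rewrite leq_exp2l.
by rewrite big_mkord IH -addrA [in RHS]big_ord_recr.
Qed.

(** On a dyadic block, [P] is bounded by its bound at the left end and the sum of [Q] by its sum up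
    to the right end, whence the extra factor rho. The ratio of the geometric series is above 1 in
    the upper bound for the Fourier dimension and below 1 for the sumset. *)
Lemma dyadic_sum_prod_le (P Q : nat -> R) A B kappa rho J : 0 <= A -> 0 <= kappa ->
  (forall l, 0 <= Q l) -> P 0%N <= A ->
  (forall l, (0 < l < 2 ^ J)%N -> P l <= A * l%:R `^ (- kappa)) ->
  (forall i, (i <= J)%N -> \sum_(l < 2 ^ i) Q l <= B * rho ^+ i) ->
  \sum_(l < 2 ^ J) P l * Q l <=
  A * B * (1 + rho * \sum_(i < J) (rho * 2 `^ (- kappa)) ^+ i).
Proof.
move=> A0 k0 Q0 P0 PA QB; rewrite (dyadic_sum (fun l => P l * Q l)) mulrDr mulr1; apply: lerD.
  apply: (@le_trans _ _ (A * Q 0%N)); first by rewrite ler_wpM2r.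
  by rewrite ler_wpM2l//; have := QB 0%N (leq0n _); rewrite expn0 big_ord1 mulr1.
rewrite mulr_sumr mulr_sumr; apply: ler_sum => i _.
apply: (@le_trans _ _ (A * 2 `^ (- kappa) ^+ i * \sum_(2 ^ i <= l < 2 ^ i.+1) Q l)).
  rewrite mulr_sumr big_nat [leRHS]big_nat; apply: ler_sum => l /andP[l1 l2].
  have l0 : (0 < l)%N by apply: leq_trans l1; rewrite expn_gt0.
  rewrite ler_wpM2r//; apply: (le_trans (PA _ _)).
    by rewrite l0 (leq_trans l2)// leq_exp2l.
  rewrite ler_wpM2l// -powR_mulrn ?powR_ge0// powRAC powR_mulrn// !powRN.
  rewrite lef_pV2 ?posrE ?powR_gt0 ?ltr0n//.
  by rewrite ge0_ler_powR ?nnegrE// -natrX ler_nat.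
have H : \sum_(2 ^ i <= l < 2 ^ i.+1) Q l <= B * rho ^+ i.+1.
  apply: le_trans (QB i.+1 (ltn_ord i)).
  rewrite -(big_mkord xpredT Q) [leRHS](big_cat_nat (n := 2 ^ i))//=; last by rewrite leq_exp2l.
  by rewrite lerDr sumr_ge0.
apply: (@le_trans _ _ (A * 2 `^ (- kappa) ^+ i * (B * rho ^+ i.+1))).
  by rewrite ler_wpM2l// mulr_ge0// exprn_ge0// powR_ge0.
by rewrite le_eqVlt; apply/orP; left; apply/eqP; rewrite exprMn exprS; ring.
Qed.

Lemma geometric_sum_le (r : R) J : 1 < r ->
  \sum_(i < J) r ^+ i <= r ^+ J / (r - 1).
Proof.
move=> r1; have d : 0 < r - 1 by rewrite subr_gt0.
rewrite ler_pdivlMr// mulrC -subrX1; lra.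
Qed.

Lemma geometric_sum_lt1_le (r : R) J : 0 <= r < 1 ->
  \sum_(i < J) r ^+ i <= (1 - r)^-1.
Proof.
move=> /andP[r0 r1]; have d : 0 < 1 - r by rewrite subr_gt0.
rewrite -[leRHS]div1r ler_pdivlMr// mulrC -opprB mulNr -subrX1.
by have := exprn_ge0 J r0; lra.
Qed.

Lemma sin_ge_half (v : R) : 0 <= v <= 1 / 2 -> v / 2 <= sin v.
Proof.
move=> /andP[v0 v1]; have := sin_quad 0 v.
rewrite add0r sin0 cos0 subr0 mulr1 mul1r ler_norml => /andP[+ _]; nra.
Qed.

Lemma dirichlet_sum_le (y : R) N : 0 < y <= 1 ->
  `|\sum_(l < N) cos (l%:R * y)| <= 4 / y.
Proof.
move=> /andP[y0 y1].
(* Multiplied by 2 sin (y / 2), the sum telescopes. *)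
have E : 2 * sin (y / 2) * \sum_(l < N) cos (l%:R * y) =
    sin (N%:R * y - y / 2) + sin (y / 2).
  elim: N => [|N IH]; first by rewrite big_ord0 mulr0 mul0r add0r sinN addNr.
  rewrite big_ord_recr/= mulrDr IH.
  rewrite (_ : N.+1%:R * y - y / 2 = N%:R * y + y / 2); last by rewrite -[N.+1%:R]natr1; lra.
  rewrite sinB sinD; ring.
have s0 : y / 4 <= sin (y / 2).
  by have := @sin_ge_half (y / 2); rewrite (_ : y / 2 / 2 = y / 4); [apply; lra|lra].
rewrite ler_pdivlMr//.
have : `|2 * sin (y / 2) * \sum_(l < N) cos (l%:R * y)| <= 2.
  rewrite E; apply: (le_trans (ler_normD _ _)).
  by rewrite (_ : 2 = 1 + 1)// lerD// ler_norml sin_geN1 sin_le1.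
rewrite normrM ger0_norm; last lra.
have : 0 <= `|\sum_(l < N) cos (l%:R * y)| by [].
move: `|\sum_(l < N) _| => t; nra.
Qed.

(** The left side is at most min(2^J, 4 / |y|). Written as a sum over the dyadic scales above |y|,
    this bound turns sums over pairs of points into counts of the pairs at distance at most 2^-i. *)
Lemma dirichlet_dyadic_le (y : R) J : `|y| <= 1 ->
  `|\sum_(l < 2 ^ J) cos (l%:R * y)| <=
  8 * \sum_(i < J.+1) (if `|y| <= (2 ^+ i)^-1 then 2 ^+ i else 0).
Proof.
move=> y1.
have term0 (i : 'I_J.+1) : 0 <= (if `|y| <= (2 ^+ i)^-1 then 2 ^+ i else 0) :> R.
  by case: ifP => // _; exact: ltW.
have pick k : (k <= J)%N -> `|y| <= (2 ^+ k)^-1 ->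
    2 ^+ k <= \sum_(i < J.+1) (if `|y| <= (2 ^+ i)^-1 then 2 ^+ i else 0) :> R.
  move=> kJ yk; rewrite (bigD1 (Ordinal (kJ : (k < J.+1)%N)))//= yk lerDl.
  by apply: sumr_ge0 => i _.
have [yJ|yJ] := leP `|y| (2 ^+ J)^-1.
  have triv : `|\sum_(l < 2 ^ J) cos (l%:R * y)| <= 2 ^+ J.
    apply: (le_trans (ler_norm_sum _ _ _)).
    apply: (@le_trans _ _ (\sum_(l < 2 ^ J) 1)).
      by apply: ler_sum => l _; rewrite ler_norml cos_geN1 cos_le1.
    by rewrite sumr_const card_ord -natrX.
  by have := pick J (leqnn _) yJ; have := exp2_gt0 (R := R) J; lra.
have y0 : 0 < `|y| by apply: lt_trans yJ; rewrite invr_gt0.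
have -> : \sum_(l < 2 ^ J) cos (l%:R * y) = \sum_(l < 2 ^ J) cos (l%:R * `|y|).
  apply: eq_bigr => l _; have [_|_] := ger0P y => //.
  by rewrite mulrN cosN.
apply: (le_trans (dirichlet_sum_le _ _)); first by rewrite y0.
move: y1; rewrite le_eqVlt => /predU1P[y1|y1].
  by have := pick 0%N (leq0n _); rewrite expr0 invr1 y1 lexx => /(_ isT); lra.
have [k /andP[k1 k2]] := dyadic_scale y0 y1.
have kJ : (k <= J)%N.
  rewrite leqNgt; apply/negP => Jk.
  have : (2 ^+ k)^-1 <= (2 ^+ J)^-1 :> R by rewrite lef_pV2 ?posrE// ler_eXn2l ?ltr1n// ltnW.
  by move=> /(lt_le_trans k2) /(lt_trans yJ); rewrite ltxx.
have := pick k kJ (ltW k2).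
have : 4 / `|y| <= 8 * 2 ^+ k.
  rewrite ler_pdivrMr//; move: k1; rewrite exprS invfM.
  rewrite -(ler_pM2l (exp2_gt0 (R := R) k)) mulrCA mulfV// mulr1; lra.
lra.
Qed.

Lemma count_close_le (n j : nat) (r : R) : (j < n)%N -> 0 <= r ->
  \sum_(m < n) (if `|j%:R - m%:R| <= r then 1 else 0 : R) <= 2 * (r + 1).
Proof.
move=> jn r0; pose P (l : nat) : R := if l%:R <= r then 1 else 0.
have -> : \sum_(m < n) (if `|j%:R - m%:R| <= r then 1 else 0 : R) =
    \sum_(m < n) P (j - m + (m - j))%N.
  apply: eq_bigr => m _; rewrite /P; congr (if _ <= _ then _ else _).
  have [mj|jm] := leqP m j.
    by rewrite (eqP mj) addn0 natrB// ger0_norm// subr_ge0 ler_nat.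
  rewrite (_ : j - m = 0)%N; last by lia.
  by rewrite add0n natrB 1?ltnW// distrC ger0_norm// subr_ge0 ler_nat ltnW.
have P0 l : 0 <= P l by rewrite /P; case: ifP.
apply: (le_trans (sum_dist_row_le P0 jn)); rewrite ler_wpM2l//.
apply: (@le_trans _ _ ((Num.truncn r).+1)%:R); last first.
  by have /andP[] := truncn_itv r0; rewrite -[(Num.truncn r).+1]addn1 natrD; lra.
elim: n {jn} => [|n IH]; first by rewrite big_ord0.
suff -> : \sum_(l < n.+1) P l = (minn n.+1 (Num.truncn r).+1)%:R.
  by rewrite ler_nat geq_minr.
elim: n.+1 => [|m IHm]; first by rewrite big_ord0 min0n.
rewrite big_ord_recr/= IHm /P -truncn_ge_nat//.
by case: ifPn => h; [rewrite natr1|rewrite addr0]; congr (_%:R); lia.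
Qed.

Definition avg_power (n : nat) (z : nat -> R) (c : R) : R :=
  (n%:R^-1 * \sum_(j < n) cos (c * z j)) ^+ 2 + (n%:R^-1 * \sum_(j < n) sin (c * z j)) ^+ 2.

Lemma avg_power_ge0 n z c : 0 <= avg_power n z c.
Proof. by rewrite addr_ge0 ?sqr_ge0. Qed.

Lemma avg_powerE n z c : avg_power n z c =
  n%:R^-1 ^+ 2 * \sum_(j < n) \sum_(m < n) cos (c * (z j - z m)).
Proof.
rewrite /avg_power !exprMn -mulrDr !expr2 !mulr_suml -big_split/=; congr (_ * _).
apply: eq_bigr => j _; rewrite !mulr_sumr -big_split/=; apply: eq_bigr => m _.
by rewrite mulrBr cosB.
Qed.

(* A t-Frostman family has mean energy at most 2^(J (1 - t)) over the first
   2^J frequencies: sum the Dirichlet kernel over dyadic distances. *)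
Lemma avg_power_sum_le (C a t : R) : 0 < C -> 0 < a -> 0 <= t < 1 ->
  exists2 B, 0 < B & forall (n J : nat) (z : nat -> R), (2 ^ J <= n)%N ->
    (forall j m, (j < n)%N -> (m < n)%N -> a * `|z j - z m| <= 1) ->
    (forall j m, (j < n)%N -> (m < n)%N ->
       `|j%:R - m%:R| <= C * n%:R * `|z j - z m| `^ t) ->
  \sum_(l < 2 ^ J) avg_power n z (l%:R * a) <= B * (2 `^ (1 - t)) ^+ J.
Proof.
move=> C0 a0 /andP[t0 t1].
pose rho : R := 2 `^ (1 - t).
have rho1 : 1 < rho by apply: powR2_gt1; lra.
pose D := 2 * (C * a^-1 `^ t + 1).
have D0 : 0 < D by rewrite mulr_gt0 ?addr_gt0 ?mulr_gt0 ?powR_gt0 ?invr_gt0.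
exists (8 * D * (rho / (rho - 1))).
  have r1 : 0 < rho / (rho - 1) by rewrite divr_gt0 ?subr_gt0// (lt_trans ltr01).
  by apply: mulr_gt0 r1; rewrite mulr_gt0.
move=> n J z Jn za zC.
have n0 : 0 < n%:R :> R by rewrite ltr0n; apply: leq_trans Jn; rewrite expn_gt0.
have row (j : 'I_n) : \sum_(m < n) `|\sum_(l < 2 ^ J) cos (l%:R * (a * (z j - z m)))| <=
    8 * (n%:R * D * \sum_(i < J.+1) rho ^+ i).
  apply: (@le_trans _ _ (\sum_(m < n) 8 *
      \sum_(i < J.+1) (if `|a * (z j - z m)| <= (2 ^+ i)^-1 then 2 ^+ i else 0))).
    apply: ler_sum => m _; apply: dirichlet_dyadic_le.
    by rewrite normrM gtr0_norm// za.
  rewrite -mulr_sumr ler_wpM2l// exchange_big/= mulr_sumr; apply: ler_sum => i _.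
  pose r : R := C * n%:R * ((2 ^+ i)^-1 * a^-1) `^ t.
  have r0 : 0 <= r by rewrite !mulr_ge0 ?powR_ge0// ltW.
  apply: (@le_trans _ _ (2 ^+ i * \sum_(m < n) (if `|j%:R - m%:R| <= r then 1 else 0 : R))).
    rewrite mulr_sumr; apply: ler_sum => m _.
    case: ifPn => h; last by case: ifP; rewrite ?mulr1 ?mulr0// ltW.
    rewrite ifT ?mulr1//; apply: (le_trans (zC _ _ (ltn_ord j) (ltn_ord m))).
    rewrite ler_wpM2l ?mulr_ge0 ?(ltW C0)//.
    rewrite ge0_ler_powR ?nnegrE ?mulr_ge0 ?invr_ge0 ?(ltW a0) ?(ltW (exp2_gt0 _))//.
    by rewrite ler_pdivlMr// mulrC -[X in X * _](gtr0_norm a0) -normrM.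
  apply: (@le_trans _ _ (2 ^+ i * (2 * (r + 1)))).
    by rewrite ler_wpM2l ?(ltW (exp2_gt0 _))// count_close_le.
  have ti : (2 ^+ i)^-1 `^ t = 2 `^ (- t) ^+ i :> R.
    by rewrite -!powR_mulrn ?powR_ge0// -powRN -!powRrM; congr powR; ring.
  have rhoi : rho ^+ i = 2 ^+ i * 2 `^ (- t) ^+ i :> R.
    rewrite -exprMn; congr (_ ^+ _); rewrite /rho powRD; first by rewrite powRr1.
    by rewrite pnatr_eq0 implybT.
  (* The hypothesis 2^J <= n enters here: n 2^(-t i) >= 1 at every scale i <= J, which absorbs the +
     1 in the count of close indices. *)
  have nt : 1 <= n%:R * 2 `^ (- t) ^+ i.
    rewrite powRN exprVn ler_pdivlMr ?exprn_gt0 ?powR_gt0// mul1r.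
    apply: (@le_trans _ _ (2 ^+ i)).
      by rewrite lerXn2r ?nnegrE ?powR_ge0// -[leRHS]powRr1// ler_powR ?ler1n// ltW.
    rewrite -natrX ler_nat (leq_trans _ Jn)// leq_exp2l// -ltnS; exact: ltn_ord.
  rewrite /r powRM ?invr_ge0 ?(ltW a0) ?(ltW (exp2_gt0 _))// ti rhoi /D.
  set w := 2 `^ (- t) ^+ i; set v := a^-1 `^ t.
  have -> : n%:R * (2 * (C * v + 1)) * (2 ^+ i * w) = 2 ^+ i * (2 * (C * n%:R * (w * v) + n%:R * w)) by ring.
  by rewrite ler_wpM2l ?(ltW (exp2_gt0 _))// ler_wpM2l// lerD2l.
under eq_bigr do rewrite avg_powerE.
rewrite -mulr_sumr exchange_big/=; under eq_bigr do rewrite exchange_big/=.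
apply: (@le_trans _ _ (n%:R^-1 ^+ 2 * \sum_(j < n) 8 * (n%:R * D * \sum_(i < J.+1) rho ^+ i))).
  rewrite ler_wpM2l ?sqr_ge0//; apply: ler_sum => j _; apply: le_trans (row j).
  apply: ler_sum => m _; apply: le_trans (ler_norm _) _.
  by under eq_bigr do rewrite -mulrA.
rewrite sumr_const card_ord -[X in _ * X](mulr_natl _ n).
apply: (@le_trans _ _ (n%:R^-1 ^+ 2 * (n%:R * (8 * (n%:R * D * (rho ^+ J.+1 / (rho - 1))))))).
  rewrite ler_wpM2l ?sqr_ge0// ler_wpM2l ?(ltW n0)// ler_wpM2l//.
  by rewrite ler_wpM2l ?geometric_sum_le// mulr_ge0 ?(ltW n0) ?(ltW D0).
rewrite -/rho (exprS rho) le_eqVlt; apply/orP; left; apply/eqP; field.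
by rewrite !gt_eqF// subr_gt0.
Qed.

End energy.

(** * Fourier dimension *)

Section finite_measure_functional.
Context {R : realType}.
Local Notation measure_on_R := {finite_measure set (measurableTypeR R) -> \bar R}.
Implicit Types (mu : measure_on_R) (D : set R) (f g : R -> R).

Lemma bounded_measurable_integrable mu D f : measurable D -> bounded_measurable f ->
  mu.-integrable D (EFin \o f).
Proof.
move=> mD [mf [K fK]]; apply: measurable_bounded_integrable => //.
- by rewrite -ge0_fin_numE ?measure_ge0//; exact: fin_num_measure.
- exact: measurable_funTS.
- by exists K; split; [exact: num_real|move=> x Kx y _; exact: le_trans (fK y) (ltW Kx)].
Qed.

Lemma integral_pos_functional mu D : measurable D ->
  pos_functional D (fun f => \int[mu]_(x in D) f x).
Proof.
move=> mD; split.
- by move=> f g bf bg; apply: RintegralD => //; exact: bounded_measurable_integrable.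
- by move=> c f bf; apply: RintegralZl => //; exact: bounded_measurable_integrable.
- by move=> f g bf bg fg; apply: le_Rintegral => //; exact: bounded_measurable_integrable.
Qed.

Lemma integral_carrier mu D f : measurable D -> mu (~` D) = 0%E -> bounded_measurable f ->
  \int[mu]_x f x = \int[mu]_(x in D) f x.
Proof.
move=> mD D0 bf; rewrite -(setUv D) Rintegral_setU//; last 3 first.
- exact: measurableC.
- by rewrite setUv; exact: bounded_measurable_integrable.
- by rewrite disj_set2E setICr.
rewrite [X in _ + X](_ : _ = 0) ?addr0//.
rewrite /Rintegral null_set_integral//.
- exact: measurableC.
- by apply/measurable_EFinP; apply: measurable_funTS; case: bf.
Qed.

Lemma integral_indicator mu D A : measurable D -> measurable A -> A `<=` D ->
  \int[mu]_(x in D) \1_A x = fine (mu A).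
Proof.
by move=> mD mA AD; rewrite /Rintegral integral_indic// setIidl.
Qed.

(** Compares [E g] with a Riemann sum, by squeezing [g] between two step functions on the partition
    formed by the [B i]. *)
Lemma pos_functional_mesh (S : set R) (E : (R -> R) -> R) (N : nat)
    (B : nat -> set R) (c q : nat -> R) (eta : R) g :
  pos_functional S E -> bounded_measurable g ->
  (forall i, measurable (B i)) ->
  (forall x, S x -> exists i, [/\ (i < N)%N, B i x & forall j, (j < N)%N -> B j x -> j = i]) ->
  (forall i, (i < N)%N -> E (\1_(B i)) = q i) ->
  (forall i x, (i < N)%N -> S x -> B i x -> `|g x - c i| <= eta) ->
  `|E g - \sum_(i < N) c i * q i| <= eta * \sum_(i < N) q i.
Proof.
move=> posE bg mB part Eq gc; have [ED EZ Emono] := posE.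
have bB i : bounded_measurable (\1_(B i) : R -> R) by exact: bounded_measurable_indic.
pose step (d : nat -> R) x := \sum_(i < N) d i * \1_(B i) x.
have bstep d : bounded_measurable (step d).
  by apply: bounded_measurable_sum => i; exact: bounded_measurableZ.
have Estep d : E (step d) = \sum_(i < N) d i * q i.
  rewrite /step (pos_functional_sum posE); last by move=> i; exact: bounded_measurableZ.
  by apply: eq_bigr => i _; rewrite EZ// Eq.
have stepE d x i : (i < N)%N -> B i x -> (forall j, (j < N)%N -> B j x -> j = i) -> step d x = d i.
  move=> iN Bi uni; rewrite /step (bigD1 (Ordinal iN))//= indicE mem_set// mulr1.
  rewrite big1 ?addr0// => j ji; rewrite indicE memNset ?mulr0// => Bj.
  by move: ji; rewrite -val_eqE/= (uni _ (ltn_ord j) Bj) eqxx.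
have up : E g <= \sum_(i < N) (c i + eta) * q i.
  rewrite -(Estep (fun i => c i + eta)); apply: Emono => // x Sx; have [i [iN Bi uni]] := part x Sx.
  by rewrite (stepE _ _ _ iN Bi uni); have := gc i x iN Sx Bi; rewrite ler_norml; lra.
have dn : \sum_(i < N) (c i - eta) * q i <= E g.
  rewrite -(Estep (fun i => c i - eta)); apply: Emono => // x Sx; have [i [iN Bi uni]] := part x Sx.
  by rewrite (stepE _ _ _ iN Bi uni); have := gc i x iN Sx Bi; rewrite ler_norml; lra.
have eD d e : \sum_(i < N) (d i + e) * q i = \sum_(i < N) d i * q i + e * \sum_(i < N) q i.
  by rewrite mulr_sumr -big_split/=; apply: eq_bigr => i _; rewrite mulrDl.
have := up; have := dn; rewrite (eD c eta) (eD c (- eta)) ler_norml; lra.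
Qed.

(** Every point off the support lies in an open null set, hence in a null interval with rational
    ends, and there are only countably many of these. *)
Lemma supp_carrier mu D : closed D -> supp mu `<=` D -> mu (~` D) = 0%E.
Proof.
move=> cD muD.
have oD : open (~` D) by rewrite openC.
pose B (pq : rat * rat) : set R := if pselect (mu `]ratr pq.1, ratr pq.2[%classic = 0%E)
  then `]ratr pq.1, ratr pq.2[%classic else set0.
have mB pq : measurable (B pq).
  by rewrite /B; case: pselect => [?|?]; [exact: measurable_itv|exact: measurable0].
have mB0 pq : mu (B pq) = 0%E.
  by rewrite /B; case: pselect => [//|?]; rewrite measure0.
have cov : ~` D `<=` \bigcup_n (if unpickle n is Some pq then B pq else set0).
  move=> x Dx.
  have /existsNP[U /not_implyP[oU /not_implyP[Ux /negP]]] : ~ supp mu x by move=> /muD.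
  rewrite -leNgt => muU.
  have : nbhs x U by exact: open_nbhs_nbhs.
  case/nbhs_ballP => e /= e0 eU.
  have [|p] := @rat_in_itvoo R (x - e) (x); first lra.
  rewrite in_itv/= => /andP[p1 p2].
  have [|q] := @rat_in_itvoo R (x) (x + e); first lra.
  rewrite in_itv/= => /andP[q1 q2].
  exists (pickle (p, q)); first exact: Logic.I.
  rewrite pickleK /B.
  case: pselect => [?|]; first by rewrite /= in_itv/= p2 q1.
  case; apply/eqP; rewrite eq_le measure_ge0 andbT; apply: le_trans muU.
  apply: le_measure; rewrite ?inE//; first exact: open_measurable.
  move=> y /=; rewrite in_itv/= => /andP[y1 y2]; apply: eU.
  rewrite /ball/= ltr_norml; lra.
apply/eqP; rewrite eq_le measure_ge0 andbT.
apply: le_trans (measure_sigma_subadditive mu _ _ cov) _.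
- by move=> n; case: (unpickle n) => [pq|]; [exact: mB|exact: measurable0].
- exact: open_measurable.
rewrite eseries0 ?lexx// => n _ _.
by case: (unpickle n) => [pq|]; [exact: mB0|exact: measure0].
Qed.

Lemma normc_fourier mu (xi : R) : Normc.normc (fourier mu xi) ^+ 2 =
  power_at (fun f => \int[mu]_x f x) (2 * pi * xi).
Proof.
rewrite /fourier /cintegral /= sqr_sqrtr ?addr_ge0 ?sqr_ge0//.
rewrite /power_at; congr (_ ^+ 2 + _).
  by apply: eq_Rintegral => x _; rewrite cosN; congr cos; ring.
have [_ EZ _] := integral_pos_functional mu measurableT.
rewrite -[RHS]sqrrN -mulN1r -EZ; last exact: bounded_measurable_sin.
by congr (_ ^+ 2); apply: eq_Rintegral => x _; rewrite mulN1r sinN; congr (- sin _); ring.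
Qed.

End finite_measure_functional.

Section fourier_dimension.
Context {R : realType}.
Local Notation measure_on_R := {finite_measure set (measurableTypeR R) -> \bar R}.
Implicit Types (A : set R) (s : R).

Definition decaying_functional A (E : (R -> R) -> R) s :=
  [/\ pos_functional A E, 0 < E (fun=> 1)
    & exists K, forall xi, power_at E xi * `|xi| `^ s <= K].

Definition fourier_exponents A : set R := [set s | [/\ 0 < s, s < 1 &
    exists2 mu, compactly_supported_in A mu &
      (ereal_sup (range (fun xi : R =>
         (Normc.normc (fourier mu xi) ^+ 2 * `|xi| `^ s)%:E)) < +oo)%E]].

Lemma fourier_exponent_functional A s : compact A -> fourier_exponents A s ->
  exists E, decaying_functional A E s.
Proof.
move=> cA [s0 s1 [mu [mu0 _ muA] supfin]].
have clA : closed A by exact: compact_closed.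
have mA : measurable A by exact: closed_measurable.
have muC : mu (~` A) = 0%E by exact: supp_carrier.
pose E f := \int[mu]_(x in A) f x.
have posE : pos_functional A E by exact: integral_pos_functional.
have TE f : bounded_measurable f -> \int[mu]_x f x = E f by exact: integral_carrier.
have powE xi : power_at (fun f => \int[mu]_x f x) xi = power_at E xi.
  rewrite /power_at !TE//; first exact: bounded_measurable_sin.
  exact: bounded_measurable_cos.
exists E; split => //.
  rewrite -TE; last exact: bounded_measurable_cst.
  rewrite Rintegral_cst// mul1r fine_gt0// lt0e mu0 measure_ge0/=.
  by rewrite -ge0_fin_numE ?measure_ge0//; exact: fin_num_measure.
pose v (xi : R) := Normc.normc (fourier mu xi) ^+ 2 * `|xi| `^ s.
have [K vK] : exists K, forall xi, v xi <= K.
  have ub xi : ((v xi)%:E <= ereal_sup (range (fun xi => (v xi)%:E)))%E.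
    by apply: ereal_sup_ubound; exists xi.
  move: supfin ub; rewrite -/v; case: (ereal_sup _) => [K| |]//= _ ub.
    by exists K => xi; rewrite -lee_fin.
  by have := ub 0; rewrite leeNy_eq.
have tp0 : 0 < 2 * pi :> R by rewrite mulr_gt0// pi_gt0.
exists (K * (2 * pi) `^ s) => xi.
have := vK (xi / (2 * pi)); rewrite /v normc_fourier powE.
rewrite [2 * pi * _]mulrC divfK ?gt_eqF// normrM normfV (gtr0_norm tp0).
have tpV : 0 <= (2 * pi)^-1 :> R by rewrite invr_ge0 ltW.
rewrite (powRM s (normr_ge0 xi) tpV) => H.
have p0 : 0 < (2 * pi) `^ s by exact: powR_gt0.
rewrite -(ler_pM2r p0) in H; apply: le_trans H.
rewrite -(powR_inv1 (ltW tp0)) powRAC powR_inv1 ?powR_ge0//.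
by rewrite mulrA divfK ?gt_eqF.
Qed.

(** The powers at the first 2^J integer frequencies add up to O(2^((1 - s) J)), while the set is
    covered by O(2^(alpha J)) cells of width about 2^-J. The covering bound then gives E(1)^2 =
    O(2^(-(s - alpha) J)), which is impossible for s > alpha. *)
Lemma decaying_functional_exponent_le alpha pos s E : 0 <= alpha <= 1 ->
  cantor_scheme alpha pos -> 0 < s < 1 ->
  decaying_functional (cantor_set alpha pos) E s -> s <= alpha.
Proof.
move=> alpha01 posP /andP[s0 s1] [posE E1 [K EK]].
have /andP[a0 a1] := alpha01.
rewrite leNgt; apply/negP => sa.
pose A := K + E (fun=> 1) ^+ 2.
have K0 : 0 <= K by apply: le_trans (EK 0); rewrite mulr_ge0 ?powR_ge0 ?power_at_ge0.
have A0 : 0 < A by rewrite ltr_wpDl ?exprn_gt0.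
pose r : R := 2 * 2 `^ (- s).
have r1 : 1 < r.
  have -> : r = 2 `^ (1 - s).
    by rewrite /r powRD ?powRr1// pnatr_eq0 implybT.
  by apply: powR2_gt1; lra.
pose A' := A * (1 + 2 / (r - 1)).
have d0 : 0 < r - 1 by rewrite subr_gt0.
have A'0 : 0 < A' by rewrite mulr_gt0// addr_gt0// divr_gt0.
have sumJ J : \sum_(l < 2 ^ J) power_at E (l%:R * 1) <= A' * r ^+ J.
  have rJ : 1 <= r ^+ J by rewrite exprn_ege1// ltW.
  have := @dyadic_sum_prod_le R (fun l => power_at E (l%:R * 1)) (fun=> 1) A 1 s 2 J.
  under eq_bigr do rewrite mulr1; rewrite mulr1 => /(_ (ltW A0) (ltW s0)).
  move=> H; apply: (le_trans (H _ _ _ _)) => //.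
  - by rewrite (power_at0 posE) lerDr.
  - move=> l /andP[l0 _]; rewrite /= mulr1 powRN ler_pdivlMr ?powR_gt0 ?ltr0n//.
    have := EK l%:R; rewrite normr_nat => /le_trans; apply.
    by rewrite lerDl sqr_ge0.
  - by move=> i _; rewrite sumr_const card_ord mul1r natrX.
  rewrite mulr1 /A' -(mulrA A) ler_wpM2l ?(ltW A0)// [leRHS]mulrDl mul1r lerD//.
  by rewrite -mulrA ler_wpM2l// [leRHS]mulrC; exact: geometric_sum_le.
have main J : E (fun=> 1) ^+ 2 <= 16 * A' * 2 `^ (alpha * 4) * 2 `^ (- ((s - alpha) * J%:R)).
  (* With N = 2^J, a = 1 and cells of width 2^-k, the product N a eps is 1/16, within the limit 1/2.
     [H] also contains the right neighbours because the kept cells are closed, whereas the covering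
     cells are half-open. *)
  pose k := (J + 4)%N.
  pose H := undup ([seq pos k i | i <- iota 0 (cells alpha k)] ++
                   [seq (pos k i).+1 | i <- iota 0 (cells alpha k)]).
  have sH : (size H)%:R <= 2 * 2 `^ (alpha * k%:R) :> R.
    apply: (@le_trans _ _ (2 * (cells alpha k)%:R)); last first.
      by rewrite ler_wpM2l// cells_le_powR.
    rewrite -natrM ler_nat (leq_trans (size_undup _))//.
    by rewrite size_cat !size_map size_iota mul2n addnn.
  have cov x : cantor_set alpha pos x -> exists2 c, c \in H &
      `[1 + c%:R * (2 ^+ k)^-1, 1 + c.+1%:R * (2 ^+ k)^-1[%classic x.
    move=> /(_ k) [i [iN /andP[x1 x2]]].
    have iI : i \in iota 0 (cells alpha k) by rewrite mem_iota.
    have [xlt|xge] := ltP x (node k (pos k i).+1).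
      exists (pos k i); last by rewrite /= in_itv/= x1.
      by rewrite mem_undup mem_cat; apply/orP; left; exact: map_f.
    exists (pos k i).+1.
      by rewrite mem_undup mem_cat; apply/orP; right; exact: (map_f (fun i => (pos k i).+1)).
    rewrite /= in_itv/=; apply/andP; split; first exact: xge.
    by apply: (le_lt_trans x2); rewrite [ltRHS]nodeS ltrDl invr_gt0.
  have NJ : (0 < 2 ^ J)%N by rewrite expn_gt0.
  have e0 : 0 < (2 ^+ k)^-1 :> R by rewrite invr_gt0.
  have Nae : (2 ^ J)%:R * 1 * (2 ^+ k)^-1 <= 1 / 2 :> R.
    by rewrite mulr1 natrX /k exprD invfM mulrA mulfV// mul1r; lra.
  have := pos_functional_cover_le posE e0 ltr01 NJ Nae (undup_uniq _) cov.
  move=> /le_trans; apply.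
  apply: (@le_trans _ _ (8 * (2 * 2 `^ (alpha * k%:R)) / (2 ^ J)%:R * (A' * r ^+ J))).
    apply: ler_pM => //.
    - by apply: sumr_ge0 => l _; exact: power_at_ge0.
    - by rewrite ler_wpM2r ?invr_ge0// ler_wpM2l.
  have -> : 2 `^ (alpha * k%:R) = 2 `^ (alpha * 4) * 2 `^ (alpha * J%:R) :> R.
    by rewrite -powRD ?pnatr_eq0 ?implybT//; congr powR; rewrite /k natrD; ring.
  have -> : 2 `^ (- ((s - alpha) * J%:R)) = 2 `^ (alpha * J%:R) * (2 `^ (- s)) ^+ J :> R.
    rewrite -powR_mulrn ?powR_ge0// -powRrM -powRD ?pnatr_eq0 ?implybT//.
    by congr powR; ring.
  rewrite natrX /r exprMn le_eqVlt; apply/orP; left; apply/eqP; field.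
  exact: exp2_neq0.
have sa0 : 0 < s - alpha by rewrite subr_gt0.
have [J] := powR2_unbounded (16 * A' * 2 `^ (alpha * 4) / E (fun=> 1) ^+ 2) sa0.
rewrite ltr_pdivrMr ?exprn_gt0//.
have := main J; rewrite powRN ler_pdivlMr ?powR_gt0// mulrC; lra.
Qed.

End fourier_dimension.

(** * Images of Lebesgue measure on the unit interval *)

Section law.
Context {R : realType}.
Local Notation realM := (measurableTypeR R).

Definition unit_itv : set R := `[0, 1[%classic.

Lemma measurable_unit_itv : measurable (unit_itv : set realM).
Proof. exact: measurable_itv. Qed.

Lemma lebesgue_unit_itv_lty : (lebesgue_measure (unit_itv : set realM) < +oo)%E.
Proof. by rewrite /unit_itv lebesgue_measure_itv/= lte_fin ltr01 oppr0 adde0 ltry. Qed.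

Definition unit_lebesgue : {finite_measure set realM -> \bar R} :=
  mfrestr measurable_unit_itv lebesgue_unit_itv_lty.

Variable g : realM -> realM.
Hypothesis mg : measurable_fun [set: realM] g.

Definition law (A : set realM) : \bar R := pushforward unit_lebesgue g A.

Let law0 : law set0 = 0%E. Proof. exact: measure0. Qed.

Let law_ge0 A : (0 <= law A)%E. Proof. exact: measure_ge0. Qed.

Let law_sigma_additive : semi_sigma_additive law.
Proof. exact: measure_semi_sigma_additive. Qed.

HB.instance Definition _ := isMeasure.Build _ _ _ law law0 law_ge0 law_sigma_additive.

Let law_fin : fin_num_fun law.
Proof.
move=> A mA; apply: fin_num_measure.
by rewrite -[X in measurable X]setTI; exact: mg.
Qed.

HB.instance Definition _ := Measure_isFinite.Build _ _ _ law law_fin.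

Definition law_measure : {finite_measure set realM -> \bar R} := law.

Lemma unit_lebesgueE A : unit_lebesgue A = lebesgue_measure (A `&` unit_itv).
Proof. by []. Qed.

Lemma integral_law (f : R -> R) : bounded_measurable f ->
  \int[law_measure]_x f x = \int[unit_lebesgue]_(u in unit_itv) f (g u).
Proof.
move=> bf; have bfg : bounded_measurable (fun u => f (g u)) by exact: bounded_measurable_comp.
have C0 : unit_lebesgue (~` unit_itv) = 0%E.
  by rewrite unit_lebesgueE setICl measure0.
rewrite -(integral_carrier measurable_unit_itv C0 bfg).
rewrite /Rintegral; congr fine.
have mf : measurable_fun [set: realM] (EFin \o f) by apply/measurable_EFinP; case: bf.
have mgM : measurable_fun [set: realM] g by exact: mg.
have intf : unit_lebesgue.-integrable (g @^-1` [set: realM]) ((EFin \o f) \o g).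
  by rewrite preimage_setT; exact: bounded_measurable_integrable.
have := integral_pushforward mgM mf intf measurableT.
rewrite preimage_setT => <-.
by apply: eq_measure_integral => A mA _.
Qed.

Lemma law_supp (S : set R) : closed S -> (forall u, 0 <= u < 1 -> S (g u)) ->
  supp law_measure `<=` S.
Proof.
move=> cS gS x sx; apply: contrapT => Sx.
have := sx (~` S); rewrite openC => /(_ cS Sx).
rewrite (_ : law_measure (~` S) = 0%E) ?ltxx//.
rewrite [LHS]/= /law /pushforward unit_lebesgueE (_ : _ `&` _ = set0) ?measure0//.
apply/seteqP; split => // u [nS]; rewrite /unit_itv/= in_itv/= => /gS.
exact: nS.
Qed.

Lemma law_setT : law_measure setT = 1%E.
Proof.
rewrite [LHS]/= /law /pushforward unit_lebesgueE preimage_setT setTI.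
by rewrite /unit_itv lebesgue_measure_itv/= lte_fin ltr01 oppr0 adde0.
Qed.

End law.

Section mesh.
Context {R : realType}.

Lemma unit_mesh (N : nat) (g : R -> R) (c : nat -> R) (eta : R) : (0 < N)%N ->
  bounded_measurable g ->
  (forall i u, (i < N)%N -> 0 <= u < 1 -> Num.truncn (N%:R * u) = i -> `|g u - c i| <= eta) ->
  `|\int[unit_lebesgue]_(u in unit_itv) g u - N%:R^-1 * \sum_(i < N) c i| <= eta.
Proof.
move=> N0 bg gc.
have NR : 0 < N%:R :> R by rewrite ltr0n.
pose B (i : nat) : set R := `[i%:R / N%:R, i.+1%:R / N%:R[%classic.
have BE i u : B i u -> Num.truncn (N%:R * u) = i.
  rewrite /B/= in_itv/= ler_pdivrMr// ltr_pdivlMr// => /andP[u1 u2].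
  by apply: truncn_def; rewrite mulrC u1 u2.
have BI i u : 0 <= u -> Num.truncn (N%:R * u) = i -> B i u.
  move=> u0 <-; rewrite /B/= in_itv/= ler_pdivrMr// ltr_pdivlMr// mulrC.
  by apply: truncn_itv; rewrite mulr_ge0.
have Bsub i : (i < N)%N -> B i `<=` unit_itv.
  move=> iN u; rewrite /B /unit_itv/= !in_itv/= => /andP[u1 u2]; apply/andP; split.
    by apply: le_trans u1; rewrite divr_ge0.
  by apply: (lt_le_trans u2); rewrite ler_pdivrMr// mul1r ler_nat.
have mB i : measurable (B i) by exact: measurable_itv.
have posE := integral_pos_functional unit_lebesgue (measurable_unit_itv (R := R)).
have := pos_functional_mesh (N := N) (B := B) (c := c) (q := fun=> N%:R^-1) (eta := eta) posE bg mB.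
rewrite -mulr_suml mulrC sumr_const card_ord -[_^-1 *+ N](mulr_natl _ N) mulfV ?gt_eqF// mulr1.
apply.
- move=> u; rewrite /unit_itv/= in_itv/= => /andP[u0 u1].
  exists (Num.truncn (N%:R * u)); split.
  + by rewrite truncn_lt_nat ?mulr_ge0// gtr_pMr.
  + exact: BI.
  + by move=> j jN /BE.
- move=> i iN; rewrite integral_indicator//; [|exact: measurable_unit_itv|exact: Bsub].
  rewrite unit_lebesgueE setIidl; last exact: Bsub.
  rewrite /B lebesgue_measure_itv/= lte_fin ltr_pM2r ?invr_gt0// ltr_nat ltnSn.
  by rewrite -EFinB/= -mulrBl -[i.+1]addn1 natrD addrC addKr mul1r.
- move=> i u iN; rewrite /unit_itv/= in_itv/= => u01 Bu.
  by apply: gc => //; exact: BE.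
Qed.

End mesh.

(** * The Fourier dimension of the Cantor set *)

Section cantor_fourier.
Context {R : realType}.

Lemma profile_le (B L B' L' sigma : R) phi Psi : B <= B' -> L <= L' ->
  profile B L sigma phi Psi -> profile B' L' sigma phi Psi.
Proof.
move=> BB LL [h1 h2 h3]; split.
- by move=> x h; apply: (le_trans (h1 x h)); rewrite ler_wpM2r ?sqr_ge0.
- by move=> x /h2 /le_trans; apply; rewrite ler_wpM2r ?powR_ge0.
- by move=> x /h3 /le_trans; apply; rewrite ler_wpM2r ?powR_ge0.
Qed.

Lemma cos_profile : profile (1 : R) 1 0 cos sin.
Proof.
split; first exact: sin_quad.
- by move=> x _; rewrite oppr0 powRr0 mul1r ler_norml cos_geN1 cos_le1.
- by move=> x _; rewrite oppr0 powRr0 mul1r ler_norml sin_geN1 sin_le1.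
Qed.

Lemma sin_profile : profile (1 : R) 1 0 sin (fun x => - cos x).
Proof.
split; first exact: cos_quad.
- by move=> x _; rewrite oppr0 powRr0 mul1r ler_norml sin_geN1 sin_le1.
- by move=> x _; rewrite oppr0 powRr0 mul1r normrN ler_norml cos_geN1 cos_le1.
Qed.

Variable alpha : R.
Hypothesis alpha01 : 0 <= alpha <= 1.
Variable pos : nat -> nat -> nat.
Hypothesis posP : cantor_scheme alpha pos.

Local Notation theta := (cantor_map alpha pos).

(** A point of the Cantor set in the i-th kept cell of order k. The left end of that cell would not
    do, since later choices may discard it. *)
Definition cantor_point k i : R := theta (i%:R / (cells alpha k)%:R).

Lemma cantor_point_in k i : (i < cells alpha k)%N -> cantor_set alpha pos (cantor_point k i).
Proof.
move=> iN; apply: cantor_map_in => //.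
have N0 : 0 < (cells alpha k)%:R :> R by rewrite ltr0n cells_gt0.
by rewrite divr_ge0//= ltr_pdivrMr// mul1r ltr_nat.
Qed.

Lemma cantor_point_avg B L sigma phi Psi k xi : profile B L sigma phi Psi -> 1 <= xi ->
  `|(cells alpha k)%:R^-1 * \sum_(i < cells alpha k) phi (cantor_point k i * xi) -
    cantor_avg alpha pos Psi k xi| <= 3 * L * (xi / 2 ^+ k).
Proof.
move=> prof x1; rewrite /cantor_avg -mulrBr -sumrB normrM normfV normr_nat.
have N0 : 0 < (cells alpha k)%:R :> R by rewrite ltr0n cells_gt0.
rewrite ler_pdivrMl//; apply: (le_trans (ler_norm_sum _ _ _)).
apply: (@le_trans _ _ (\sum_(i < cells alpha k) 3 * L * (xi / 2 ^+ k))); last first.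
  by rewrite sumr_const card_ord -[leLHS](mulr_natl _ (cells alpha k)).
apply: ler_sum => i _; rewrite distrC; apply: (cell_avg_close prof x1).
have := cantor_map_bounds alpha01 posP k (i%:R / (cells alpha k)%:R).
by rewrite /cell_index mulrC divfK ?gt_eqF// natrK.
Qed.

(** The averages over level k converge to the integral, because [phi (r * xi)] differs from its cell
    average by O(xi 2^-k); a bound uniform in k therefore passes to the limit. *)
Lemma cantor_integral_le B L sigma phi Psi xi K : profile B L sigma phi Psi -> 1 <= xi ->
  bounded_measurable (fun u => phi (theta u * xi)) ->
  (forall k, `|cantor_avg alpha pos Psi k xi| <= K) ->
  `|\int[unit_lebesgue]_(u in unit_itv) phi (theta u * xi)| <= K.
Proof.
move=> prof x1 bm avgK; apply/ler_addgt0Pr => e e0.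
have L0 : 0 <= L.
  by have [/(_ 0 1) + _ _] := prof; rewrite expr1n mulr1; exact: le_trans.
have [k] := powR2_unbounded (3 * L * xi / e) ltr01.
rewrite mul1r powR_mulrn// ltr_pdivrMr// => Hk.
have eta : 3 * L * (xi / 2 ^+ k) <= e by rewrite mulrA ler_pdivrMr// [leRHS]mulrC ltW.
have := @unit_mesh R (cells alpha k) (fun u => phi (theta u * xi))
  (fun i => cell_avg Psi k (pos k i) xi) _ (cells_gt0 alpha k) bm.
move=> /(_ (3 * L * (xi / 2 ^+ k))) H.
have {}H : `|\int[unit_lebesgue]_(u in unit_itv) phi (theta u * xi) - cantor_avg alpha pos Psi k xi| <= e.
  apply: le_trans eta; apply: H => i u iN u01 ui; rewrite distrC.
  apply: (cell_avg_close prof x1); rewrite -ui; exact: cantor_map_bounds.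
have := ler_normD (\int[unit_lebesgue]_(u in unit_itv) phi (theta u * xi) - cantor_avg alpha pos Psi k xi) (cantor_avg alpha pos Psi k xi).
rewrite subrK; have := avgK k; lra.
Qed.

Lemma supp_closed (mu : {finite_measure set (measurableTypeR R) -> \bar R}) : closed (supp mu).
Proof.
rewrite -openC openE => x /existsNP[U /not_implyP[oU /not_implyP[Ux muU]]].
rewrite /interior nbhsE; exists U; first by split.
by move=> y Uy /(_ U oU Uy).
Qed.

Hypothesis decay : forall kappa, 0 <= kappa < alpha ->
  exists C, forall k xi, 1 <= xi ->
    `|cantor_avg alpha pos sin k xi| <= C * xi `^ (- (0 + kappa / 2)) /\
    `|cantor_avg alpha pos (fun x => - cos x) k xi| <= C * xi `^ (- (0 + kappa / 2)).

Lemma fourier_exponent_cantor kappa : 0 < kappa < alpha ->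
  fourier_exponents (cantor_set alpha pos) kappa.
Proof.
move=> /andP[k0 ka]; have /andP[a0 a1] := alpha01.
split => //; first exact: lt_le_trans a1.
have mth : measurable_fun [set: measurableTypeR R] theta.
  apply: nondecreasing_measurable => // u v; exact: cantor_map_nondecreasing.
have clS : closed (cantor_set alpha pos : set R).
  exact: compact_closed (cantor_set_compact alpha01 posP).
have suppS : supp (law_measure mth) `<=` cantor_set alpha pos.
  by apply: law_supp => // u u01; exact: cantor_map_in.
exists (law_measure mth).
  split => //; first by rewrite law_setT.
  exact: subclosed_compact (@supp_closed _) (cantor_set_compact alpha01 posP) suppS.
have [|C HC] := decay (kappa := kappa); first by rewrite ltW.
(* The 2 covers |2 pi xi| < 1, where the cosine and sine parts are at most 1; 2 C^2 covers the other
   frequencies, through the decay of the same two parts. *)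
apply: (@le_lt_trans _ _ (2 + 2 * C ^+ 2)%:E); last exact: ltry.
apply: ge_ereal_sup => _ [xi _ <-]; rewrite lee_fin normc_fourier.
have posE : pos_functional setT (fun f => \int[law_measure mth]_x f x).
  exact: integral_pos_functional.
set c := 2 * pi * xi.
have -> : power_at (fun f => \int[law_measure mth]_x f x) c =
          power_at (fun f => \int[law_measure mth]_x f x) `|c|.
  by have [_|_] := ger0P c => //; rewrite (power_atN posE).
have xic : `|xi| <= `|c|.
  rewrite /c normrM ler_peMl// gtr0_norm ?mulr_gt0 ?pi_gt0//.
  by have := @pi_ge2 R; lra.
have E1 : \int[law_measure mth]_x 1 = 1 :> R.
  by rewrite Rintegral_cst// mul1r; exact: (congr1 fine (law_setT mth)).
have [c1|c1] := leP 1 `|c|; last first.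
  have bd f : bounded_measurable f -> (forall x, `|f x| <= 1) -> (\int[law_measure mth]_x f x) ^+ 2 <= 1.
    move=> bf f1; have := pos_functional_norm_le posE bf (fun x _ => f1 x).
    by rewrite E1 mulr1 -real_normK ?num_real// => h; rewrite expr_le1.
  have p2 : power_at (fun f => \int[law_measure mth]_x f x) `|c| <= 2.
    rewrite /power_at.
    have : (\int[law_measure mth]_x sin (`|c| * x)) ^+ 2 <= 1.
      apply: (bd _ (bounded_measurable_sin `|c|)) => x.
      by rewrite ler_norml sin_geN1 sin_le1.
    have : (\int[law_measure mth]_x cos (`|c| * x)) ^+ 2 <= 1.
      apply: (bd _ (bounded_measurable_cos `|c|)) => x.
      by rewrite ler_norml cos_geN1 cos_le1.
    lra.
  have xk : `|xi| `^ kappa <= 1.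
    have : `|xi| `^ kappa <= 1 `^ kappa.
      by rewrite ge0_ler_powR ?nnegrE ?(ltW k0)// (le_trans xic)// ltW.
    by rewrite powR1.
  apply: (@le_trans _ _ (2 * 1)).
    by apply: ler_pM => //; exact: power_at_ge0.
  by rewrite mulr1 lerDl mulr_ge0// sqr_ge0.
have c0 : 0 < `|c| by exact: lt_le_trans c1.
have bmc f : (forall d, bounded_measurable (fun x => f (d * x))) ->
    bounded_measurable (fun u => f (theta u * `|c|)).
  move=> bf; have := bounded_measurable_comp (bf `|c|) mth.
  by congr bounded_measurable; apply/funext => u; rewrite mulrC.
have cosb : `|\int[law_measure mth]_x cos (`|c| * x)| <= C * `|c| `^ (- (0 + kappa / 2)).
  rewrite integral_law; last exact: bounded_measurable_cos.
  under eq_Rintegral do rewrite mulrC.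
  apply: (cantor_integral_le cos_profile c1); first exact: (bmc cos bounded_measurable_cos).
  by move=> k; have [] := HC k _ c1.
have sinb : `|\int[law_measure mth]_x sin (`|c| * x)| <= C * `|c| `^ (- (0 + kappa / 2)).
  rewrite integral_law; last exact: bounded_measurable_sin.
  under eq_Rintegral do rewrite mulrC.
  apply: (cantor_integral_le sin_profile c1); first exact: (bmc sin bounded_measurable_sin).
  by move=> k; have [] := HC k _ c1.
apply: (@le_trans _ _ (2 * (C * `|c| `^ (- (0 + kappa / 2))) ^+ 2 * `|c| `^ kappa)).
  apply: ler_pM; [exact: power_at_ge0|exact: powR_ge0| |].
    rewrite /power_at [2]mulr2n mulrDl mul1r.
    by apply: lerD; rewrite -[leLHS]real_normK ?num_real// lerXn2r ?nnegrE// (le_trans _ cosb).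
  by rewrite ge0_ler_powR ?nnegrE ?(ltW k0).
rewrite exprMn -(powR_mulrn 2 (powR_ge0 `|c| _)) -powRrM.
rewrite -mulrA -mulrA -powRD; last by rewrite (gt_eqF c0) implybT.
rewrite (_ : - (0 + kappa / 2) * 2%:R + kappa = 0); last by lra.
by rewrite powRr0 mulr1 lerDr.
Qed.

Lemma dim_F_cantor_set : dim_F (cantor_set alpha pos : set R) = alpha.
Proof.
have /andP[a0 a1] := alpha01.
have ub : ubound (fourier_exponents (cantor_set alpha pos)) alpha.
  move=> s sS; have [s0 s1 _] := sS.
  have [E HE] := fourier_exponent_functional (cantor_set_compact alpha01 posP) sS.
  by apply: (decaying_functional_exponent_le alpha01 posP _ HE); rewrite s0.
have -> : dim_F (cantor_set alpha pos) = sup (fourier_exponents (cantor_set alpha pos)) by [].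
(* For alpha = 0 no exponent is admissible, and the supremum of the empty set is 0. *)
move: a0; rewrite le_eqVlt => /predU1P[a0|a0].
  rewrite (_ : fourier_exponents _ = set0) ?sup0//.
  apply/seteqP; split => // s sS; have [s0 _ _] := sS.
  by have := ub s sS; rewrite -a0 leNgt s0.
apply/eqP; rewrite eq_le; apply/andP; split.
  apply: ge_sup => //; exists (alpha / 2); apply: fourier_exponent_cantor; lra.
apply/ler_addgt0Pr => e e0; rewrite -lerBlDr.
have [h|h] := leP (alpha - e) 0.
  apply: (le_trans h); apply: le_trans (_ : alpha / 2 <= _); first lra.
  apply: ub_le_sup; first by exists alpha.
  by apply: fourier_exponent_cantor; lra.
apply: ub_le_sup; first by exists alpha.
by apply: fourier_exponent_cantor; lra.
Qed.

End cantor_fourier.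

(** * Weighted Fourier profiles *)

Section weighted_profile.
Context {R : realType}.

(* The weight w(y) = sin(c y)^2 vanishes at 0 and both w and w(y) / y, the
   average of sin(2 u y) over u in [0, c] up to a factor c, are superpositions
   of characters of bounded frequency, so that they preserve Fourier decay. *)
Definition weight (c y : R) : R := sin (c * y) ^+ 2.

Definition weight_quotient (c y : R) : R := weight c y / y.

Lemma weightE c y : weight c y = (1 - cos (2 * c * y)) / 2.
Proof.
rewrite /weight sin2cos2 -mulrA (_ : 2 * (c * y) = c * y + c * y); last lra.
by rewrite cosD -!expr2 sin2cos2; lra.
Qed.

Lemma weight_quotientM c y : weight_quotient c y * y = weight c y.
Proof.
(* At y = 0 the quotient has the default value 0, consistent with the vanishing of the weight
   there. *)
have [->|y0] := eqVneq y 0; first by rewrite mulr0 /weight mulr0 sin0 expr0n.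
by rewrite /weight_quotient divfK.
Qed.

Lemma weight_quotient_le c y : 0 <= c -> `|weight_quotient c y| <= c.
Proof.
move=> c0; have [->|y0] := eqVneq y 0; first by rewrite /weight_quotient invr0 mulr0 normr0.
rewrite /weight_quotient /weight normrM normfV ler_pdivrMr ?normr_gt0// expr2 normrM.
have h1 : `|sin (c * y)| <= 1 by rewrite ler_norml sin_geN1 sin_le1.
have h2 : `|sin (c * y)| <= c * `|y|.
  by have := sin_lip (c * y) 0; rewrite sin0 !subr0 normrM (ger0_norm c0).
by have := ler_pM (normr_ge0 _) (normr_ge0 _) h1 h2; rewrite mul1r.
Qed.

(** A Riemann sum for the integral of sin(2 u y) over u in [0, c], whose value is
    [weight_quotient c y]. A positive functional only commutes with finite sums, so the
    superposition of characters is used through finite sums with an error uniform on bounded sets of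
    y. *)
Definition quotient_approx (c : R) n y : R :=
  c / n%:R * \sum_(j < n) sin (2 * (j%:R * (c / n%:R)) * y).

Lemma quotient_approx_le c n y : (0 < n)%N ->
  `|weight_quotient c y - quotient_approx c n y| <= 2 * c ^+ 2 * `|y| / n%:R.
Proof.
move=> n0; have [->|y0] := eqVneq y 0.
  rewrite /weight_quotient invr0 mulr0 /quotient_approx big1 ?mulr0 ?subr0 ?normr0 ?mulr0 ?mul0r//.
  by move=> j _; rewrite mulr0 sin0.
have nR : 0 < n%:R :> R by rewrite ltr0n.
set d := c / n%:R.
(* Induction on the upper end m d of the integral, one mesh interval at a time; each of them costs 2
   d^2 |y|. *)
suff H m : `|weight_quotient (m%:R * d) y - d * \sum_(j < m) sin (2 * (j%:R * d) * y)| <=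
    m%:R * (2 * d ^+ 2 * `|y|).
  have := H n; rewrite [n%:R * d]mulrC /d divfK ?gt_eqF// => /le_trans; apply.
  by rewrite le_eqVlt; apply/orP; left; apply/eqP; field; rewrite gt_eqF.
elim: m => [|m IH].
  by rewrite !mul0r big_ord0 mulr0 subr0 /weight_quotient /weight mul0r sin0 expr0n mul0r normr0.
rewrite big_ord_recr/= mulrDr.
have step : `|weight_quotient (m.+1%:R * d) y - weight_quotient (m%:R * d) y -
    d * sin (2 * (m%:R * d) * y)| <= 2 * d ^+ 2 * `|y|.
  have := cos_quad (2 * (m%:R * d) * y) (2 * d * y).
  rewrite (_ : 2 * (m%:R * d) * y + 2 * d * y = 2 * (m.+1%:R * d) * y); last first.
    by rewrite -[m.+1%:R]natr1; ring.
  rewrite /weight_quotient !weightE => H.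
  have yn : 0 < 2 * `|y| by rewrite mulr_gt0 ?normr_gt0.
  rewrite -(ler_pM2l yn).
  have -> : 2 * `|y| * (2 * d ^+ 2 * `|y|) = 1 * (2 * d * y) ^+ 2.
    by rewrite !exprMn -[y ^+ 2]real_normK ?num_real//; ring.
  apply: le_trans H; rewrite -[2 in X in X * _ <= _](gtr0_norm (_ : 0 < 2))// -!normrM.
  by rewrite le_eqVlt; apply/orP; left; apply/eqP; congr `|_|; field.
rewrite (_ : weight_quotient (m.+1%:R * d) y - _ =
   (weight_quotient (m.+1%:R * d) y - weight_quotient (m%:R * d) y - d * sin (2 * (m%:R * d) * y)) +
   (weight_quotient (m%:R * d) y - d * \sum_(j < m) sin (2 * (j%:R * d) * y))); last ring.
apply: (le_trans (ler_normD _ _)); rewrite -[m.+1%:R in leRHS]natr1; lra.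
Qed.

Lemma bounded_measurable_weight c : bounded_measurable (weight c).
Proof.
have -> : weight c = (fun y => sin (c * y) * sin (c * y)) by apply/funext => y; rewrite -expr2.
by apply: bounded_measurableM; exact: bounded_measurable_sin.
Qed.

Lemma bounded_measurable_weight_quotient c : 0 <= c -> bounded_measurable (weight_quotient c).
Proof.
move=> c0; split; last by exists c => y; exact: weight_quotient_le.
apply: (measurable_fun_cvg (h := fun n y => quotient_approx c n.+1 y)).
  move=> n; rewrite /quotient_approx.
  have [] // : bounded_measurable (fun y => c / n.+1%:R * \sum_(j < n.+1) sin (2 * (j%:R * (c / n.+1%:R)) * y)).
  by apply/bounded_measurableZ/bounded_measurable_sum => j; exact: bounded_measurable_sin.
move=> y _; apply/cvgrPdist_le => e e0.
near=> n; apply: (le_trans (quotient_approx_le c y (ltn0Sn n))).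
rewrite ler_pdivrMr ?ltr0n// -ler_pdivrMl//.
near: n; exists (Num.truncn (e^-1 * (2 * c ^+ 2 * `|y|))) => // n /= hn.
apply: ltW; apply: lt_le_trans (truncnS_gt _) _.
by rewrite ler_nat ltnS.
Unshelve. all: by end_near. Qed.

Lemma bounded_measurable_cos_phase (x p : R) : bounded_measurable (fun y => cos (x * y - p)).
Proof.
under eq_fun do rewrite cosB mulrC [X in _ + X]mulrC.
apply: bounded_measurableD; apply: bounded_measurableZ.
  exact: bounded_measurable_cos.
exact: bounded_measurable_sin.
Qed.

Lemma bounded_measurable_sin_phase (x p : R) : bounded_measurable (fun y => sin (x * y - p)).
Proof.
have -> : (fun y => sin (x * y - p)) = (fun y => cos (x * y - (p + pi / 2))).
  by apply/funext => y; rewrite -cosBpihalf opprD addrA.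
exact: bounded_measurable_cos_phase.
Qed.

Variables (S : set R) (E : (R -> R) -> R) (ylim sigma C c : R).
Hypothesis posE : pos_functional S E.
Hypothesis S_le : forall y, S y -> `|y| <= ylim.
Hypothesis sigma01 : 0 <= sigma <= 1.
Hypothesis C_ge0 : 0 <= C.
Hypothesis c_itv : 0 <= c <= 1 / 4.
Hypothesis decayE : forall x p, x != 0 -> `|E (fun y => cos (x * y - p))| <= C * `|x| `^ (- sigma).

(** Here the condition c <= 1/4 pays off: the weights shift frequencies by at most 2 c <= 1/2, so
    for x >= 1 the shifted frequency stays above x / 2, at the cost of a factor 2^sigma <= 2. *)
Let decay_shift x u p : 1 <= x -> `|u| <= 1 / 2 ->
  `|E (fun y => cos ((x + u) * y - p))| <= 2 * C * x `^ (- sigma).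
Proof.
move=> x1; rewrite ler_norml => /andP[u1 u2].
have x0 : 0 < x by lra.
have x20 : 0 < x / 2 by lra.
have xu0 : 0 < x + u by lra.
have /andP[s0 s1] := sigma01.
apply: (le_trans (decayE _ (lt0r_neq0 xu0))).
rewrite (gtr0_norm xu0) [2 * C]mulrC -mulrA ler_wpM2l//.
apply: (@le_trans _ _ ((x / 2) `^ (- sigma))).
  rewrite !powRN lef_pV2 ?posrE ?powR_gt0//.
  by apply: ge0_ler_powR; rewrite ?nnegrE ?(ltW x20) ?(ltW xu0)//; lra.
have V0 : 0 <= 2^-1 :> R by [].
rewrite (powRM _ (ltW x0) V0) mulrC ler_wpM2r ?powR_ge0//.
have -> : 2^-1 `^ (- sigma) = 2 `^ sigma :> R by rewrite -powR_inv1// -powRrM mulN1r opprK.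
by rewrite -[leRHS]powRr1// ler_powR ?ler1n.
Qed.

Let mcos x p := bounded_measurable_cos_phase x p.
Let msin x p := bounded_measurable_sin_phase x p.

Let c_ge0 : 0 <= c. Proof. by case/andP: c_itv. Qed.

Let mq : bounded_measurable (weight_quotient c).
Proof. exact: bounded_measurable_weight_quotient. Qed.

Let mw : bounded_measurable (weight c). Proof. exact: bounded_measurable_weight. Qed.

Let EB f g : bounded_measurable f -> bounded_measurable g ->
  E (fun y => f y - g y) = E f - E g.
Proof.
move=> bf bg; have [ED EZ _] := posE.
rewrite (_ : (fun y => f y - g y) = (fun y => f y + -1 * g y)).
  by rewrite ED ?EZ ?mulN1r//; exact: bounded_measurableZ.
by apply/funext => y; rewrite mulN1r.
Qed.

Let E1_ge0 : 0 <= E (fun=> 1).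
Proof.
have [_ _ Emono] := posE.
rewrite -[X in X <= _](_ : E (fun=> 0) = 0); last by rewrite (pos_functional_cst posE) mul0r.
by apply: Emono => //; exact: bounded_measurable_cst.
Qed.

(** The weight splits the frequency x into x, x + 2 c and x - 2 c with coefficients of total size 1,
    so the bound of [decay_shift] carries over unchanged. *)
Let cos_weight_decay x p : 1 <= x ->
  `|E (fun y => weight c y * cos (x * y - p))| <= 2 * C * x `^ (- sigma).
Proof.
move=> x1; have [ED EZ _] := posE; have /andP[c0 c1] := c_itv.
have -> : (fun y => weight c y * cos (x * y - p)) = (fun y => 1 / 2 * cos ((x + 0) * y - p) -
    1 / 4 * (cos ((x + 2 * c) * y - p) + cos ((x + - (2 * c)) * y - p))).
  apply/funext => y; rewrite weightE addr0.
  rewrite (_ : (x + 2 * c) * y - p = (x * y - p) + 2 * c * y); last ring.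
  rewrite (_ : (x + - (2 * c)) * y - p = (x * y - p) - 2 * c * y); last ring.
  by move: (x * y - p) => th; rewrite cosB cosD; field.
rewrite EB; [|exact: bounded_measurableZ|by apply: bounded_measurableZ; exact: bounded_measurableD].
rewrite !EZ ?ED//; last exact: bounded_measurableD.
have n0 : `|0 : R| <= 1 / 2 by rewrite normr0.
have n1 : `|2 * c| <= 1 / 2 by rewrite ger0_norm; lra.
have n2 : `|- (2 * c)| <= 1 / 2 by rewrite normrN.
have := decay_shift p x1 n0; have := decay_shift p x1 n1; have := decay_shift p x1 n2.
rewrite !ler_norml; lra.
Qed.

Let sin_quotient_decay x p : 1 <= x ->
  `|E (fun y => weight_quotient c y * sin (x * y - p))| <= 2 * C * x `^ (- sigma).
Proof.
move=> x1; have [ED EZ _] := posE; have /andP[c0 c1] := c_itv.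
set t := x `^ (- sigma).
have t0 : 0 <= t by exact: powR_ge0.
apply/ler_addgt0Pr => e e0.
pose n := (Num.truncn (2 * c ^+ 2 * `|ylim| * E (fun=> 1) / e)).+1.
have nR : 0 < n%:R :> R by rewrite ltr0n.
pose u (j : nat) : R := 2 * (j%:R * (c / n%:R)).
have uc (j : 'I_n) : `|u j| <= 1 / 2.
  rewrite ger0_norm; last by rewrite !mulr_ge0// invr_ge0.
  have : j%:R * (c / n%:R) <= c.
    rewrite mulrCA ler_piMr// ler_pdivrMr// mul1r ler_nat; exact: ltnW.
  rewrite /u; lra.
pose g y := quotient_approx c n y * sin (x * y - p).
have gE : g = (fun y => c / n%:R * \sum_(j < n) (1 / 2 * (cos ((x + - u j) * y - p) - cos ((x + u j) * y - p)))).
  apply/funext => y; rewrite /g /quotient_approx -mulrA mulr_suml; congr (_ * _).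
  apply: eq_bigr => j _; rewrite -/(u j).
  rewrite (_ : (x + u j) * y - p = (x * y - p) + u j * y); last ring.
  rewrite (_ : (x + - u j) * y - p = (x * y - p) - u j * y); last ring.
  by move: (x * y - p) => th; rewrite cosB cosD; field.
have mterm j : bounded_measurable (fun y => cos ((x + - u j) * y - p) - cos ((x + u j) * y - p)).
  exact: bounded_measurableB.
have mg : bounded_measurable g.
  by rewrite gE; apply/bounded_measurableZ/bounded_measurable_sum => j; exact: bounded_measurableZ.
have Eg : `|E g| <= 2 * C * t.
  rewrite gE EZ; last by apply: bounded_measurable_sum => j; exact: bounded_measurableZ.
  rewrite (pos_functional_sum posE); last by move=> j; exact: bounded_measurableZ.
  rewrite normrM ger0_norm ?divr_ge0//.
  apply: (@le_trans _ _ (c / n%:R * (n%:R * (2 * C * t)))); last first.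
    by rewrite mulrA divfK ?gt_eqF// ler_piMl ?mulr_ge0//; lra.
  rewrite ler_wpM2l ?divr_ge0//; apply: (le_trans (ler_norm_sum _ _ _)).
  apply: (@le_trans _ _ (\sum_(j < n) 2 * C * t)); last first.
    by rewrite sumr_const card_ord -[leLHS](mulr_natl _ n).
  apply: ler_sum => j _; rewrite EZ// EB//.
  have uN : `|- u j| <= 1 / 2 by rewrite normrN.
  have := decay_shift p x1 (uc j); have := decay_shift p x1 uN.
  rewrite -/t !ler_norml; lra.
have diff : `|E (fun y => weight_quotient c y * sin (x * y - p)) - E g| <= e.
  rewrite -EB//; last exact: bounded_measurableM.
  apply: (@le_trans _ _ (2 * c ^+ 2 * `|ylim| / n%:R * E (fun=> 1))); last first.
    rewrite mulrAC ler_pdivrMr// [leRHS]mulrC -ler_pdivrMr// ltW//.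
    exact: truncnS_gt.
  apply: (pos_functional_norm_le posE).
    by apply: bounded_measurableB => //; exact: bounded_measurableM.
  move=> y Sy; rewrite /g -mulrBl normrM.
  apply: (@le_trans _ _ `|weight_quotient c y - quotient_approx c n y|).
    by rewrite ler_piMr// ler_norml sin_geN1 sin_le1.
  apply: (le_trans (quotient_approx_le c y (ltn0Sn _))).
  rewrite ler_wpM2r ?invr_ge0// ler_wpM2l ?mulr_ge0 ?sqr_ge0//.
  exact: le_trans (S_le Sy) (ler_norm _).
have := ler_normD (E (fun y => weight_quotient c y * sin (x * y - p)) - E g) (E g).
rewrite subrK; lra.
Qed.

(** Differentiating [weight_quotient c y * sin (x * y - p)] in x gives
    [weight c y * cos (x * y - p)]. The quadratic estimate for sine is applied under [E], with the
    quotient at most c and |y| at most [ylim]. The phases p = 0 and p = pi / 2 yield the two real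
    components of the transform. *)
Lemma weighted_profile p :
  profile (2 * C) (c * ylim ^+ 2 * E (fun=> 1)) sigma
    (fun x => E (fun y => weight c y * cos (x * y - p)))
    (fun x => E (fun y => weight_quotient c y * sin (x * y - p))).
Proof.
have [ED EZ _] := posE; have /andP[c0 c1] := c_itv.
split; [|by move=> x; exact: cos_weight_decay|by move=> x; exact: sin_quotient_decay].
have mA x : bounded_measurable (fun y => weight c y * cos (x * y - p)).
  exact: bounded_measurableM mw (mcos x p).
have mB x : bounded_measurable (fun y => weight_quotient c y * sin (x * y - p)).
  exact: bounded_measurableM mq (msin x p).
move=> x h; rewrite -EZ// -(EB (mB (x + h)) (mB x)).
have mBB := bounded_measurableB (mB (x + h)) (mB x).
rewrite -(EB mBB (bounded_measurableZ h (mA x))).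
rewrite [leRHS]mulrAC; apply: (pos_functional_norm_le posE).
  exact: bounded_measurableB mBB (bounded_measurableZ h (mA x)).
move=> y Sy.
rewrite (_ : _ - _ = weight_quotient c y *
   (sin ((x * y - p) + h * y) - sin (x * y - p) - h * y * cos (x * y - p))); last first.
  rewrite -weight_quotientM (_ : (x + h) * y - p = (x * y - p) + h * y); ring.
rewrite normrM -(mulrA c); apply: ler_pM => //; first exact: weight_quotient_le.
apply: (le_trans (sin_quad _ _)); rewrite mul1r exprMn mulrC ler_wpM2r ?sqr_ge0//.
rewrite -real_normK ?num_real// lerXn2r ?nnegrE//; last exact: S_le.
exact: le_trans (S_le Sy).
Qed.

End weighted_profile.

Section weighted_functional.
Context {R : realType}.

Lemma phase_decay (S : set R) E s (posE : pos_functional S E) K :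
  (forall xi, power_at E xi * `|xi| `^ s <= K) ->
  forall x p, x != 0 ->
    `|E (fun y => cos (x * y - p))| <= 2 * Num.sqrt K * `|x| `^ (- (s / 2)).
Proof.
move=> EK x p x0; have [ED EZ _] := posE.
have nx0 : 0 < `|x| by rewrite normr_gt0.
set t := `|x| `^ (- (s / 2)).
have t0 : 0 < t by exact: powR_gt0.
have tt : t ^+ 2 = (`|x| `^ s)^-1.
  rewrite /t -powR_mulrn ?powR_ge0// -powRrM -powRN; congr powR; lra.
have P : power_at E x <= K * t ^+ 2.
  by rewrite tt ler_pdivlMr ?powR_gt0.
have K0 : 0 <= K.
  by apply: le_trans (EK x); rewrite mulr_ge0 ?power_at_ge0 ?powR_ge0.
have sqb v : v ^+ 2 <= power_at E x -> `|v| <= Num.sqrt K * t.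
  move=> h; rewrite -(@ler_pXn2r _ 2) ?nnegrE ?mulr_ge0 ?sqrtr_ge0 ?(ltW t0)//.
  by rewrite real_normK ?num_real// exprMn sqr_sqrtr// (le_trans h).
have c1 : `|E (fun y => cos (x * y))| <= Num.sqrt K * t.
  by apply: sqb; rewrite lerDl sqr_ge0.
have c2 : `|E (fun y => sin (x * y))| <= Num.sqrt K * t.
  by apply: sqb; rewrite lerDr sqr_ge0.
have -> : (fun y => cos (x * y - p)) = (fun y => cos p * cos (x * y) + sin p * sin (x * y)).
  by apply/funext => y; rewrite cosB; ring.
have mc := @bounded_measurable_cos R x; have ms := @bounded_measurable_sin R x.
rewrite ED; [|exact: bounded_measurableZ|exact: bounded_measurableZ].
rewrite !EZ//; apply: (le_trans (ler_normD _ _)); rewrite !normrM.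
have h1 : `|cos p| <= 1 by rewrite ler_norml cos_geN1 cos_le1.
have h2 : `|sin p| <= 1 by rewrite ler_norml sin_geN1 sin_le1.
have := ler_pM (normr_ge0 _) (normr_ge0 _) h1 c1.
have := ler_pM (normr_ge0 _) (normr_ge0 _) h2 c2.
by rewrite !mul1r; lra.
Qed.

Lemma weight_ge0 c (y : R) : 0 <= weight c y. Proof. exact: sqr_ge0. Qed.

(* If the weight integrates to 0 then so does sin(2^j y / 4)^2 for every j, since
   sin(2 x)^2 <= 4 sin(x)^2; hence E(cos(2^j y / 2)) = E(1) for every j,
   contradicting the decay. *)
Lemma weight_gt0_of_decay (S : set R) E s C : pos_functional S E -> 0 < E (fun=> 1) -> 0 < s ->
  (forall x p, x != 0 -> `|E (fun y => cos (x * y - p))| <= C * `|x| `^ (- (s / 2))) ->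
  0 < E (weight (1 / 4)).
Proof.
move=> posE E1 s0 decay; have [ED EZ Emono] := posE.
have mw c : bounded_measurable (weight c) := bounded_measurable_weight c.
have Ew0 c : 0 <= E (weight c).
  rewrite -[leLHS](_ : E (fun=> 0) = 0); last by rewrite (pos_functional_cst posE) mul0r.
  by apply: Emono => //; [exact: bounded_measurable_cst|move=> y _; exact: weight_ge0].
rewrite lt_neqAle Ew0 andbT; apply/eqP => /esym W0.
have WJ j : E (weight (2 ^+ j * (1 / 4))) = 0.
  elim: j => [|j IH]; first by rewrite expr0 mul1r.
  apply/eqP; rewrite eq_le Ew0 andbT.
  apply: (@le_trans _ _ (E (fun y => 4 * weight (2 ^+ j * (1 / 4)) y))); last first.
    by rewrite EZ// IH mulr0.
  apply: Emono => //; first exact: bounded_measurableZ.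
  move=> y _; rewrite /weight (exprS 2 j).
  rewrite (_ : 2 * 2 ^+ j * (1 / 4) * y = 2 ^+ j * (1 / 4) * y + 2 ^+ j * (1 / 4) * y); last ring.
  move: (2 ^+ j * (1 / 4) * y) => z; rewrite sinD.
  rewrite (_ : sin z * cos z + cos z * sin z = 2 * (sin z * cos z)); last ring.
  rewrite !exprMn (_ : 2 ^+ 2 = 4); last ring.
  by rewrite ler_wpM2l// ler_piMr ?sqr_ge0.
have cosE j : E (fun y => cos (2 ^+ j * (1 / 2) * y - 0)) = E (fun=> 1).
  have -> : (fun y : R => cos (2 ^+ j * (1 / 2) * y - 0)) =
      (fun y : R => 1 + (-2) * weight (2 ^+ j * (1 / 4)) y).
    apply/funext => y; rewrite weightE subr0.
    rewrite (_ : 2 * (2 ^+ j * (1 / 4)) * y = 2 ^+ j * (1 / 2) * y); last by field.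
    by field.
  rewrite ED; [|exact: bounded_measurable_cst|exact: bounded_measurableZ].
  by rewrite EZ// WJ mulr0 addr0.
have s20 : 0 < s / 2 by rewrite divr_gt0.
have [j] := powR2_unbounded (C * 2^-1 `^ (- (s / 2)) / E (fun=> 1)) s20.
rewrite ltr_pdivrMr// ltNge => /negP; apply.
have x0 : 0 < 2 ^+ j * (1 / 2) :> R by rewrite mulr_gt0.
have := decay _ 0 (lt0r_neq0 x0); rewrite cosE (gtr0_norm E1) (gtr0_norm x0) mul1r.
have V0 : 0 <= 2^-1 :> R by [].
rewrite (powRM _ (ltW (exp2_gt0 j)) V0) => h.
have -> : 2 `^ (s / 2 * j%:R) = (2 ^+ j) `^ (s / 2) :> R.
  by rewrite mulrC powRrM powR_mulrn.
have p0 : 0 < (2 ^+ j) `^ (s / 2) :> R by exact: powR_gt0.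
rewrite -ler_pdivlMl//; apply: (le_trans h).
by rewrite powRN le_eqVlt; apply/orP; left; apply/eqP; ring.
Qed.

Lemma exists_weighted_functional (Y : set R) y0 s : compact Y -> Y y0 -> y0 != 0 ->
  s = 0 \/ fourier_exponents Y s ->
  exists E c C, [/\ pos_functional Y E, 0 <= c <= 1 / 4, 0 <= C,
    forall x p, x != 0 -> `|E (fun y => cos (x * y - p))| <= C * `|x| `^ (- (s / 2))
    & 0 < E (weight c)].
Proof.
move=> cY Yy0 y00 [->|sY].
  have d0 : 0 < 4 * (1 + `|y0|) by rewrite mulr_gt0// addr_gt0// normr_gt0.
  have ny : 0 < `|y0| by rewrite normr_gt0.
  (* This is where a non-zero point of [Y] enters: c is at most 1/4 and 0 < c |y0| <= 1/2, so the
     weight does not vanish at y0. *)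
  exists (fun f => f y0), (4 * (1 + `|y0|))^-1, 1; split => //.
  - by split => // f g _ _; exact.
  - rewrite invr_ge0 (ltW d0)/= -[1 / 4]invrK lef_pV2 ?posrE ?invr_gt0//; lra.
  - by move=> x p _; rewrite mul0r oppr0 powRr0 mulr1 ler_norml cos_geN1 cos_le1.
  rewrite /weight -real_normK ?num_real// exprn_gt0//.
  set c := (4 * (1 + `|y0|))^-1.
  have -> : `|sin (c * y0)| = `|sin (c * `|y0|)|.
    by have [_|_] := ger0P y0 => //; rewrite mulrN sinN normrN.
  have cy0 : 0 < c * `|y0| by rewrite mulr_gt0// invr_gt0.
  have cy1 : c * `|y0| <= 1 / 2 by rewrite /c mulrC ler_pdivrMr//; lra.
  rewrite normr_gt0 gt_eqF//; apply: lt_le_trans (sin_ge_half _); first by rewrite divr_gt0.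
  by rewrite (ltW cy0).
have [s0 _ _] := sY.
have [E [posE E1 [K EK]]] := fourier_exponent_functional cY sY.
have decay := phase_decay posE EK.
exists E, (1 / 4), (2 * Num.sqrt K); split => //.
- by rewrite lexx andbT.
- exact: weight_gt0_of_decay posE E1 s0 decay.
Qed.

End weighted_functional.

(** * The sumset *)

Section product_functional.
Context {R : realType}.
Variables (Y : set R) (E : (R -> R) -> R) (c : R).
Hypothesis posE : pos_functional Y E.

Definition cos_transform (p x : R) := E (fun y => weight c y * cos (x * y - p)).

(* The law of r y + z, with y weighted by weight c; y and the finite families r
   and z are independent, so that the power spectrum factorizes. *)
Definition product_functional (N n : nat) (r z : nat -> R) (f : R -> R) : R :=
  N%:R^-1 * \sum_(i < N) (n%:R^-1 * \sum_(j < n) E (fun y => f (r i * y + z j) * weight c y)).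

Let mw : bounded_measurable (weight c). Proof. exact: bounded_measurable_weight. Qed.

Let maff (f : R -> R) (r z : R) : bounded_measurable f ->
  bounded_measurable (fun y => f (r * y + z) * weight c y).
Proof.
move=> bf; apply: bounded_measurableM => //; apply: bounded_measurable_comp => //.
by apply: measurable_funD => //; exact: measurable_funM.
Qed.

Lemma product_pos_functional N n r z (X : set R) :
  (forall i j y, (i < N)%N -> (j < n)%N -> Y y -> X (r i * y + z j)) ->
  pos_functional X (product_functional N n r z).
Proof.
move=> rzX; have [ED EZ Emono] := posE; split.
- move=> f g bf bg; rewrite /product_functional -mulrDr -big_split/=; congr (_ * _).
  apply: eq_bigr => i _; rewrite -mulrDr -big_split/=; congr (_ * _).
  apply: eq_bigr => j _; rewrite -ED; [|exact: maff|exact: maff].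
  by congr E; apply/funext => y; rewrite mulrDl.
- move=> d f bf; rewrite /product_functional mulrCA; congr (_ * _).
  rewrite mulr_sumr; apply: eq_bigr => i _; rewrite mulrCA; congr (_ * _).
  rewrite mulr_sumr; apply: eq_bigr => j _; rewrite -EZ; last exact: maff.
  by congr E; apply/funext => y; rewrite mulrA.
- move=> f g bf bg fg; rewrite /product_functional ler_wpM2l ?invr_ge0//.
  apply: ler_sum => i _; rewrite ler_wpM2l ?invr_ge0//; apply: ler_sum => j _.
  apply: Emono; [exact: maff|exact: maff|] => y Yy.
  by apply: ler_wpM2r; [exact: weight_ge0|apply: fg; exact: rzX].
Qed.

Lemma product_functional1 N n r z : (0 < N)%N -> (0 < n)%N ->
  product_functional N n r z (fun=> 1) = E (weight c).
Proof.
move=> N0 n0; have NR : N%:R != 0 :> R by rewrite pnatr_eq0 -lt0n.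
have nR : n%:R != 0 :> R by rewrite pnatr_eq0 -lt0n.
have e : E (fun y => 1 * weight c y) = E (weight c).
  by congr E; apply/funext => y; rewrite mul1r.
rewrite /product_functional.
under eq_bigr => i _.
  under eq_bigr => j _ do rewrite e.
  rewrite sumr_const card_ord -(mulr_natl (E (weight c)) n) mulKf//.
over.
by rewrite sumr_const card_ord -(mulr_natl (E (weight c)) N) mulKf.
Qed.

Lemma power_at_product N n r z xi :
  power_at (product_functional N n r z) xi =
  ((N%:R^-1 * \sum_(i < N) cos_transform 0 (r i * xi)) ^+ 2 +
   (N%:R^-1 * \sum_(i < N) cos_transform (pi / 2) (r i * xi)) ^+ 2) * avg_power n z xi.
Proof.
have [ED EZ _] := posE.
have mc x p : bounded_measurable (fun y => weight c y * cos (x * y - p)).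
  by apply: bounded_measurableM => //; exact: bounded_measurable_cos_phase.
have Ec i j : E (fun y => cos (xi * (r i * y + z j)) * weight c y) =
    cos (xi * z j) * cos_transform 0 (r i * xi) - sin (xi * z j) * cos_transform (pi / 2) (r i * xi).
  rewrite -mulNr -!EZ// -ED; [|exact: bounded_measurableZ|exact: bounded_measurableZ].
  congr E; apply/funext => y; rewrite subr0 cosBpihalf.
  rewrite (_ : xi * (r i * y + z j) = r i * xi * y + xi * z j); last ring.
  by rewrite cosD; ring.
have Es i j : E (fun y => sin (xi * (r i * y + z j)) * weight c y) =
    cos (xi * z j) * cos_transform (pi / 2) (r i * xi) + sin (xi * z j) * cos_transform 0 (r i * xi).
  rewrite -!EZ// -ED; [|exact: bounded_measurableZ|exact: bounded_measurableZ].
  congr E; apply/funext => y; rewrite subr0 cosBpihalf.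
  rewrite (_ : xi * (r i * y + z j) = r i * xi * y + xi * z j); last ring.
  by rewrite sinD; ring.
pose Pc : R := N%:R^-1 * \sum_(i < N) cos_transform 0 (r i * xi).
pose Ps : R := N%:R^-1 * \sum_(i < N) cos_transform (pi / 2) (r i * xi).
pose Zc : R := n%:R^-1 * \sum_(j < n) cos (xi * z j).
pose Zs : R := n%:R^-1 * \sum_(j < n) sin (xi * z j).
have sumP (u v : R) : N%:R^-1 * \sum_(i < N) (u * cos_transform 0 (r i * xi) +
    v * cos_transform (pi / 2) (r i * xi)) = u * Pc + v * Ps.
  by rewrite big_split/= -!mulr_sumr /Pc /Ps; ring.
(* These are the real and imaginary parts of the complex product (Zc + i Zs) (Pc + i Ps). *)
have -> : power_at (product_functional N n r z) xi =
    (Zc * Pc - Zs * Ps) ^+ 2 + (Zs * Pc + Zc * Ps) ^+ 2.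
  rewrite /power_at /product_functional; congr (_ ^+ 2 + _ ^+ 2).
    rewrite -mulNr -sumP; congr (_ * _); apply: eq_bigr => i _.
    under eq_bigr do rewrite Ec.
    by rewrite sumrB -!mulr_suml /Zc /Zs; ring.
  rewrite -sumP; congr (_ * _); apply: eq_bigr => i _.
  under eq_bigr do rewrite Es.
  by rewrite big_split/= -!mulr_suml /Zc /Zs; ring.
rewrite /avg_power -/Pc -/Ps -/Zc -/Zs; ring.
Qed.

Lemma cos_transform_le p x : `|cos_transform p x| <= E (weight c).
Proof.
have [ED EZ Emono] := posE.
have mc : bounded_measurable (fun y => weight c y * cos (x * y - p)).
  by apply: bounded_measurableM => //; exact: bounded_measurable_cos_phase.
have b y : `|weight c y * cos (x * y - p)| <= weight c y.
  by rewrite normrM ger0_norm ?weight_ge0// ler_piMr ?weight_ge0// ler_norml cos_geN1 cos_le1.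
rewrite ler_norml; apply/andP; split.
  rewrite -mulN1r -EZ//; apply: Emono => //; first exact: bounded_measurableZ.
  by move=> y _; rewrite mulN1r; have := b y; rewrite ler_norml => /andP[].
by apply: Emono => // y _; have := b y; rewrite ler_norml => /andP[].
Qed.

End product_functional.

(** * Uniform square summability for the discretized sumset *)

Section power_sum.
Context {R : realType}.
Variables (Y : set R) (E : (R -> R) -> R) (c : R).
Hypothesis posE : pos_functional Y E.
Variables (alpha : R) (pos : nat -> nat -> nat).
Hypothesis alpha01 : 0 <= alpha <= 1.
Hypothesis posP : cantor_scheme alpha pos.
Variables (B L sigma kappa C : R) (Psi : R -> R -> R).
Hypothesis prof : forall p, profile B L sigma (cos_transform E c p) (Psi p).
Hypothesis C_ge0 : 0 <= C.
Hypothesis exponent_itv : 0 <= sigma + kappa / 2 <= 1.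
Hypothesis decay : forall k (xi : R), 1 <= xi ->
  `|cantor_avg alpha pos (Psi 0) k xi| <= C * xi `^ (- (sigma + kappa / 2)) /\
  `|cantor_avg alpha pos (Psi (pi / 2)) k xi| <= C * xi `^ (- (sigma + kappa / 2)).

Let m := E (weight c).

Let L_ge0 : 0 <= L.
Proof. by have [/(_ 0 1) + _ _] := prof 0; rewrite expr1n mulr1; exact: le_trans. Qed.

Let m_ge0 : 0 <= m.
Proof. exact: le_trans (cos_transform_le c posE 0 0). Qed.

(** The constant has three sources: C is the decay of the Cantor averages; 3 L is the passage from
    cell averages to points, whose error 3 L xi / 2^k is at most 3 L / xi when xi^2 <= 2^k; m is the
    trivial bound, used for xi < 1. *)
Let avg_le k (xi p : R) : 0 < xi -> xi ^+ 2 <= 2 ^+ k -> p = 0 \/ p = pi / 2 ->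
  ((cells alpha k)%:R^-1 * \sum_(i < cells alpha k) cos_transform E c p (cantor_point alpha pos k i * xi)) ^+ 2
  <= (C + 3 * L + m) ^+ 2 * xi `^ (- (2 * (sigma + kappa / 2))).
Proof.
move=> xi0 xik pE; have /andP[e0 e1] := exponent_itv.
set T := _ * \sum_(i < _) _; set e := sigma + kappa / 2.
have -> : xi `^ (- (2 * e)) = (xi `^ (- e)) ^+ 2.
  by rewrite -powR_mulrn ?powR_ge0// -powRrM; congr powR; lra.
rewrite -exprMn -[leLHS]real_normK ?num_real//.
have D0 : 0 <= C + 3 * L + m by rewrite !addr_ge0// mulr_ge0.
rewrite lerXn2r ?nnegrE ?mulr_ge0 ?powR_ge0//.
have [x1|x1] := leP 1 xi; last first.
  have p1 : 1 <= xi `^ (- e).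
    rewrite powRN invf_ge1 ?powR_gt0// -[leRHS](powRr0 xi).
    by rewrite ger_powR// xi0/= ltW.
  have Tm : `|T| <= m.
    rewrite /T normrM normfV normr_nat ler_pdivrMl ?ltr0n ?cells_gt0//.
    apply: (le_trans (ler_norm_sum _ _ _)).
    apply: (@le_trans _ _ (\sum_(i < cells alpha k) m)).
      by apply: ler_sum => i _; exact: cos_transform_le posE p _.
    by rewrite sumr_const card_ord (mulr_natl m (cells alpha k)).
  apply: (le_trans Tm); apply: (@le_trans _ _ (C + 3 * L + m)).
    by rewrite lerDr addr_ge0// mulr_ge0.
  by rewrite ler_peMr.
have dec : `|cantor_avg alpha pos (Psi p) k xi| <= C * xi `^ (- e).
  by have [h1 h2] := decay k x1; case: pE => ->.
have close := cantor_point_avg alpha01 posP k (prof p) x1.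
have far : 3 * L * (xi / 2 ^+ k) <= 3 * L * xi `^ (- e).
  rewrite ler_wpM2l ?mulr_ge0//; apply: (@le_trans _ _ (xi `^ (-1))).
    rewrite powR_inv1 ?(ltW xi0)// ?ler_pdivrMr ?(exp2_gt0 k)// ler_pdivlMl// -expr2.
  by rewrite ler_powR//; rewrite lerN2.
have := ler_normD (T - cantor_avg alpha pos (Psi p) k xi) (cantor_avg alpha pos (Psi p) k xi).
rewrite subrK => /le_trans; apply.
rewrite !mulrDl.
have : 0 <= m * xi `^ (- e) by rewrite mulr_ge0 ?powR_ge0.
move: close; rewrite -/T; lra.
Qed.

Variables (t a CG : R) (G : R -> R).
Hypothesis t_itv : 0 <= t < 1.
Hypothesis a_itv : 0 < a <= 1.
Hypothesis CG_gt0 : 0 < CG.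
Hypothesis G_close : forall u v : R, 0 <= u < 1 -> 0 <= v < 1 -> a * `|G u - G v| <= 1.
Hypothesis G_holder : forall u v : R, 0 <= u < 1 -> 0 <= v < 1 ->
  `|u - v| <= CG * `|G u - G v| `^ t.
Hypothesis exponent_gt : 1 < t + 2 * (sigma + kappa / 2).

(** Adapted to the frequencies up to 2^J. [avg_power_sum_le] asks for 2^J points on the side of Z,
    and level 2 J on the Cantor side ensures xi^2 <= 2^(2 J), so that sampling at finitely many r is
    accurate enough. *)
Definition scale_functional J : (R -> R) -> R :=
  product_functional E c (cells alpha (2 * J)) (2 ^ J) (cantor_point alpha pos (2 * J))
    (fun j => G (j%:R / (2 ^ J)%:R)).

(** The Cantor factor decays like l^-kap with kap = 2 sigma + kappa, and the energy of the Z factor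
    up to 2^i is O(2^((1 - t) i)). The dyadic block i thus contributes O(2^((1 - t - kap) i)), which
    is summable by [exponent_gt]. *)
Lemma scale_functional_power_le : exists M, forall J,
  \sum_(l < 2 ^ J) power_at (scale_functional J) (l%:R * a) <= M.
Proof.
have /andP[a0 a1] := a_itv; have /andP[t0 t1] := t_itv.
have /andP[e0 e1] := exponent_itv.
pose kap := 2 * (sigma + kappa / 2).
have kap0 : 0 <= kap by rewrite mulr_ge0.
have [BG BG0 HBG] := avg_power_sum_le CG_gt0 a0 t_itv.
pose D := C + 3 * L + m.
(* The first term serves l > 0, after extracting a^-kap from the frequency l a; the second serves l
   = 0. *)
pose A := 2 * D ^+ 2 * a `^ (- kap) + 2 * m ^+ 2.
have A1 : 0 <= 2 * D ^+ 2 * a `^ (- kap).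
  by rewrite mulr_ge0 ?powR_ge0// mulr_ge0// sqr_ge0.
have A2 : 0 <= 2 * m ^+ 2 by rewrite mulr_ge0// sqr_ge0.
have A0 : 0 <= A by rewrite addr_ge0.
pose rho : R := 2 `^ (1 - t).
pose q := rho * 2 `^ (- kap).
have q01 : 0 <= q < 1.
  rewrite mulr_ge0 ?powR_ge0//= /q /rho -powRD ?pnatr_eq0 ?implybT//.
  rewrite (_ : 1 - t + - kap = - (t + kap - 1)); last ring.
  by rewrite powRN invf_lt1 ?powR_gt0// powR2_gt1//; have := exponent_gt; rewrite -/kap; lra.
exists (A * BG * (1 + rho * (1 - q)^-1)) => J.
set n := (2 ^ J)%N; set k := (2 * J)%N.
have n0 : 0 < n%:R :> R by rewrite ltr0n expn_gt0.
pose z j := G (j%:R / n%:R).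
have jn j : (j < n)%N -> 0 <= (j%:R / n%:R : R) < 1.
  by move=> h; rewrite divr_ge0//= ltr_pdivrMr// mul1r ltr_nat.
pose P l := ((cells alpha k)%:R^-1 * \sum_(i < cells alpha k)
      cos_transform E c 0 (cantor_point alpha pos k i * (l%:R * a))) ^+ 2 +
   ((cells alpha k)%:R^-1 * \sum_(i < cells alpha k)
      cos_transform E c (pi / 2) (cantor_point alpha pos k i * (l%:R * a))) ^+ 2.
have PE l : power_at (scale_functional J) (l%:R * a) = P l * avg_power n z (l%:R * a).
  by rewrite /scale_functional (power_at_product c posE).
under eq_bigr do rewrite PE.
apply: (@le_trans _ _ (A * BG * (1 + rho * \sum_(i < J) q ^+ i))); last first.
  rewrite ler_wpM2l ?mulr_ge0 ?(ltW BG0)// lerD2l ler_wpM2l ?powR_ge0//.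
  exact: geometric_sum_lt1_le.
apply: (@dyadic_sum_prod_le R P (fun l => avg_power n z (l%:R * a)) A BG kap rho J) => //.
- by move=> l; exact: avg_power_ge0.
- have mm p : ((cells alpha k)%:R^-1 * \sum_(i < cells alpha k)
      cos_transform E c p (cantor_point alpha pos k i * (0%:R * a))) ^+ 2 <= m ^+ 2.
    rewrite -[leLHS]real_normK ?num_real// lerXn2r ?nnegrE//.
    rewrite normrM normfV normr_nat ler_pdivrMl ?ltr0n ?cells_gt0//.
    apply: (le_trans (ler_norm_sum _ _ _)).
    apply: (@le_trans _ _ (\sum_(i < cells alpha k) m)).
      by apply: ler_sum => i _; exact: cos_transform_le posE p _.
    by rewrite sumr_const card_ord (mulr_natl m (cells alpha k)).
  rewrite /P; have := mm 0; have := mm (pi / 2).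
  by rewrite /A; lra.
- move=> l /andP[l0 lJ].
  have la0 : 0 < l%:R * a by rewrite mulr_gt0 ?ltr0n.
  have lak : (l%:R * a) ^+ 2 <= 2 ^+ k.
    rewrite /k mulnC exprM lerXn2r ?nnegrE ?(ltW la0)// ?(ltW (exp2_gt0 _))//.
    apply: (@le_trans _ _ l%:R); first by rewrite ler_piMr.
    by rewrite -natrX ler_nat ltnW.
  have h1 := avg_le la0 lak (or_introl erefl).
  have h2 := avg_le la0 lak (or_intror erefl).
  have l0R : 0 <= l%:R :> R by [].
  apply: (@le_trans _ _ (2 * D ^+ 2 * (l%:R * a) `^ (- kap))).
    rewrite -/D -/kap in h1 h2; apply: (le_trans (lerD h1 h2)).
    by rewrite le_eqVlt; apply/orP; left; apply/eqP; ring.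
  rewrite (powRM _ l0R (ltW a0)) /A [leRHS]mulrDl.
  have : 0 <= 2 * m ^+ 2 * l%:R `^ (- kap) by rewrite mulr_ge0 ?powR_ge0.
  rewrite (_ : 2 * D ^+ 2 * (l%:R `^ (- kap) * a `^ (- kap)) =
    2 * D ^+ 2 * a `^ (- kap) * l%:R `^ (- kap)); last ring.
  lra.
- move=> i iJ; apply: HBG.
  + by rewrite leq_exp2l.
  + by move=> j j' /jn hj /jn hj'; exact: G_close.
  + move=> j j' /jn hj /jn hj'; have := G_holder hj hj'.
    rewrite -mulrBl normrM normfV normr_nat ler_pdivrMr// => /le_trans; apply.
    by rewrite mulrAC.
Qed.

End power_sum.

(** * Positive Lebesgue measure from bounded power sums *)

Section lebesgue_gt0.
Context {R : realType}.
Implicit Types X : set R.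

Let near_set X n : set R := \bigcup_(x in X) ball x (n.+1%:R^-1).

Let near_set_measurable X n : measurable (near_set X n).
Proof.
by apply: open_measurable; apply: bigcup_open => x _; exact: ball_open.
Qed.

(** The open neighbourhoods of X of radius 1 / (n + 1) have finite measure and decrease to X, which
    is closed; so their measures tend to that of X. *)
Lemma compact_lebesgue_nbhd X e : compact X -> lebesgue_measure X = 0%E -> 0 < e ->
  exists2 d : R, 0 < d & exists U : set R,
    [/\ measurable U, (lebesgue_measure U < e%:E)%E &
      forall x y, X x -> `|x - y| < d -> U y].
Proof.
move=> cX X0 e0; have [L L1 XL] := compact_norm_le cX.
have bounded : near_set X 0 `<=` `[- (L + 1), L + 1]%classic.
  move=> y [x Xx]; rewrite /ball/= invr1 => xy.
  have := XL x Xx; move: xy; rewrite in_itv/= ltr_norml ler_norml; lra.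
have fin0 : (lebesgue_measure (near_set X 0) < +oo)%E.
  have mI : measurable (`[- (L + 1), L + 1]%classic : set R) by exact: measurable_itv.
  set I := `[- (L + 1), L + 1]%classic in mI bounded.
  have finI : (lebesgue_measure I < +oo)%E.
    by rewrite /I lebesgue_measure_itv/=; case: ifP => _; rewrite -?EFinB ltry.
  have := le_measure lebesgue_measure (mem_set (near_set_measurable X 0)) (mem_set mI) bounded.
  by move=> h; exact: le_lt_trans h finI.
have capE : \bigcap_n near_set X n = X.
  apply/seteqP; split => [y yX|x Xx n _]; last by exists x => //; exact: ballxx.
  apply: (compact_closed _ cX) => //= B /nbhs_ballP[r /= r0 rB].
  have [x Xx xy] := yX (Num.truncn r^-1) I.
  exists x; split => //; apply: rB; apply: ball_sym; apply: le_ball xy.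
  rewrite -[leRHS]invrK lef_pV2 ?posrE ?invr_gt0//.
  by apply: ltW; exact: truncnS_gt.
have decr : {homo near_set X : n m / (n <= m)%N >-> (m <= n)%O}.
  move=> n m nm; rewrite subsetEset => y [x Xx xy]; exists x => //.
  by apply: le_ball xy; rewrite lef_pV2 ?posrE ?ltr0n// ler_nat.
have mcap : measurable (\bigcap_n near_set X n) by rewrite capE; exact: compact_measurable.
have := nonincreasing_cvg_mu fin0 (near_set_measurable X) mcap decr.
rewrite capE => lim.
have nb : nbhs (lebesgue_measure X) [set x : \bar R | (x < e%:E)%E].
  by rewrite X0; apply: open_nbhs_nbhs; split; [exact: open_ereal_lt_ereal|rewrite /= lte_fin].
have [n _ /(_ n (leqnn n)) /= Hn] := lim _ nb.
exists (n.+1%:R^-1); first by rewrite invr_gt0 ltr0n.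
exists (near_set X n); split => // x y Xx xy; exists x => //.
Qed.

(* Were X Lebesgue null, it would be covered by o(N) of the N cells of size
   about 1 / N, and the uniform power bound would force E(1) = 0. *)
Lemma lebesgue_measure_gt0_of_power X (m a M : R) (E : nat -> (R -> R) -> R) :
  compact X -> 0 < m -> 0 < a ->
  (forall J, pos_functional X (E J)) -> (forall J, E J (fun=> 1) = m) ->
  (forall J, \sum_(l < 2 ^ J) power_at (E J) (l%:R * a) <= M) ->
  (0 < lebesgue_measure X)%E.
Proof.
move=> cX m0 a0 posE Em EM; rewrite lt0e measure_ge0 andbT; apply/eqP => X0.
have M0 : 0 < M.
  apply: lt_le_trans (EM 0%N); rewrite expn0 big_ord1 mul0r.
  by rewrite (power_at0 (posE 0%N)) Em exprn_gt0.
(* The covering bound reads m^2 <= 8 |H| M / N, and the cells have width eps = 1 / (2 a N): together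
   the cells hit by X have length |H| eps >= m^2 / (16 a M), independently of J. *)
pose c := m ^+ 2 / (16 * a * M).
have c0 : 0 < c by rewrite divr_gt0 ?exprn_gt0// !mulr_gt0.
have [d d0 [U [mU Uc XU]]] := compact_lebesgue_nbhd cX X0 c0.
have [L L1 XL] := compact_norm_le cX.
(* J is taken so large that eps < d: every cell that meets X then lies entirely in [U]. *)
have [J HJ] := powR2_unbounded (1 / (2 * a * d)) ltr01.
have N0 : 0 < (2 ^ J)%:R :> R by rewrite ltr0n expn_gt0.
pose eps := 1 / (2 * a * (2 ^ J)%:R).
have e0 : 0 < eps by rewrite divr_gt0// !mulr_gt0.
have ed : eps < d.
  move: HJ; rewrite (mul1r J%:R) powR_mulrn// -natrX ltr_pdivrMr ?mulr_gt0//.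
  by rewrite /eps ltr_pdivrMr ?mulr_gt0// [_ * (2 * a * d)](_ : _ = d * (2 * a * (2 ^ J)%:R)) //; ring.
have Nae : (2 ^ J)%:R * a * eps <= 1 / 2.
  by rewrite /eps le_eqVlt; apply/orP; left; apply/eqP; field; rewrite !gt_eqF.
pose cell i : set R := `[- L + i%:R * eps, - L + i.+1%:R * eps[%classic.
pose hit i := `[< exists2 x, X x & cell i x >].
pose K := (Num.truncn (2 * L / eps)).+1.
pose H := [seq i <- iota 0 K | hit i].
have cov x : X x -> exists2 i, i \in H & cell i x.
  move=> Xx; have := XL _ Xx; rewrite ler_norml => /andP[x1 x2].
  have q0 : 0 <= (x + L) / eps by rewrite divr_ge0 ?(ltW e0)//; lra.
  have /andP[t1 t2] := truncn_itv q0.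
  have xc : cell (Num.truncn ((x + L) / eps)) x.
    move: t1 t2; rewrite /cell/= in_itv/= ler_pdivlMr// ltr_pdivrMr//; lra.
  exists (Num.truncn ((x + L) / eps)) => //.
  rewrite mem_filter mem_iota/= add0n ltnS; apply/andP; split.
    by apply/asboolP; exists x.
  by apply: le_truncn; rewrite ler_wpM2r ?invr_ge0 ?(ltW e0)//; lra.
have uH : uniq H by rewrite filter_uniq// iota_uniq.
have n0 : (0 < 2 ^ J)%N by rewrite expn_gt0.
have count : c <= (size H)%:R * eps.
  have := pos_functional_cover_le (posE J) e0 a0 n0 Nae uH cov.
  rewrite Em => h; have : m ^+ 2 <= 8 * (size H)%:R / (2 ^ J)%:R * M.
    by apply: (le_trans h); rewrite ler_wpM2l// divr_ge0// mulr_ge0.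
  rewrite /c ler_pdivrMr ?mulr_gt0// => /le_trans; apply.
  by rewrite le_eqVlt; apply/orP; left; apply/eqP; rewrite /eps; field; rewrite !gt_eqF.
pose F i := if hit i then cell i else set0.
have mF i : measurable (F i) by rewrite /F; case: ifP => // _; exact: measurable_itv.
have tF : trivIset setT F.
  apply/trivIsetP => i j _ _ ij; rewrite /F; case: ifP => _; last by rewrite set0I.
  case: ifP => _; last by rewrite setI0.
  rewrite -subset0 => x []; rewrite /cell/= !in_itv/= => /andP[i1 i2] /andP[j1 j2].
  have ij1 : (i < j.+1)%N by rewrite -(ltr_nat R) -(ltr_pM2r e0); lra.
  have ji1 : (j < i.+1)%N by rewrite -(ltr_nat R) -(ltr_pM2r e0); lra.
  by move: ij; rewrite eqn_leq -ltnS ij1 -ltnS ji1.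
have FU : \big[setU/set0]_(i < K) F i `<=` U.
  rewrite -bigcup_mkord => y [i _]; rewrite /F; case: ifP => // /asboolP[x Xx].
  rewrite /cell/= !in_itv/= => /andP[i1 i2] /andP[j1 j2].
  apply: (XU x y Xx); apply: lt_trans ed; rewrite ltr_norml.
  by move: i1 i2 j1 j2; rewrite -[i.+1%:R]natr1 mulrDl mul1r; lra.
have muF : lebesgue_measure (\big[setU/set0]_(i < K) F i) = ((size H)%:R * eps)%:E.
  rewrite measure_bigsetU//.
  have -> : (size H)%:R * eps = \sum_(i < K) (if hit i then eps else 0).
    rewrite -(big_mkord xpredT (fun i => if hit i then eps else 0)).
    rewrite -big_mkcond -big_filter /index_iota subn0 -/H.
    by rewrite big_const_seq count_predT iter_addr_0 mulr_natl.
  rewrite -sumEFin; apply: eq_bigr => i _; rewrite /F; case: ifP => _; last exact: measure0.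
  have := lebesgue_measure_itv `[- L + i%:R * eps, - L + i.+1%:R * eps[.
  rewrite /= lte_fin ltrD2l ltr_pM2r// ltr_nat ltnSn -EFinB => mucell.
  apply: etrans mucell _; congr EFin; rewrite -[i.+1%:R]natr1; ring.
have mFK : measurable (\big[setU/set0]_(i < K) F i) by exact: bigsetU_measurable.
have := le_measure lebesgue_measure (mem_set mFK) (mem_set mU) FU.
rewrite /= muF => /le_lt_trans /(_ Uc); rewrite lte_fin ltNge.
by rewrite count.
Qed.

End lebesgue_gt0.

(** * Choice of the scheme and of the exponents *)

Section construction.
Context {R : realType}.

(** The order of the quantifiers matters: the scheme is fixed before kappa, since one and the same
    set must have Fourier decay for every kappa < alpha. *)
Lemma exists_cantor_scheme_decay (alpha B L : R) J (sigma : 'I_J -> R) (phi Psi : 'I_J -> R -> R) :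
  0 <= alpha <= 1 -> 0 < B -> (forall j, 0 <= sigma j <= 1) ->
  (forall j, profile B L (sigma j) (phi j) (Psi j)) ->
  exists2 pos, cantor_scheme alpha pos & forall kappa, kappa = 0 \/ 0 <= kappa < alpha ->
    exists2 C, 0 <= C & forall j k (xi : R), 1 <= xi ->
      `|cantor_avg alpha pos (Psi j) k xi| <= C * xi `^ (- (sigma j + kappa / 2)).
Proof.
move=> alpha01 B0 sigma01 prof.
have [pos posP posK] := exists_cantor_scheme alpha01 prof sigma01 B0.
exists pos => // kappa kappaP.
have /choice[C HC] j : exists C, forall k (xi : R), 1 <= xi ->
    `|cantor_avg alpha pos (Psi j) k xi| <= C * xi `^ (- (sigma j + kappa / 2)).
  exact: (cantor_avg_decay alpha01 (prof j) (sigma01 j) (posK^~ j) kappaP).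
exists (\sum_j `|C j|) => [|j k xi x1]; first exact: sumr_ge0.
apply: (le_trans (HC j k xi x1)); rewrite ler_wpM2r ?powR_ge0//.
apply: (le_trans (ler_norm _)); rewrite (bigD1 j)//= lerDl; exact: sumr_ge0.
Qed.

Lemma exists_exponents (dF dH alpha : R) (F : set R) :
  (forall s, F s -> 0 < s < 1) -> dF = sup F -> dH <= 1 -> 0 <= alpha <= 1 ->
  1 - alpha < dF + dH ->
  exists s t kappa, [/\ s = 0 \/ F s, 0 <= s < 1, 0 <= t < 1, 0 < t -> t < dH &
    (kappa = 0 \/ 0 <= kappa < alpha) /\ 1 < s + t + kappa].
Proof.
(* The excess over 1 is 4 eta, and each of s, t, kappa gives up at most eta. Where giving up eta
   would leave nothing positive, or where [F] has no supremum and [sup F] defaults to 0, the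
   exponent 0 is taken. *)
move=> F01 -> dH1 /andP[a0 a1] gt1; pose eta := (sup F + dH + alpha - 1) / 4.
have eta0 : 0 < eta by rewrite /eta; lra.
have [s sP [s01 sF]] : exists2 s, s = 0 \/ F s & 0 <= s < 1 /\ sup F - eta < s.
  have [F0|F0] := ltP 0 (sup F); last first.
    exists 0; first by left.
    by rewrite lexx ltr01; split => //; lra.
  have hasF : has_sup F by apply: contrapT => /sup_out F_eq0; rewrite F_eq0 ltxx in F0.
  have [/= s Fs sF] := sup_adherent eta0 hasF.
  exists s; first by right.
  by have /andP[h1 h2] := F01 _ Fs; rewrite (ltW h1) h2.
have [kappa kP ka] : exists2 kappa, kappa = 0 \/ 0 <= kappa < alpha & alpha - eta <= kappa.
  have [h|h] := ltP eta alpha; [exists (alpha - eta) => //|exists 0; [by left|lra]].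
  by right; lra.
have [t [t01 td tt]] : exists t, [/\ 0 <= t < 1, 0 < t -> t < dH & dH - eta <= t].
  have [h|h] := ltP eta dH; [exists (dH - eta)|exists 0]; split => //; try lra.
exists s, t, kappa; split => //; split => //.
by move: sF ka tt; rewrite /eta; lra.
Qed.

Lemma sumset_compact (S Y Z : set R) : compact S -> compact Y -> compact Z ->
  compact [set x | exists r y z, [/\ S r, Y y, Z z & x = r * y + z]].
Proof.
move=> cS cY cZ.
have -> : [set x | exists r y z, [/\ S r, Y y, Z z & x = r * y + z]] =
    (fun p : R * R * R => p.1.1 * p.1.2 + p.2) @` (S `*` Y `*` Z).
  apply/seteqP; split => [_ [r [y [z [Sr Yy Zz ->]]]]|_ [[[r y] z] [[Sr Yy] Zz] <-]].
    by exists (r, y, z).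
  by exists r, y, z.
apply: continuous_compact; last by apply: compact_setX => //; exact: compact_setX.
apply: continuous_subspaceT => p; apply: cvgD; last exact: cvg_snd.
by apply: cvgM; apply: (@cvg_comp _ _ _ fst _ _ _ _ (@cvg_fst _ _ _ _ _)); [exact: cvg_fst|exact: cvg_snd].
Qed.

End construction.

Theorem corollary1p7 (R : realType) (Y Z : set R) (alpha : R)
    (Y_nonempty : Y !=set0) (Z_nonempty : Z !=set0)
    (Y_compact : compact Y) (Z_compact : compact Z)
    (Y_nonzero : exists2 y, Y y & y != 0)
    (dim_pos : 0 < dim_F Y + dim_H Z)
    (alpha_ge0 : 0 <= alpha) (alpha_le1 : alpha <= 1)
    (dim_gt : 1 - alpha < dim_F Y + dim_H Z) :
  exists S : set R,
    [/\ compact S,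
        S `<=` [set r | 0 < r],
        dim_H S = alpha,
        dim_F S = alpha
      & (0 < lebesgue_measure
               [set x | exists r y z, [/\ S r, Y y, Z z & x = r * y + z]%R])%E].
Proof.
have alpha01 : 0 <= alpha <= 1 by rewrite alpha_ge0.
have [y0 Yy0 y00] := Y_nonzero.
have exp01 s : fourier_exponents Y s -> 0 < s < 1 by case=> -> ->.
have [s [t [kappa [sP s01 t01 tP [kappaP exps]]]]] :=
  exists_exponents exp01 (erefl : dim_F Y = sup (fourier_exponents Y))
    (dim_H_le1 Z_compact) alpha01 dim_gt.
have /andP[s0 s1] := s01; have /andP[t0 _] := t01.
have kappa01 : 0 <= kappa <= 1 by case: kappaP => [->|/andP[? ?]]; lra.
have [E [c [C [posE c_itv C0 decayE m0]]]] := exists_weighted_functional Y_compact Yy0 y00 sP.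
have [ylim _ Yle] := compact_norm_le Y_compact.
have [zlim zlim1 Zle] := compact_norm_le Z_compact.
have [G [CG [CG0 GZ Gholder]]] := frostman_dim_H Z_nonempty Z_compact t0 tP.
have sigma01 : 0 <= s / 2 <= 1 by lra.
have wprof := weighted_profile posE Yle sigma01 C0 c_itv decayE.
set Psi := fun p x => E (fun y => weight_quotient c y * sin (x * y - p)).
set L' := c * ylim ^+ 2 * E (fun=> 1) in wprof.
(* Common constants for all profiles: 1 serves cosine and sine, 2 C and [L'] serve the weighted
   transform. *)
pose B := 1 + 2 * C; pose L := 1 + L'.
have L'0 : 0 <= L'.
  by have [/(_ 0 1) + _ _] := wprof 0; rewrite expr1n mulr1; exact: le_trans.
have B1 : 1 <= B by rewrite lerDl mulr_ge0.
have L1 : 1 <= L by rewrite lerDl.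
have prof p : profile B L (s / 2) (cos_transform E c p) (Psi p).
  by apply: profile_le (wprof p); rewrite lerDr.
(* The first two profiles give the Cantor set its Fourier dimension; the last two fit it to the two
   real components of the weighted transform on [Y]. *)
pose sigma (j : 'I_4) := nth 0 [:: 0; 0; s / 2; s / 2] j.
pose phi (j : 'I_4) := nth cos [:: cos; sin; cos_transform E c 0; cos_transform E c (pi / 2)] j.
pose Phi (j : 'I_4) := nth cos [:: sin; (fun x => - cos x); Psi 0; Psi (pi / 2)] j.
have profs j : profile B L (sigma j) (phi j) (Phi j).
  case: j => [[|[|[|[|//]]]]] ?; rewrite /sigma /phi /Phi/=.
  - exact: profile_le cos_profile.
  - exact: profile_le sin_profile.
  - exact: prof.
  - exact: prof.
have sigmas j : 0 <= sigma j <= 1.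
  by case: j => [[|[|[|[|//]]]]] ?; rewrite /sigma/= ?lexx ?ler01.
have B0 : 0 < B by apply: lt_le_trans B1.
have [pos posP decay] := exists_cantor_scheme_decay alpha01 B0 sigmas profs.
have decay_sin kap : 0 <= kap < alpha -> exists C, forall k xi, 1 <= xi ->
    `|cantor_avg alpha pos sin k xi| <= C * xi `^ (- (0 + kap / 2)) /\
    `|cantor_avg alpha pos (fun x => - cos x) k xi| <= C * xi `^ (- (0 + kap / 2)).
  move=> /or_intror /decay [D D0 HD]; exists D => k xi x1.
  by split; [exact: (HD (@Ordinal 4 0 isT))|exact: (HD (@Ordinal 4 1 isT))].
exists (cantor_set alpha pos); split.
- exact: cantor_set_compact.
- by move=> x /(cantor_set_bounds alpha01 posP); rewrite /= in_itv/= => /andP[x1 _]; lra.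
- exact: dim_H_cantor_set.
- exact: dim_F_cantor_set.
have [D D0 HD] := decay kappa kappaP.
have decayY k xi : 1 <= xi ->
    `|cantor_avg alpha pos (Psi 0) k xi| <= D * xi `^ (- (s / 2 + kappa / 2)) /\
    `|cantor_avg alpha pos (Psi (pi / 2)) k xi| <= D * xi `^ (- (s / 2 + kappa / 2)).
  by move=> x1; split; [exact: (HD (@Ordinal 4 2 isT))|exact: (HD (@Ordinal 4 3 isT))].
(* The frequency spacing is fitted to the diameter of [Z], at most 2 zlim: the phases a (z - z')
   then stay in [-1, 1], within the range of the Dirichlet kernel bound. *)
pose a := (2 * zlim)^-1.
have zlim0 : 0 < 2 * zlim by lra.
have a01 : 0 < a <= 1 by rewrite invr_gt0 zlim0 invf_le1//; lra.
have exp1 : 0 <= s / 2 + kappa / 2 <= 1 by lra.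
have expt : 1 < t + 2 * (s / 2 + kappa / 2) by lra.
have Gclose u v : 0 <= u < 1 -> 0 <= v < 1 -> a * `|G u - G v| <= 1.
  move=> /GZ /Zle hu /GZ /Zle hv; rewrite ler_pdivrMl// mulr1.
  by apply: (le_trans (ler_normB _ _)); lra.
have [M HM] := scale_functional_power_le posE alpha01 posP prof D0 exp1 decayY t01 a01 CG0 Gclose Gholder expt.
have /andP[a0 _] := a01.
apply: (lebesgue_measure_gt0_of_power _ m0 a0 _ _ HM).
- exact: sumset_compact (cantor_set_compact alpha01 posP) Y_compact Z_compact.
- move=> J; rewrite /scale_functional; have := product_pos_functional c posE; apply => i j y iN jn Yy.
  exists (cantor_point alpha pos (2 * J) i), y, (G (j%:R / (2 ^ J)%:R)); split => //.
    exact: cantor_point_in.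
  apply: GZ; rewrite divr_ge0//= ltr_pdivrMr ?ltr0n ?expn_gt0// mul1r ltr_nat//.
- by move=> J; apply: product_functional1; rewrite ?cells_gt0 ?expn_gt0.
Qed.
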